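(* Let $k$ be a field of characteristic zero, and let $\mathfrak{R}=\mathfrak{D}^{\langle\mu\rangle}$ be the ring defined in the context. Then $\mathfrak{R}$ has the strong transitivity property and its plinth invariant is $k$.
   Context: Let $\mathfrak{D}=k[x_0,x_1,x_2]$ with $2x_0x_2-x_1^2=1$, i.e. $\mathfrak{D}$ is the quotient of the polynomial ring $k[X_0,X_1,X_2]$ by the ideal $(2X_0X_2-X_1^2-1)$. Let $\mu$ be the $k$-automorphism of $\mathfrak{D}$ with $\mu(x_i)=-x_i$ for $i=0,1,2$, and let $\mathfrak{R}=\mathfrak{D}^{\langle\mu\rangle}=k[x_0^2,x_0x_1,x_0x_2,x_1^2,x_1x_2,x_2^2]$. For an affine $k$-domain $B$: a $k$-derivation $D$ of $B$ is locally nilpotent if for each $b\in B$, $D^nb=0$ for $n\gg 0$; $\mathrm{LND}(B)$ is the set of locally nilpotent derivations of $B$; $\ker D$ is the kernel of $D$, and $\mathrm{pl}(D)=\ker D\cap DB$ is its plinth ideal (an ideal of $\ker D$). $D\in\mathrm{LND}(B)$ is irreducible if $DB$ is contained in no proper principal ideal of $B$, and $\mathrm{ILND}(B)$ is the set of irreducible $D\in\mathrm{LND}(B)$. The group $\mathrm{Aut}_k(B)$ of $k$-algebra automorphisms acts on $\mathrm{ILND}(B)$ by conjugation $D\mapsto\alpha D\alpha^{-1}$. The Makar-Limanov invariant is $ML(B)=\bigcap_{D\in\mathrm{LND}(B)}\ker D$. $k^{[n]}$ denotes the polynomial ring in $n$ variables over $k$. Let $\mathcal{C}(k)$ be the class of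 rings $B$ such that (a) $B$ is a normal affine $k$-domain, $\dim B=2$, $B^*=k^*$ and $ML(B)\neq B$; and (b) $\ker D\cong_k k^{[1]}$ for every nonzero $D\in\mathrm{LND}(B)$. The ring $\mathfrak{R}$ belongs to $\mathcal{C}(k)$. For $B\in\mathcal{C}(k)$: - $B$ has the strong transitivity property if the action of $\mathrm{Aut}_k(B)$ on $\mathrm{ILND}(B)$ is transitive. - If $B$ has the strong transitivity property and $B\not\cong_k k^{[2]}$, the plinth invariant of $B$ is the isomorphism class, as a $k$-algebra, of $\ker D/\mathrm{pl}(D)$ for $D\in\mathrm{ILND}(B)$ (independent of the choice of $D$). *)

(* Defs.v *)
From HB Require Import structures.
From mathcomp Require Import all_boot all_algebra.
From mathcomp Require Import generic_quotient ring_quotient boolp.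
From mathcomp.multinomials Require Import mpoly.

Set Implicit Arguments.
Unset Strict Implicit.
Unset Printing Implicit Defensive.

Import GRing.Theory.
Local Open Scope ring_scope.
Local Open Scope quotient_scope.

(* The library class [idealr] consists of proper ideals only; the plinth ideal
   of a derivation may be the unit ideal, hence the following record. *)
Record ideal (A : comNzRingType) := Ideal {
  ideal_pred :> {pred A};
  ideal_zmod_closed : zmod_closed ideal_pred;
  ideal_mull : forall a, {in ideal_pred, forall u, a * u \in ideal_pred}
}.

HB.instance Definition _ (A : comNzRingType) (I : ideal A) :=
  GRing.isZmodClosed.Build A (ideal_pred I) (ideal_zmod_closed I).

Section PrincipalIdeal.
Variables (A : comNzRingType) (f : A).

Definition principal_pred : {pred A} := fun a => `[< exists b, a = b * f >].

Lemma principal_zmod_closed : zmod_closed principal_pred.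
Proof.
split; first by apply/asboolP; exists 0; rewrite mul0r.
move=> _ _ /asboolP[b ->] /asboolP[c ->].
by apply/asboolP; exists (b - c); rewrite mulrBl.
Qed.

Lemma principal_mull a :
  {in principal_pred, forall u, a * u \in principal_pred}.
Proof.
by move=> _ /asboolP[b ->]; apply/asboolP; exists (a * b); rewrite mulrA.
Qed.

Definition principal : ideal A := Ideal principal_zmod_closed principal_mull.

End PrincipalIdeal.

(* The quotient algebra A / I is the library's quotient Z-module; it may be the
   zero ring, so that it is in general no [algType], but only a commutative
   ring [comPzRingType] and a k-module. *)
Section AlgQuotient.
Variables (k : fieldType) (A : comAlgType k) (I : ideal A).

Definition alg_quot := Quotient.quot (ideal_pred I).

HB.instance Definition _ := Choice.on alg_quot.
HB.instance Definition _ := GRing.Zmodule.on alg_quot.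
HB.instance Definition _ := EqQuotient.on alg_quot.

Definition quot_proj (a : A) : alg_quot := \pi_alg_quot a.

Lemma quot_proj_eq a b : (quot_proj a == quot_proj b) = (a - b \in ideal_pred I).
Proof. by rewrite Quotient.idealrBE. Qed.

Lemma quot_projK (x : alg_quot) : quot_proj (repr x) = x.
Proof. exact: reprK. Qed.

Lemma quot_projP (a : A) : repr (quot_proj a) - a \in ideal_pred I.
Proof. by rewrite -quot_proj_eq quot_projK. Qed.

Lemma quot_projD : {morph quot_proj : a b / a + b}.
Proof. exact: raddfD. Qed.

Lemma quot_proj0 : quot_proj 0 = 0.
Proof. exact: raddf0. Qed.

Definition quot_one : alg_quot := quot_proj 1.
Definition quot_mul (x y : alg_quot) : alg_quot := quot_proj (repr x * repr y).
Definition quot_scale (c : k) (x : alg_quot) : alg_quot :=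
  quot_proj (c *: repr x).

Lemma quot_mulE a b : quot_mul (quot_proj a) (quot_proj b) = quot_proj (a * b).
Proof.
apply/eqP; rewrite quot_proj_eq.
set a' := repr _; set b' := repr _.
have -> : a' * b' - a * b = b' * (a' - a) + a * (b' - b).
  by rewrite !mulrBr addrA [b' * a]mulrC subrK [b' * a']mulrC.
by rewrite rpredD // ideal_mull // quot_projP.
Qed.

Lemma quot_scaleE c a : quot_scale c (quot_proj a) = quot_proj (c *: a).
Proof.
apply/eqP; rewrite quot_proj_eq -scalerBr -mulr_algl.
by rewrite ideal_mull // quot_projP.
Qed.

Lemma quot_mulA : associative quot_mul.
Proof.
move=> x y z; rewrite -[x]quot_projK -[y]quot_projK -[z]quot_projK.
by rewrite !quot_mulE mulrA.
Qed.

Lemma quot_mulC : commutative quot_mul.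
Proof. by move=> x y; rewrite /quot_mul mulrC. Qed.

Lemma quot_mul1 : left_id quot_one quot_mul.
Proof. by move=> x; rewrite -[x]quot_projK quot_mulE mul1r. Qed.

Lemma quot_mulDl : left_distributive quot_mul +%R.
Proof.
move=> x y z; rewrite -[x]quot_projK -[y]quot_projK -[z]quot_projK.
by rewrite -quot_projD !quot_mulE mulrDl quot_projD.
Qed.

HB.instance Definition _ := GRing.Zmodule_isComPzRing.Build alg_quot
  quot_mulA quot_mulC quot_mul1 quot_mulDl.

Lemma quot_scaleA a b x : quot_scale a (quot_scale b x) = quot_scale (a * b) x.
Proof. by rewrite -[x]quot_projK !quot_scaleE scalerA. Qed.

Lemma quot_scale1 : left_id 1 quot_scale.
Proof. by move=> x; rewrite -[x]quot_projK quot_scaleE scale1r. Qed.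

Lemma quot_scaleDr : right_distributive quot_scale +%R.
Proof.
move=> c x y; rewrite -[x]quot_projK -[y]quot_projK.
by rewrite -quot_projD !quot_scaleE scalerDr quot_projD.
Qed.

Lemma quot_scaleDl x : {morph quot_scale^~ x : a b / a + b}.
Proof.
by move=> a b; rewrite -[x]quot_projK !quot_scaleE scalerDl quot_projD.
Qed.

HB.instance Definition _ := GRing.Zmodule_isLmodule.Build k alg_quot
  quot_scaleA quot_scale1 quot_scaleDr quot_scaleDl.

Lemma quot_scaleAl (c : k) (x y : alg_quot) : c *: (x * y) = (c *: x) * y.
Proof.
change (quot_scale c (quot_mul x y) = quot_mul (quot_scale c x) y).
rewrite -[x]quot_projK -[y]quot_projK.
by rewrite !(quot_mulE, quot_scaleE) scalerAl.
Qed.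

Lemma quot_proj_linear : linear quot_proj.
Proof.
by move=> c a b; rewrite quot_projD; congr (_ + _); rewrite -quot_scaleE.
Qed.
HB.instance Definition _ :=
  GRing.isLinear.Build k A alg_quot _ quot_proj quot_proj_linear.

Lemma quot_proj_monoid_morphism : monoid_morphism quot_proj.
Proof. by split=> // a b; rewrite -quot_mulE. Qed.
HB.instance Definition _ :=
  GRing.isMonoidMorphism.Build A alg_quot quot_proj quot_proj_monoid_morphism.

End AlgQuotient.

(* Stated as a notation because the two sides need not be nonzero rings. *)
Notation alg_iso A B :=
  (exists2 f : {linear A -> B}, monoid_morphism f & bijective f).

Section Subalgebra.
Variables (k : fieldType) (A : comAlgType k) (S : subalgClosed A).

Record subalg := Subalg { subalg_val : A; _ : subalg_val \in S }.

HB.instance Definition _ := [isSub for subalg_val].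
HB.instance Definition _ := [Choice of subalg by <:].
HB.instance Definition _ := GRing.SubChoice_isSubComNzRing.Build _ _ subalg
  (GRing.subalg_closedBM (GRing.subalgClosedP S)).
HB.instance Definition _ := [SubZmodule_isSubLmodule of subalg by <:].
HB.instance Definition _ := [SubNzRing_SubLmodule_isSubLalgebra of subalg by <:].
HB.instance Definition _ := [SubLalgebra_isSubAlgebra of subalg by <:].

End Subalgebra.

Section Derivations.
Variables (k : fieldType) (B : comAlgType k).

Record derivation := Derivation {
  der_fun :> {linear B -> B};
  der_leibniz : forall a b, der_fun (a * b) = a * der_fun b + der_fun a * b
}.

Definition locally_nilpotent (D : derivation) : Prop :=
  forall b, exists N, forall n, (N <= n)%N -> iter n D b = 0.

Definition der_irreducible (D : derivation) : Prop :=
  ~ exists a : B, (exists b, b \notin principal_pred a)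
               /\ (forall b, D b \in principal_pred a).

Definition ILND (D : derivation) : Prop :=
  locally_nilpotent D /\ der_irreducible D.

Section KernelPlinth.
Variable D : derivation.

Definition der_ker_pred : {pred B} := fun b => D b == 0.

Lemma der_ker_subalg_closed : GRing.subalg_closed der_ker_pred.
Proof.
split.
- have := der_leibniz D 1 1; rewrite !mulr1 mul1r.
  by move/(canLR (addrK _)); rewrite subrr => /esym/eqP.
- by move=> c a b /eqP Da /eqP Db; rewrite unfold_in linearP Da Db scaler0 addr0.
- by move=> a b /eqP Da /eqP Db; rewrite unfold_in der_leibniz Da Db mulr0 mul0r addr0.
Qed.
HB.instance Definition _ :=
  GRing.isSubalgClosed.Build k B der_ker_pred der_ker_subalg_closed.

Definition der_ker : Type := subalg der_ker_pred.
HB.instance Definition _ := GRing.ComAlgebra.on der_ker.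

Definition plinth_pred : {pred der_ker} :=
  fun a => `[< exists b, D b = subalg_val a >].

Lemma plinth_zmod_closed : zmod_closed plinth_pred.
Proof.
split; first by apply/asboolP; exists 0; rewrite linear0.
move=> x y /asboolP[a Da] /asboolP[b Db]; apply/asboolP; exists (a - b).
by rewrite linearB Da Db.
Qed.

Lemma plinth_mull a : {in plinth_pred, forall u, a * u \in plinth_pred}.
Proof.
move=> u /asboolP[b Db]; apply/asboolP; exists (subalg_val a * b).
by rewrite der_leibniz Db (eqP (valP a)) mul0r addr0.
Qed.

Definition plinth : ideal der_ker := Ideal plinth_zmod_closed plinth_mull.

End KernelPlinth.

Record alg_auto := AlgAuto {
  auto_fun :> {lrmorphism B -> B};
  auto_inv : {lrmorphism B -> B};
  auto_funK : cancel auto_fun auto_inv;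
  auto_invK : cancel auto_inv auto_fun
}.

(* A transitive action has exactly one orbit: the set acted upon is nonempty. *)
Definition strong_transitivity : Prop :=
  (exists D, ILND D) /\
  (forall D E, ILND D -> ILND E ->
     exists alpha : alg_auto, forall b, E b = alpha (D (auto_inv alpha b))).

(* The plinth invariant of [B] is the isomorphism class of [A]; this includes
   the conditions under which the invariant is defined. *)
Definition plinth_invariant_is (A : comAlgType k) : Prop :=
  [/\ strong_transitivity,
      ~ alg_iso B {mpoly k[2]}
    & forall D, ILND D -> alg_iso (alg_quot (plinth D)) A].

End Derivations.

Section RingD.
Variable k : fieldType.

Local Notation X i := ('X_(inord i) : {mpoly k[3]}).

Definition quadric : {mpoly k[3]} := 2%:R * X 0 * X 2 - X 1 ^+ 2 - 1.

Definition ringD : Type := alg_quot (principal quadric).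

HB.instance Definition _ := GRing.ComPzRing.on ringD.
HB.instance Definition _ := GRing.Lmodule.on ringD.

Lemma quadric_root : quadric.@[fun=> 1] = 0.
Proof.
rewrite /quadric !rmorphB /= expr2 !rmorphM /= rmorph_nat !mevalXU rmorph1.
by rewrite !mulr1 -addrA -opprD subrr.
Qed.

Lemma ringD_oner_neq0 : (1 : ringD) != 0.
Proof.
rewrite -[0](raddf0 (quot_proj (principal quadric))) quot_proj_eq subr0.
apply/asboolP=> -[p /(congr1 (meval (fun=> 1)))].
by rewrite mevalM quadric_root mulr0 meval1 => /eqP; rewrite oner_eq0.
Qed.
HB.instance Definition _ := GRing.PzSemiRing_isNonZero.Build ringD ringD_oner_neq0.
HB.instance Definition _ :=
  GRing.Lmodule_isLalgebra.Build k ringD (@quot_scaleAl k _ _).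
HB.instance Definition _ := GRing.Lalgebra_isComAlgebra.Build k ringD.

Definition projD : {mpoly k[3]} -> ringD := quot_proj (principal quadric).
HB.instance Definition _ :=
  GRing.Linear.copy projD (quot_proj (principal quadric)).
HB.instance Definition _ :=
  GRing.RMorphism.copy projD (quot_proj (principal quadric)).

Lemma ringD_relation (x := fun i => projD (X i)) :
  2%:R * x 0 * x 2 - x 1 ^+ 2 = 1.
Proof.
have : projD quadric = 0.
  apply/eqP; rewrite -(raddf0 projD) quot_proj_eq subr0.
  by apply/asboolP; exists 1; rewrite mul1r.
rewrite /quadric !rmorphB /= rmorphXn !rmorphM /= rmorph_nat rmorph1.
by move/eqP; rewrite subr_eq0 => /eqP.
Qed.

Definition sign_subst (p : {mpoly k[3]}) : {mpoly k[3]} :=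
  p \mPo [tuple - 'X_i | i < 3].
HB.instance Definition _ := GRing.LRMorphism.copy sign_subst
  (comp_mpoly [tuple - 'X_i | i < 3]).

Definition mu (x : ringD) : ringD := projD (sign_subst (repr x)).

Lemma sign_substX (i : 'I_3) : sign_subst 'X_i = - 'X_i.
Proof. by rewrite /sign_subst comp_mpolyXU -tnth_nth tnth_mktuple. Qed.

Lemma sign_subst_quadric : sign_subst quadric = quadric.
Proof.
rewrite /quadric !rmorphB /= expr2 !rmorphM /= rmorph_nat rmorph1.
by rewrite !sign_substX [2%:R * _]mulrN !mulrNN.
Qed.

Lemma mu_proj p : mu (projD p) = projD (sign_subst p).
Proof.
apply/eqP; rewrite quot_proj_eq -raddfB /=.
have /asboolP[q ->] := quot_projP (principal quadric) p.
apply/asboolP; exists (sign_subst q).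
by rewrite rmorphM /= sign_subst_quadric.
Qed.

Lemma mu_var (i : 'I_3) : mu (projD 'X_i) = - projD 'X_i.
Proof. by rewrite mu_proj sign_substX raddfN. Qed.

Lemma mu_linear : linear mu.
Proof.
move=> c x y; rewrite -[x]quot_projK -[y]quot_projK -/projD -linearP.
by rewrite !mu_proj !linearP.
Qed.
HB.instance Definition _ := GRing.isLinear.Build k ringD ringD _ mu mu_linear.

Lemma mu_monoid_morphism : monoid_morphism mu.
Proof.
split=> [|x y].
  by rewrite -[1 in LHS](rmorph1 projD) mu_proj !rmorph1.
rewrite -[x]quot_projK -[y]quot_projK -/projD -rmorphM.
by rewrite !mu_proj [sign_subst _]rmorphM [LHS]rmorphM.
Qed.
HB.instance Definition _ :=
  GRing.isMonoidMorphism.Build ringD ringD mu mu_monoid_morphism.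

Definition mu_fixed : {pred ringD} := fun x => mu x == x.

Lemma mu_fixed_subalg_closed : GRing.subalg_closed mu_fixed.
Proof.
split; first by rewrite unfold_in rmorph1.
- by move=> c x y /eqP mx /eqP my; rewrite unfold_in linearP /= mx my.
- by move=> x y /eqP mx /eqP my; rewrite unfold_in rmorphM /= mx my.
Qed.
HB.instance Definition _ :=
  GRing.isSubalgClosed.Build k ringD mu_fixed mu_fixed_subalg_closed.

(* An element is invariant under the group generated by [mu] if and only if it
   is fixed by [mu]. *)
Definition ringR : Type := subalg mu_fixed.
HB.instance Definition _ := GRing.ComAlgebra.on ringR.

End RingD.

(* Main.v *)
(* With y = 2 x2 the quadric reads x0 y = x1^2 + 1, and every element is a unique
   combination of normal forms x0^a x1^c and y^b x1^c.  Writing u^i v^j for the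
   normal form with x0 ~ u^2, x1 ~ uv, y ~ v^2, the product is that of k[u,v] up to
   terms of lower weight, for every weight of (u,v), and R is spanned by the u^i v^j
   with 4 | i + j.  So a locally nilpotent derivation E of R has a Newton polygon, and
   its top part for any weight is a homogeneous locally nilpotent derivation of the
   span of these monomials in k[u,v].
   Unless E lowers the degree in u or in v, the polygon has extreme vertices (p,-1) and
   (-1,q).  Say q <= p.  The top part along the edge between them forces
   p + 1 = (4c + 1)(q + 1), and homogeneous kernel elements of equal weight being
   proportional, it yields a shear x1 |-> x1 + la x0^(2c+1), with la in k itself, which
   decreases p + q.  By induction E is conjugate to a derivation lowering the degree in
   v; this one kills x0^2 and is a multiple of D : x0 |-> 0, x1 |-> x0, x2 |-> x1.
   If E is irreducible the multiple is a constant, which a torus automorphism absorbs.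
   Finally ker D = k[x0^2], in which the plinth ideal is generated by x0^2. *)
Require Import Defs.
From HB Require Import structures.
From mathcomp Require Import all_boot all_order all_algebra.
From mathcomp Require Import fraction boolp.
From mathcomp.multinomials Require Import mpoly ssrcomplements.
From mathcomp Require Import zify ring.

Set Implicit Arguments.
Unset Strict Implicit.
Unset Printing Implicit Defensive.

Import Order.TTheory GRing.Theory Num.Theory.
Local Open Scope ring_scope.

(** * Linear operators on k[u,v] and weights *)

(** A vertex of the polygon is reached by taking top parts for two independent weights in
    succession: the result translates monomials by a fixed (r, s), up to a factor linear in the
    exponents, and in characteristic 0 local nilpotency forces r = -1 or s = -1. As k is arbitrary,
    the shear must be found without extracting roots of polynomials. Along the edge, the degree of
    local nilpotency of u^4 and v^4 is proportional to their weight for (q+1, p+1). Hence x0 x1 =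
    u^3 v and x0^(2c+2) = u^(4c+4) agree in both, and their last nonzero iterates are homogeneous
    kernel elements of one weight; the ratio of these is the constant of the shear. Unless p = q,
    the slope is 4c+1 and not merely an odd number because a pure power of u in E(u^4) has exponent
    divisible by 4. This makes x0^(2c+1) an odd power, so that the shear commutes with the sign
    involution and restricts to R. That R is no polynomial ring is seen from slices: a partial
    derivative takes the value 1, the standard derivation never does. *)

Section IterLinear.
Variables (k : fieldType) (V : lmodType k) (E : {linear V -> V}).

Lemma iter_lin N c x y : iter N E (c *: x + y) = c *: iter N E x + iter N E y.
Proof. by elim: N => //= N ->; rewrite linearP. Qed.
Lemma iter_lin0 N : iter N E 0 = 0.
Proof. by elim: N => //= N ->; rewrite linear0. Qed.
Lemma iter_linZ N c x : iter N E (c *: x) = c *: iter N E x.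
Proof. by rewrite -[c *: x]addr0 iter_lin iter_lin0 addr0. Qed.
Lemma iter_linD N x y : iter N E (x + y) = iter N E x + iter N E y.
Proof. by rewrite -[x]scale1r iter_lin !scale1r. Qed.
Lemma iter_lin_ge N N' x : (N <= N')%N -> iter N E x = 0 -> iter N' E x = 0.
Proof. by move=> /subnK <- e; rewrite iterD e iter_lin0. Qed.

End IterLinear.

Section Bivariate.
Variable k : fieldType.
Local Notation P := {mpoly k[2]}.
Local Notation o1 := (ord_max : 'I_2).
Local Notation o0 := (ord0 : 'I_2).
Implicit Types (Q : pred 'X_{1..2}) (f : P) (m : 'X_{1..2}).

Definition mon (i j : nat) : 'X_{1..2} := [multinom if l == o0 then i else j | l < 2].

Lemma mon_0 i j : mon i j o0 = i. Proof. by rewrite mnmE. Qed.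
Lemma mon_1 i j : mon i j o1 = j. Proof. by rewrite mnmE. Qed.

Lemma monP (m m' : 'X_{1..2}) : m o0 = m' o0 -> m o1 = m' o1 -> m = m'.
Proof.
move=> e0 e1; apply/mnmP=> i; case: i => [[|[|i]] hi] //.
- by have -> : Ordinal hi = o0 by apply/val_inj.
- by have -> : Ordinal hi = o1 by apply/val_inj.
Qed.

Lemma mon_eta (m : 'X_{1..2}) : mon (m o0) (m o1) = m.
Proof. by apply: monP; rewrite ?mon_0 ?mon_1. Qed.

Lemma monD i j i' j' : (mon i j + mon i' j')%MM = mon (i + i') (j + j').
Proof. by apply: monP; rewrite mnmDE ?mon_0 ?mon_1. Qed.

Lemma mon00 : mon 0 0 = 0%MM.
Proof. by apply: monP; rewrite ?mon_0 ?mon_1 mnm0E. Qed.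

Lemma mdeg2 (m : 'X_{1..2}) : mdeg m = (m o0 + m o1)%N.
Proof.
rewrite mdegE big_ord_recr big_ord1 /=; congr addn; congr (fun_of_multinom m _); exact: val_inj.
Qed.

Lemma monXD i j i' j' : 'X_[mon i j] * 'X_[mon i' j'] = 'X_[mon (i + i') (j + j')] :> P.
Proof. by rewrite -mpolyXD monD. Qed.

Section LinearExtension.
Variables (V : lmodType k) (g : 'X_{1..2} -> V).

Definition lin (f : P) : V := \sum_(m <- msupp f) f@_m *: g m.

(** Supports vary from one polynomial to another; a common index set of bounded monomials turns the
    linearity of [lin] into a termwise identity. *)
Lemma linw K f : (msize f <= K)%N ->
  lin f = \sum_(m : 'X_{1..2 < K}) f@_m *: g m.
Proof.
move=> le_fK; rewrite /lin (big_mksub 'X_{1..2 < K}) ?msupp_uniq //=; last first.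
  by move=> x /msize_mdeg_lt/leq_trans; apply.
by rewrite big_rmcond //= => m /memN_msupp_eq0 ->; rewrite scale0r.
Qed.

Lemma lin_linear : linear lin.
Proof.
move=> c f f'; set K := maxn (msize (c *: f + f')) (maxn (msize f) (msize f')).
rewrite !(@linw K) ?leq_maxl // ?leq_max ?leqnn ?orbT //.
rewrite scaler_sumr -big_split /=; apply: eq_bigr => m _.
by rewrite mcoeffD mcoeffZ scalerDl scalerA.
Qed.
HB.instance Definition _ := GRing.isLinear.Build k P V _ lin lin_linear.

Lemma linX m : lin 'X_[m] = g m.
Proof. by rewrite /lin msuppX big_seq1 mcoeffX eqxx scale1r. Qed.

End LinearExtension.

Lemma lin_unique (V : lmodType k) (h : {linear P -> V}) f :
  h f = lin (fun m => h 'X_[m]) f.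
Proof. by rewrite {1}[f]mpolyE linear_sum; apply: eq_bigr => m _; rewrite linearZ. Qed.

Definition mproj (Q : pred 'X_{1..2}) : P -> P :=
  lin (fun m => if Q m then 'X_[m] else 0).
HB.instance Definition _ Q := GRing.Linear.copy (mproj Q)
  (lin (fun m => if Q m then 'X_[m] else 0 : P)).

Lemma mprojE Q f m : (mproj Q f)@_m = if Q m then f@_m else 0.
Proof.
rewrite /mproj /lin raddf_sum /=.
have -> : (if Q m then f@_m else 0) =
  \sum_(m' <- msupp f) f@_m' * (if Q m then (m' == m)%:R else 0).
  case: (boolP (Q m)) => Qm; last by rewrite big1 // => m' _; rewrite mulr0.
  rewrite {1}[f]mpolyE raddf_sum /=; apply: eq_bigr => m' _.
  by rewrite mcoeffZ mcoeffX.
apply: eq_bigr => m' _; rewrite mcoeffZ.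
case: (eqVneq m' m) => [->|ne]; first by case: ifP; rewrite ?mcoeffX ?eqxx ?mcoeff0.
by case: ifP; case: ifP; rewrite ?mcoeffX ?mcoeff0 ?(negbTE ne).
Qed.

(** Weight bounds, homogeneity and divisibility of the degree are all instances, so each closure
    property is proved once. The zero polynomial satisfies every instance. *)
Definition supp_in (Q : pred 'X_{1..2}) (f : P) : Prop := forall m, f@_m != 0 -> Q m.

Lemma supp_in_sum Q f : supp_in Q f ->
  f = \sum_(m <- msupp f | Q m) f@_m *: 'X_[m].
Proof.
move=> Qf; rewrite {1}[f]mpolyE big_seq [RHS]big_seq_cond.
by apply: eq_bigl => m; case: (boolP (m \in _)) => //=; rewrite mcoeff_msupp => /Qf ->.
Qed.

Lemma supp_in0 Q : supp_in Q 0.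
Proof. by move=> m; rewrite mcoeff0 eqxx. Qed.
Lemma supp_inX Q m : Q m -> supp_in Q 'X_[m].
Proof. by move=> Qm m'; rewrite mcoeffX; case: (eqVneq m m') => [<-|]; rewrite ?eqxx. Qed.
Lemma supp_inD Q f g : supp_in Q f -> supp_in Q g -> supp_in Q (f + g).
Proof.
move=> Qf Qg m; rewrite mcoeffD => nz.
case: (eqVneq f@_m 0) => [f0|/Qf //]; apply: Qg.
by move: nz; rewrite f0 add0r.
Qed.
Lemma supp_inZ Q c f : supp_in Q f -> supp_in Q (c *: f).
Proof. by move=> Qf m; rewrite mcoeffZ mulf_eq0 negb_or => /andP[_ /Qf]. Qed.
Lemma supp_inN Q f : supp_in Q f -> supp_in Q (- f).
Proof. by move=> Qf; rewrite -scaleN1r; apply: supp_inZ. Qed.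
Lemma supp_inB Q f g : supp_in Q f -> supp_in Q g -> supp_in Q (f - g).
Proof. by move=> Qf Qg; apply/supp_inD/supp_inN. Qed.
Lemma supp_in_bigsum Q I (r : seq I) (S : pred I) (F : I -> P) :
  (forall i, S i -> supp_in Q (F i)) -> supp_in Q (\sum_(i <- r | S i) F i).
Proof.
move=> QF; elim/big_rec: _ => [|i f Si Qf]; first exact: supp_in0.
by apply: supp_inD => //; apply: QF.
Qed.
Lemma supp_inW (Q Q' : pred 'X_{1..2}) f : (forall m, Q m -> Q' m) -> supp_in Q f -> supp_in Q' f.
Proof. by move=> QQ' Qf m /Qf/QQ'. Qed.

Lemma mproj_in Q f : supp_in Q (mproj Q f).
Proof. by move=> m; rewrite mprojE; case: ifP; rewrite ?eqxx. Qed.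
Lemma mproj_id Q f : supp_in Q f -> mproj Q f = f.
Proof.
move=> Qf; apply/mpolyP=> m; rewrite mprojE; case: ifP => // /negbT nQ.
by case: (eqVneq f@_m 0) => [->//|/Qf Qm]; rewrite Qm in nQ.
Qed.

Lemma supp_inM (Q Q' Q'' : pred 'X_{1..2}) f g :
  (forall m m', Q m -> Q' m' -> Q'' (m + m')%MM) ->
  supp_in Q f -> supp_in Q' g -> supp_in Q'' (f * g).
Proof.
move=> QQ Qf Qg; rewrite (supp_in_sum Qf) (supp_in_sum Qg).
rewrite big_distrlr /=; apply: supp_in_bigsum => m Qm; apply: supp_in_bigsum => m' Qm'.
rewrite -scalerAl -scalerAr -mpolyXD; do 2 apply: supp_inZ; apply: supp_inX; exact: QQ.
Qed.

Lemma lin_supp_in Q (Q' : pred 'X_{1..2}) (g : 'X_{1..2} -> P) f :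
  (forall m, Q m -> supp_in Q' (g m)) -> supp_in Q f -> supp_in Q' (lin g f).
Proof.
move=> Qg Qf; rewrite /lin big_seq; apply: supp_in_bigsum => m.
rewrite mcoeff_msupp => /Qf Qm; apply: supp_inZ; exact: Qg.
Qed.

End Bivariate.

Section Weights.
Variable k : fieldType.
Local Notation P := {mpoly k[2]}.
Local Notation o1 := (ord_max : 'I_2).
Local Notation o0 := (ord0 : 'I_2).
Implicit Types (Q : pred 'X_{1..2}) (f g : P) (m : 'X_{1..2}) (a b : nat) (n d : int).

Definition wt a b m : nat := (a * m o0 + b * m o1)%N.

Lemma wtD a b m m' : wt a b (m + m')%MM = (wt a b m + wt a b m')%N.
Proof. by rewrite /wt !mnmDE; lia. Qed.

Lemma wt11 m : wt 1 1 m = mdeg m.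
Proof. by rewrite mdeg2 /wt !mul1n. Qed.

(** The bound is an integer because derivations may lower weights; a negative bound is how an
    element is shown to vanish ([wle_neg]). *)
Definition wle a b n : P -> Prop := supp_in (fun m => (wt a b m)%:Z <= n).
Definition whomog a b n : P -> Prop := supp_in (fun m => (wt a b m)%:Z == n).
Definition hpart a b n : P -> P := mproj (fun m => (wt a b m)%:Z == n).
HB.instance Definition _ a b n := GRing.Linear.copy (hpart a b n)
  (@mproj k (fun m => (wt a b m)%:Z == n)).
(** These are the coordinates of invariants: the sign involution multiplies the normal form of
    degree 2e by (-1)^e, hence the 4. *)
Definition inC : P -> Prop := supp_in (fun m => 4 %| mdeg m)%N.

Lemma supp_in_ind Q (T : P -> Prop) :
  T 0 -> (forall c m f, Q m -> T f -> T (c *: 'X_[m] + f)) ->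
  forall f, supp_in Q f -> T f.
Proof. by move=> T0 Tadd f Qf; rewrite (supp_in_sum Qf); apply: big_rec => // m f' Qm; apply: Tadd. Qed.

Lemma supp_in_mon Q c m f : supp_in Q f -> Q m -> supp_in Q (c *: 'X_[m] + f).
Proof. by move=> Qf Qm; apply/supp_inD => //; apply/supp_inZ/supp_inX. Qed.

Lemma supp_in_lin Q (E : {linear P -> P}) Q' :
  (forall m, Q m -> supp_in Q' (E 'X_[m])) -> forall f, supp_in Q f -> supp_in Q' (E f).
Proof. by move=> QE f Qf; rewrite lin_unique; apply: lin_supp_in Qf. Qed.

Lemma inC1 : inC 1.
Proof. by rewrite -mpolyX0; apply: supp_inX; rewrite mdeg0. Qed.

Lemma inCM f g : inC f -> inC g -> inC (f * g).
Proof. by apply: supp_inM => m m' Cm Cm'; rewrite mdegD dvdn_add. Qed.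

Lemma wleW a b n n' f : n <= n' -> wle a b n f -> wle a b n' f.
Proof. by move=> nn'; apply: supp_inW => m /le_trans; apply. Qed.

Lemma wle_neg a b n f : n < 0 -> wle a b n f -> f = 0.
Proof.
move=> n0 nf; apply/mpolyP => m; rewrite mcoeff0.
by case: (eqVneq f@_m 0) => // /nf; lia.
Qed.

Lemma wle_exists a b f : exists n : nat, wle a b n f.
Proof.
have : supp_in predT f by move=> m.
elim/supp_in_ind: f / => [|c m f _ [n nf]]; first by exists 0; apply: supp_in0.
exists (n + wt a b m)%N; apply: supp_in_mon; last by lia.
by apply: wleW nf; lia.
Qed.

Lemma wleM a b n n' f g : wle a b n f -> wle a b n' g -> wle a b (n + n') (f * g).
Proof. by apply: supp_inM => m m'; rewrite wtD; lia. Qed.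

Lemma homogM a b n n' f g : whomog a b n f -> whomog a b n' g -> whomog a b (n + n') (f * g).
Proof. by apply: supp_inM => m m'; rewrite wtD; lia. Qed.

Lemma homog_wle a b n f : whomog a b n f -> wle a b n f.
Proof. by apply: supp_inW => m /eqP ->. Qed.

Lemma homogX a b m : whomog a b (wt a b m)%:Z 'X_[m].
Proof. exact: supp_inX. Qed.

Lemma wleX a b m : wle a b (wt a b m)%:Z 'X_[m].
Proof. exact/homog_wle/homogX. Qed.

Arguments wleX a b m : clear implicits.
Arguments homogX a b m : clear implicits.

Lemma hpart_homog a b n f : whomog a b n (hpart a b n f).
Proof. exact: mproj_in. Qed.

Lemma hpart_id a b n f : whomog a b n f -> hpart a b n f = f.
Proof. exact: mproj_id. Qed.

Lemma hpart_low a b n n' f : wle a b n' f -> n' < n -> hpart a b n f = 0.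
Proof.
move=> nf lt_n; apply/mpolyP=> m; rewrite mprojE mcoeff0.
case: eqP => // e; case: (eqVneq f@_m 0) => // /nf; lia.
Qed.

Lemma hpart_split a b n f : wle a b n f -> wle a b (n - 1) (f - hpart a b n f).
Proof.
move=> nf m; rewrite mcoeffB mprojE; case: ifP => [_|/negbT ne]; first by rewrite subrr eqxx.
by rewrite subr0 => /nf; lia.
Qed.

Lemma hpart_wle a b n f : wle a b n f -> hpart a b n f = 0 -> wle a b (n - 1) f.
Proof. by move=> /hpart_split + e; rewrite e subr0. Qed.

Lemma hpartM a b n n' f g : wle a b n f -> wle a b n' g ->
  hpart a b (n + n') (f * g) = hpart a b n f * hpart a b n' g.
Proof.
move=> nf ng; set f1 := hpart a b n f; set g1 := hpart a b n' g.
have -> : f * g = f1 * g1 + (f1 * (g - g1) + (f - f1) * g) by ring.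
have hf1 : whomog a b n f1 by apply: hpart_homog.
have hg1 : whomog a b n' g1 by apply: hpart_homog.
rewrite linearD /= hpart_id; last exact: homogM.
rewrite (@hpart_low _ _ _ (n + n' - 1)) ?addr0 //; last by lia.
apply: supp_inD.
  apply: wleW (wleM (homog_wle hf1) (hpart_split ng)); lia.
apply: wleW (wleM (hpart_split nf) ng); lia.
Qed.

Lemma inC_hpart a b n f : inC f -> inC (hpart a b n f).
Proof. by move=> Cf m; rewrite mprojE; case: ifP; rewrite ?eqxx // => _ /Cf. Qed.

Lemma homog_hpart a b n a' b' n' f : whomog a' b' n' f -> whomog a' b' n' (hpart a b n f).
Proof. by move=> Cf m; rewrite mprojE; case: ifP; rewrite ?eqxx // => _ /Cf. Qed.

(* [star] is the multiplication of the ring of invariants, read on the monomials of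
   degree divisible by 4; the ordinary product of [P] is another instance. *)
Record star_ok (star : P -> P -> P) : Prop := StarOk {
  star1l : forall f, inC f -> star 1 f = f;
  star1r : forall f, inC f -> star f 1 = f;
  starC : forall f g, inC f -> inC g -> inC (star f g);
  starF : forall a b n n' f g, (0 < a + b)%N -> inC f -> inC g ->
    wle a b n f -> wle a b n' g -> wle a b (n + n' - 1) (star f g - f * g)
}.

(** The operator is linear on all of [P], but only its restriction to [inC] matters. With [star] as
    a parameter, the record covers both derivations of R and their top parts, for which the product
    is the ordinary one. *)
Record lnd_ok (star : P -> P -> P) (E : {linear P -> P}) : Prop := LndOk {
  lndC : forall f, inC f -> inC (E f);
  lndL : forall f g, inC f -> inC g -> E (star f g) = star f (E g) + star (E f) g;
  lndN : forall f, inC f -> exists N, iter N E f = 0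
}.

Lemma mul_star_ok : star_ok *%R.
Proof.
split=> [f|f||a b n n' f g *]; rewrite ?mul1r ?mulr1 //; first exact: inCM.
by rewrite subrr; apply: supp_in0.
Qed.

Definition wdeg (E : {linear P -> P}) a b d : Prop :=
  forall n f, inC f -> wle a b n f -> wle a b (n + d) (E f).

Section Graded.
Variables (star : P -> P -> P) (E : {linear P -> P}).
Hypotheses (star_okP : star_ok star) (lnd_okP : lnd_ok star E).

Lemma star_wle a b n n' f g : (0 < a + b)%N -> inC f -> inC g ->
  wle a b n f -> wle a b n' g -> wle a b (n + n') (star f g).
Proof.
move=> ab Cf Cg nf ng; rewrite -[star f g](subrK (f * g)).
apply: supp_inD; last exact: wleM.
by apply: wleW (starF star_okP ab Cf Cg nf ng); lia.
Qed.

Lemma hpart_star a b n n' f g : (0 < a + b)%N -> inC f -> inC g ->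
  wle a b n f -> wle a b n' g ->
  hpart a b (n + n') (star f g) = hpart a b n f * hpart a b n' g.
Proof.
move=> ab Cf Cg nf ng; rewrite -[star f g](subrK (f * g)) linearD /=.
by rewrite hpartM // (hpart_low (starF star_okP ab Cf Cg nf ng)) ?add0r //; lia.
Qed.

Lemma lnd1 : E 1 = 0.
Proof.
have := lndL lnd_okP inC1 inC1; have CE1 := lndC lnd_okP inC1.
rewrite (star1l star_okP inC1) (star1l star_okP CE1) (star1r star_okP CE1).
by move/(canLR (addrK _)); rewrite subrr.
Qed.

Lemma inCX m : (4 %| mdeg m)%N -> inC 'X_[m].
Proof. by move=> Cm; apply: supp_inX. Qed.

Lemma wdegP a b d : (forall m, (4 %| mdeg m)%N -> wle a b ((wt a b m)%:Z + d) (E 'X_[m])) ->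
  wdeg E a b d.
Proof.
move=> Ed n f Cf nf; have := @supp_in_lin (fun m => (4 %| mdeg m)%N && ((wt a b m)%:Z <= n)) E.
apply=> [m /andP[Cm mn]|m nz]; last by rewrite Cf ?nf.
by apply: wleW (Ed _ Cm); lia.
Qed.

(** The monomials of degree 4 generate. A monomial is split as [m0 + m'] with [m0] of degree 4; its
    difference [g] from the star product has smaller total degree, so that induction applies, and
    smaller weight, so that the bound obtained suffices. Both facts are [starF], for the weights
    (1,1) and (a,b). *)
Lemma wdeg_gen a b d : (0 < a + b)%N ->
  (forall m, mdeg m = 4 -> wle a b ((wt a b m)%:Z + d) (E 'X_[m])) -> wdeg E a b d.
Proof.
move=> ab Egen; apply: wdegP => m.
have [N] := ubnP (mdeg m); elim: N m => // N IH m leN Cm.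
case: (posnP (mdeg m)) => [/eqP|m_gt0].
  by rewrite mdeg_eq0 => /eqP ->; rewrite mpolyX0 lnd1; apply: supp_in0.
have m_ge4 : (4 <= mdeg m)%N by apply: dvdn_leq.
pose i := minn 4 (m o0); pose m0 := mon i (4 - i).
pose m' := mon (m o0 - i) (m o1 - (4 - i)).
have mE : m = (m0 + m')%MM.
  rewrite -[m]mon_eta monD; move: m_ge4; rewrite mdeg2 => m4.
  by congr mon; rewrite /i; lia.
have m04 : mdeg m0 = 4 by rewrite mdeg2 mon_0 mon_1 /i; lia.
have Cm' : (4 %| mdeg m')%N by move: Cm; rewrite mE mdegD m04 dvdn_addr.
have C0 : inC 'X_[m0] by apply: inCX; rewrite m04.
have C' := inCX Cm'.
set g := star 'X_[m0] 'X_[m'] - 'X_[m0] * 'X_[m'].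
have -> : 'X_[m] = star 'X_[m0] 'X_[m'] - g by rewrite /g opprB addrC subrK mE mpolyXD.
have wm : wt a b m = (wt a b m0 + wt a b m')%N by rewrite mE wtD.
rewrite linearB /= (lndL lnd_okP C0 C'); apply: supp_inB; last first.
  have Cg : inC g by apply: supp_inB; [apply: (starC star_okP) | apply: inCM].
  have := @supp_in_lin (fun l => [&& 4 %| mdeg l, mdeg l < mdeg m &
                                  ((wt a b l)%:Z <= (wt a b m)%:Z - 1)%R])%N E.
  apply=> [l /and3P[Cl lm wl]|l nz].
    by apply: wleW (IH _ _ Cl); lia.
  rewrite Cg //=; apply/andP; split.
    have := starF star_okP (isT : 0 < 1 + 1)%N C0 C' (wleX 1 1 m0) (wleX 1 1 m').
    by move=> /(_ l nz); rewrite !wt11 mE mdegD; lia.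
  have := starF star_okP ab C0 C' (wleX a b m0) (wleX a b m') => /(_ l nz).
  by rewrite wm; lia.
have EC0 := lndC lnd_okP C0; have EC' := lndC lnd_okP C'.
apply: supp_inD.
  apply: wleW (star_wle ab C0 EC' (wleX a b m0) (IH _ _ Cm')); first by rewrite wm; lia.
  by move: leN; rewrite mE mdegD m04; lia.
apply: wleW (star_wle ab EC0 C' (Egen _ m04) (wleX a b m')).
by rewrite wm; lia.
Qed.

Lemma wdegW a b d d' : d <= d' -> wdeg E a b d -> wdeg E a b d'.
Proof. by move=> dd Ed n f Cf nf; apply: wleW (Ed n f Cf nf); lia. Qed.

Lemma wdeg_exists a b : (0 < a + b)%N -> exists d, wdeg E a b d.
Proof.
move=> ab; suff [d Hd] : exists d : nat, forall i, (i < 5)%N ->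
    wle a b d (E 'X_[mon i (4 - i)]).
  exists d; apply: (wdeg_gen ab) => m m4; have := m4; rewrite mdeg2 => e.
  have -> : m = mon (m o0) (4 - m o0).
    by rewrite -[LHS]mon_eta; congr mon; lia.
  apply: wleW (Hd _ _); first by lia.
  move: e; rewrite ?mon_0; lia.
elim: 5%N => [|N [d IH]]; first by exists 0%N.
have [d' Hd'] := wle_exists a b (E 'X_[mon N (4 - N)]).
exists (d + d')%N => i; rewrite ltnS leq_eqVlt => /predU1P[->|/IH Hi].
  by apply: wleW Hd'; lia.
by apply: wleW Hi; lia.
Qed.

(** If every bound could be improved, [E f] would have negative weight, hence vanish. *)
Lemma wdeg_min a b : (0 < a + b)%N -> (exists2 f, inC f & E f <> 0) ->
  exists d, wdeg E a b d /\ ~ wdeg E a b (d - 1).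
Proof.
move=> ab [f Cf Ef0]; have [d0 Hd0] := wdeg_exists ab.
apply: contrapT => H; apply: Ef0.
have {H} all_d (t : nat) : wdeg E a b (d0 - t%:Z).
  elim: t => [|t IH]; first by rewrite subr0.
  apply: contrapT => nH; apply: H; exists (d0 - t%:Z); split=> //.
  by move=> H'; apply: nH; apply: wdegW H'; lia.
have [n nf] := wle_exists a b f.
apply: (@wle_neg a b (n%:Z + (d0 - (n + `|d0| + 1)%:Z))); first by lia.
exact: all_d.
Qed.

Section Top.
Variables (a b : nat) (d : int).
Hypotheses (ab : (0 < a + b)%N) (Ed : wdeg E a b d).

(** The operator induced on the associated graded ring of the weight filtration. *)
Definition grE : P -> P := lin (fun m => hpart a b ((wt a b m)%:Z + d) (E 'X_[m])).
HB.instance Definition _ := GRing.Linear.copy grE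
  (lin (fun m => hpart a b ((wt a b m)%:Z + d) (E 'X_[m]))).

Lemma grEX m : grE 'X_[m] = hpart a b ((wt a b m)%:Z + d) (E 'X_[m]).
Proof. exact: linX. Qed.

Lemma grE_top n f : inC f -> wle a b n f ->
  hpart a b (n + d) (E f) = grE (hpart a b n f).
Proof.
move=> Cf nf.
have : supp_in (fun m => (4 %| mdeg m)%N && ((wt a b m)%:Z <= n)) f.
  by move=> m nz; rewrite Cf ?nf.
elim/supp_in_ind: f / {Cf nf} => [|c m f /andP[Cm mn] IH]; first by rewrite !linear0.
rewrite !linearP /= IH; congr (_ *: _ + _).
case: (eqVneq (wt a b m)%:Z n) => [e|ne].
  by rewrite -e (hpart_id (homogX a b m)) grEX.
have lt_mn : (wt a b m)%:Z < n by rewrite lt_neqAle ne.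
rewrite (hpart_low (wleX a b m)) // linear0 (@hpart_low _ _ _ ((wt a b m)%:Z + d)) //.
  by apply: Ed (wleX a b m); apply: inCX.
by lia.
Qed.

Lemma grE_iter N n f : inC f -> wle a b n f ->
  wle a b (n + d *+ N) (iter N E f) /\
  hpart a b (n + d *+ N) (iter N E f) = iter N grE (hpart a b n f).
Proof.
move=> Cf nf; elim: N => [|N [IHw IHt]]; first by rewrite mulr0n addr0.
have CN : inC (iter N E f) by elim: (N) => //= M; apply: (lndC lnd_okP).
by rewrite mulrSr addrA /=; split; [apply: Ed | rewrite grE_top // IHt].
Qed.

(** The Leibniz rule passes to the ordinary product because [star] has the same top part. Iterates
    of [grE] on a monomial are top parts of iterates of [E], which gives nilpotency on monomials and
    then, by linearity, everywhere. *)
Lemma grE_ok : lnd_ok *%R grE.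
Proof.
have CE f : inC f -> inC (grE f).
  move=> Cf; apply: (@supp_in_lin (fun m => (4 %| mdeg m)%N)) Cf => m Cm.
  by rewrite /= grEX; apply/inC_hpart/(lndC lnd_okP)/inCX.
split=> //.
- move=> f g Cf; elim/supp_in_ind: f / Cf => [|c m f Cm IHf].
    by move=> _; rewrite !(linear0, mul0r, addr0).
  move=> Cg; rewrite mulrDl !linearP linearD mulrDl /= (IHf Cg).
  suff -> : grE (c *: 'X_[m] * g) = c *: ('X_[m] * grE g + grE 'X_[m] * g).
    by rewrite scalerDr mulrDl -!scalerAl; ring.
  rewrite -scalerAl linearZ; congr (_ *: _) => {IHf f}.
  elim/supp_in_ind: g / Cg => [|c' m' g Cm' IHg].
    by rewrite !(linear0, mulr0, addr0).
  rewrite mulrDr !linearP linearD /= IHg mulrDr.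
  suff E' : grE ('X_[m] * 'X_[m']) = 'X_[m] * grE 'X_[m'] + grE 'X_[m] * 'X_[m'].
    by rewrite -scalerAr linearZ /= E' scalerDr -!scalerAr mulrDr -scalerAr; ring.
  have Xm := inCX Cm; have Xm' := inCX Cm'.
  pose n := (wt a b m)%:Z; pose n' := (wt a b m')%:Z.
  have wX := wleX a b m; have wX' := wleX a b m'.
  have h1 := grE_top (starC star_okP Xm Xm') (star_wle ab Xm Xm' wX wX').
  move: h1; rewrite (hpart_star ab) // (hpart_id (homogX a b m)) (hpart_id (homogX a b m')) => <-.
  rewrite (lndL lnd_okP) // linearD /=.
  have EXm := lndC lnd_okP Xm; have EXm' := lndC lnd_okP Xm'.
  rewrite -[X in hpart _ _ X]addrA (hpart_star ab) //; last exact: Ed.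
  rewrite hpart_id -?grEX; last exact: homogX.
  congr (_ + _); rewrite addrA addrAC (hpart_star ab) //; last exact: Ed.
  by rewrite -grEX hpart_id //; apply: homogX.
- move=> f Cf; elim/supp_in_ind: f / Cf => [|c m f Cm [N IH]]; first by exists 0%N.
  have [M HM] := lndN lnd_okP (inCX Cm).
  have [_] := grE_iter M (inCX Cm) (wleX a b m).
  rewrite HM linear0 hpart_id; last exact: homogX.
  move=> e; exists (N + M)%N.
  by rewrite iter_lin iterD -e iter_lin0 scaler0 add0r addnC iterD IH iter_lin0.
Qed.

Lemma grE_neq0 : ~ wdeg E a b (d - 1) -> exists2 f, inC f & grE f <> 0.
Proof.
move=> nEd; apply: contrapT => H; apply: nEd; apply: wdegP => m Cm.
rewrite addrA; apply: hpart_wle; first by apply: Ed (wleX a b m); apply: inCX.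
by rewrite -grEX; apply: contrapT => nz; apply: H; exists 'X_[m] => //; apply: inCX.
Qed.

End Top.
End Graded.
End Weights.

Arguments wleX {k} a b m.
Arguments homogX {k} a b m.

(** * Newton polygons *)

Section Vertices.
Variable k : fieldType.
Hypothesis hk : [pchar k] =i pred0.
Local Notation P := {mpoly k[2]}.
Local Notation o1 := (ord_max : 'I_2).
Local Notation o0 := (ord0 : 'I_2).
Implicit Types (f g : P) (m : 'X_{1..2}) (i j a b : nat) (x y r s d : int).

Lemma natk_eq0 n : (n%:R == 0 :> k) = (n == 0)%N.
Proof. exact: (pcharf0P k).1. Qed.

(** Integer exponents, with value 0 outside the quadrant, allow translations by negative vectors
    without truncated subtraction. *)
Definition cf f x y : k := if (0 <= x) && (0 <= y) then f@_(mon `|x| `|y|) else 0.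

Lemma cfN f i j : cf f i j = f@_(mon i j).
Proof. by []. Qed.

Lemma cf0 x y : cf 0 x y = 0.
Proof. by rewrite /cf; case: ifP => // _; rewrite mcoeff0. Qed.
Lemma cfD f g x y : cf (f + g) x y = cf f x y + cf g x y.
Proof. by rewrite /cf; case: ifP => _; rewrite ?mcoeffD ?addr0. Qed.
Lemma cfZ c f x y : cf (c *: f) x y = c * cf f x y.
Proof. by rewrite /cf; case: ifP => _; rewrite ?mcoeffZ ?mulr0. Qed.

Lemma mon_eq i j i' j' : (mon i j == mon i' j') = (i == i') && (j == j').
Proof.
apply/eqP/andP => [e|[/eqP -> /eqP -> //]].
by split; apply/eqP; [rewrite -(mon_0 i j) e mon_0 | rewrite -(mon_1 i j) e mon_1].
Qed.

Lemma cfX i j x y : cf 'X_[mon i j] x y = ((x == i) && (y == j))%:R.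
Proof.
rewrite /cf; case: (boolP ((0 <= x) && (0 <= y))) => [/andP[x0 y0]|nn].
  rewrite mcoeffX mon_eq; congr (_%:R); congr nat_of_bool; lia.
by by have -> : (x == i) && (y == j) = false by lia.
Qed.

Lemma cfMX f i j x y : cf ('X_[mon i j] * f) x y = cf f (x - i%:Z) (y - j%:Z).
Proof.
have : supp_in predT f by []; elim/supp_in_ind: f / => [|c m f _ IH].
  by rewrite mulr0 !cf0.
rewrite mulrDr !cfD IH; congr (_ + _); rewrite -scalerAr !cfZ; congr (_ * _).
rewrite -[m]mon_eta -mpolyXD monD !cfX; congr (_%:R); congr nat_of_bool; lia.
Qed.

Lemma cf_supp Q f x y : supp_in Q f -> cf f x y != 0 ->
  exists i j, [/\ x = i%:Z, y = j%:Z & Q (mon i j)].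
Proof.
move=> Qf; rewrite /cf; case: ifP => [/andP[x0 y0] /Qf Qm|]; last by rewrite eqxx.
exists `|x|%N, `|y|%N; split=> //; lia.
Qed.

Lemma mon_neq0 f : f <> 0 -> exists i j, cf f i j != 0.
Proof.
move=> nz; apply: contrapT => H; apply: nz; apply/mpolyP => m; rewrite mcoeff0.
apply/eqP; apply: contrapT => /negP nm; apply: H.
by exists (m o0), (m o1); rewrite cfN mon_eta.
Qed.

(** The points (r, s) where this is nonzero for some i, j span the Newton polygon of [E]; the
    derivation u^p d/dv contributes (p, -1). *)
Definition cc (E : {linear P -> P}) r s i j : k := cf (E 'X_[mon i j]) (i%:Z + r) (j%:Z + s).

Lemma mdeg_mon i j : mdeg (mon i j) = (i + j)%N.
Proof. by rewrite mdeg2 mon_0 mon_1. Qed.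

Lemma wt_mon a b i j : wt a b (mon i j) = (a * i + b * j)%N.
Proof. by rewrite /wt mon_0 mon_1. Qed.

Lemma inCmon i j : (4 %| i + j)%N -> inC ('X_[mon i j] : P).
Proof. by move=> C; apply: supp_inX; rewrite mdeg_mon. Qed.

Section Coefficients.
Variables (E : {linear P -> P}) (r s : int).
Hypothesis EP : lnd_ok *%R E.
Local Notation c := (cc E r s).

Lemma cc_add i j i' j' : (4 %| i + j)%N -> (4 %| i' + j')%N ->
  c (i + i') (j + j') = c i j + c i' j'.
Proof.
move=> C C'; rewrite /cc -monXD (lndL EP (inCmon C) (inCmon C')).
rewrite cfD [E _ * _]mulrC !cfMX addrC; congr (cf _ _ _ + cf _ _ _); lia.
Qed.

Lemma cc_muln i j n : (4 %| i + j)%N -> c (n * i) (n * j) = n%:R * c i j.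
Proof.
move=> C; elim: n => [|n IH].
  rewrite !mul0n mul0r /cc mon00 mpolyX0 (lnd1 (mul_star_ok k) EP); exact: cf0.
rewrite !mulSn cc_add // ?IH; last by rewrite -mulnDr dvdn_mull.
by rewrite -[n.+1]addn1 natrD; ring.
Qed.

Lemma cc4 i j : (4 %| i + j)%N -> 4%:R * c i j = i%:R * c 4 0 + j%:R * c 0 4.
Proof.
move=> C; rewrite -cc_muln // -!cc_muln // -cc_add ?muln0 ?addn0 ?add0n ?dvdn_mull //.
by congr c; lia.
Qed.

Lemma n4_neq0 : 4%:R != 0 :> k. Proof. by rewrite natk_eq0. Qed.

(** The Leibniz rule makes the coefficient additive in (i, j). The exponents (4,0) and (0,4) do not
    generate the lattice 4 | i + j, but they generate 4 times it, and 4 is invertible in k. *)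
Lemma cc_lin : exists al be, (al = c 4 0 / 4%:R /\ be = c 0 4 / 4%:R) /\
  forall i j, (4 %| i + j)%N -> c i j = i%:R * al + j%:R * be.
Proof.
exists (c 4 0 / 4%:R), (c 0 4 / 4%:R); split=> // i j C.
apply: (mulfI n4_neq0); rewrite cc4 //; field; exact: n4_neq0.
Qed.

Lemma cc_r0 i j : (i%:Z + r < 0) -> c i j = 0.
Proof. by rewrite /cc /cf => lt0; rewrite ifF //; lia. Qed.

Lemma cc_s0 i j : (j%:Z + s < 0) -> c i j = 0.
Proof. by rewrite /cc /cf => lt0; rewrite ifF //; lia. Qed.

(** Such a translation takes v^4 out of the quadrant, which kills the coefficient of j. *)
Lemma cc_rm1 : r <= -1 -> forall i j, (4 %| i + j)%N -> c i j = i%:R * (c 4 0 / 4%:R).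
Proof.
move=> r1 i j C; have [al [be [[-> ->] ->]]] // := cc_lin.
by rewrite [c 0 4]cc_r0 ?mul0r ?mulr0 ?addr0 //; lia.
Qed.

Lemma cc_sm1 : s <= -1 -> forall i j, (4 %| i + j)%N -> c i j = j%:R * (c 0 4 / 4%:R).
Proof.
move=> s1 i j C; have [al [be [[-> ->] ->]]] // := cc_lin.
by rewrite [c 4 0]cc_s0 ?mul0r ?mulr0 ?add0r //; lia.
Qed.

(** Now u v^3 leaves the quadrant as well, and there i = 1. *)
Lemma cc_rm2 : r <= -2 -> forall i j, (4 %| i + j)%N -> c i j = 0.
Proof.
move=> r2 i j C; have r1 : r <= -1 by lia.
have := cc_rm1 r1 (isT : 4 %| 1 + 3)%N; rewrite cc_r0 ?mul1r; last by lia.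
by move/esym=> e; rewrite cc_rm1 // e mulr0.
Qed.

Lemma cc_sm2 : s <= -2 -> forall i j, (4 %| i + j)%N -> c i j = 0.
Proof.
move=> s2 i j C; have s1 : s <= -1 by lia.
have := cc_sm1 s1 (isT : 4 %| 3 + 1)%N; rewrite cc_s0 ?mul1r; last by lia.
by move/esym=> e; rewrite cc_sm1 // e mulr0.
Qed.

Lemma cc_bounds i j : (4 %| i + j)%N -> c i j != 0 -> (-1 <= r) && (-1 <= s).
Proof.
move=> C nz; apply/andP; split; rewrite leNgt; apply: contra nz => lt1.
  by rewrite cc_rm2 //; lia.
by rewrite cc_sm2 //; lia.
Qed.

(** The derivation translates each monomial by (r, s) with a factor i al + j be. If r and s were
    both nonnegative, no monomial would ever leave the quadrant, and nilpotency on u^4 and v^4 would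
    force al = be = 0. *)
Lemma cc_vertex :
  (forall i j, (4 %| i + j)%N ->
     supp_in (fun m => ((m o0)%:Z == i%:Z + r) && ((m o1)%:Z == j%:Z + s)) (E 'X_[mon i j])) ->
  (exists i j, (4 %| i + j)%N && (c i j != 0)) ->
  (exists q : nat, [/\ r = -1, s = q%:Z & exists2 al, al != 0 &
      forall i j, (4 %| i + j)%N -> c i j = i%:R * al]) \/
  (exists p : nat, [/\ r = p%:Z, s = -1 & exists2 be, be != 0 &
      forall i j, (4 %| i + j)%N -> c i j = j%:R * be]).
Proof.
move=> bih [i0 [j0 /andP[C0 nz0]]]; have /andP[r1 s1] := cc_bounds C0 nz0.
case: (eqVneq r (-1)) => [rE|rN].
  have r1' : r <= -1 by rewrite rE.
  have cE := cc_rm1 r1'; left.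
  (* For r = s = -1 the factor is a multiple of i and also a multiple of j; its value on u^4 shows
     that it is zero. *)
  case: (eqVneq s (-1)) => [sE|sN].
    move: nz0; rewrite cE //; have := cE _ _ (isT : 4 %| 4 + 0)%N.
    have s1' : s <= -1 by rewrite sE.
    have := cc_sm1 s1' (isT : 4 %| 4 + 0)%N; rewrite mul0r => ->.
    by move/esym/eqP; rewrite mulf_eq0 (negbTE n4_neq0) => /eqP ->; rewrite mulr0 eqxx.
  exists `|s|%N; split=> //; first by lia.
  exists (c 4 0 / 4%:R) => //; apply: contra nz0 => /eqP e.
  by rewrite cE // e mulr0.
case: (eqVneq s (-1)) => [sE|sN].
  have s1' : s <= -1 by rewrite sE.
  have cE := cc_sm1 s1'; right.
  exists `|r|%N; split=> //; first by lia.
  exists (c 0 4 / 4%:R) => //; apply: contra nz0 => /eqP e.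
  by rewrite cE // e mulr0.
exfalso.
have [rn rE] : exists rn : nat, r = rn by exists `|r|%N; lia.
have [sn sE] : exists sn : nat, s = sn by exists `|s|%N; lia.
have [al [be [_ cE]]] := cc_lin.
have CS i j t : (4 %| i + j)%N -> c i j != 0 -> (4 %| (i + t * rn) + (j + t * sn))%N.
  move=> C nz; have CE := lndC EP (inCmon C).
  have [i' [j' [ei ej]]] := cf_supp CE nz; rewrite mdeg_mon => C'.
  have -> : (i + t * rn + (j + t * sn) = (i + j) + t * (rn + sn))%N by ring.
  rewrite dvdn_addr // dvdn_mull //.
  have e : (i' + j' = (i + j) + (rn + sn))%N by lia.
  by move: C'; rewrite e dvdn_addr.
(* The chain of translates of a monomial can stop only where the linear factor vanishes, say after t
   steps. *)
have nil i j N : (4 %| i + j)%N -> iter N E 'X_[mon i j] = 0 ->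
    exists t : nat, (i + t * rn)%:R * al + (j + t * sn)%:R * be = 0.
  elim: N i j => [|N IH] i j C.
    move=> /= /(congr1 (fun f : P => f@_(mon i j))); rewrite mcoeffX eqxx mcoeff0.
    by move/eqP; rewrite oner_eq0.
  rewrite iterSr; case: (eqVneq (c i j) 0) => [c0 _|nz].
    by exists 0%N; rewrite !mul0n !addn0 -cE.
  have CE := CS _ _ 1 C nz; rewrite !mul1n in CE.
  have -> : E 'X_[mon i j] = c i j *: 'X_[mon (i + rn) (j + sn)].
    apply/mpolyP=> m; rewrite mcoeffZ mcoeffX.
    case: eqVneq => [<-|ne].
      by rewrite mulr1 -cfN /cc rE sE !PoszD.
    rewrite mulr0; apply/eqP; apply: contraNT ne => /(bih _ _ C) /andP[/eqP e0 /eqP e1].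
    apply/eqP; apply: monP; rewrite ?mon_0 ?mon_1; lia.
  rewrite iter_linZ => /eqP; rewrite scaler_eq0 (negbTE nz) => /eqP /(IH _ _ CE)[t Ht].
  by exists t.+1; rewrite -Ht !mulSn !addnA.
have [N /(nil 4 0 _ isT)%N [t Ht]] := lndN EP (inCmon (isT : 4 %| 4 + 0)%N).
have [N' /(nil 0 4 _ isT)%N [t' Ht']] := lndN EP (inCmon (isT : 4 %| 0 + 4)%N).
(* The two vanishing conditions read 4 al = -t L and 4 be = -t' L. Substituted into 4 L, they give
   (4 + t rn + t' sn) L = 0, where the integer is positive. *)
set L := rn%:R * al + sn%:R * be.
have e1 : 4%:R * al = - t%:R * L.
  by apply/eqP; rewrite mulNr -addr_eq0 -Ht /L !natrD !natrM; apply/eqP; ring.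
have e2 : 4%:R * be = - t'%:R * L.
  by apply/eqP; rewrite mulNr -addr_eq0 -Ht' /L !natrD !natrM; apply/eqP; ring.
have e3 : (4 + t * rn + t' * sn)%:R * L = 0.
  have -> : (4 + t * rn + t' * sn)%:R * L =
     rn%:R * (4%:R * al + t%:R * L) + sn%:R * (4%:R * be + t'%:R * L).
    rewrite /L !natrD !natrM; ring.
  by rewrite e1 e2 !mulNr !addNr !mulr0 addr0.
have L0 : L = 0.
  by apply/eqP; move/eqP: e3; rewrite mulf_eq0 natk_eq0 !addn_eq0.
move: e1 e2; rewrite L0 !mulr0 => /eqP + /eqP; rewrite !mulf_eq0 !(negbTE n4_neq0) /=.
by move=> /eqP a0 /eqP b0; move: nz0; rewrite cE // a0 b0 !mulr0 addr0 eqxx.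
Qed.

End Coefficients.
End Vertices.

Section NewtonPolygon.
Variable k : fieldType.
Hypothesis hk : [pchar k] =i pred0.
Local Notation P := {mpoly k[2]}.
Local Notation o1 := (ord_max : 'I_2).
Local Notation o0 := (ord0 : 'I_2).
Implicit Types (f g : P) (m : 'X_{1..2}) (i j a b : nat) (x y r s d : int).

Lemma wle_cf a b n f x y : wle a b n f -> cf f x y != 0 -> a%:Z * x + b%:Z * y <= n.
Proof. by move=> nf /(cf_supp nf)[i [j [-> ->]]]; rewrite wt_mon PoszD !PoszM. Qed.

Lemma homog_cf a b n f x y : whomog a b n f -> cf f x y != 0 -> a%:Z * x + b%:Z * y = n.
Proof. by move=> nf /(cf_supp nf)[i [j [-> ->]]]; rewrite wt_mon PoszD !PoszM => /eqP. Qed.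

Lemma cf_hpart a b n f x y : a%:Z * x + b%:Z * y = n -> cf (hpart a b n f) x y = cf f x y.
Proof.
move=> e; rewrite /cf; case: ifP => // /andP[x0 y0].
by rewrite mprojE wt_mon ifT // -e PoszD !PoszM !gez0_abs.
Qed.

Lemma linear2_eq0 (a b a' b' x y : int) :
  a * b' - a' * b != 0 -> a * x + b * y = 0 -> a' * x + b' * y = 0 -> x = 0 /\ y = 0.
Proof.
move=> det e e'; split; apply/eqP.
  have : (a * b' - a' * b) * x == 0.
    have -> : (a * b' - a' * b) * x = b' * (a * x + b * y) - b * (a' * x + b' * y) by ring.
    by rewrite e e' !mulr0 subrr.
  by rewrite mulf_eq0 (negbTE det).
have : (a * b' - a' * b) * y == 0.
  have -> : (a * b' - a' * b) * y = a * (a' * x + b' * y) - a' * (a * x + b * y) by ring.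
  by rewrite e e' !mulr0 subrr.
by rewrite mulf_eq0 (negbTE det).
Qed.

Lemma lnd_neq0_mon (E : {linear P -> P}) : (exists2 f, inC f & E f <> 0) ->
  exists i j, (4 %| i + j)%N /\ E 'X_[mon i j] <> 0.
Proof.
move=> [f Cf Ef]; apply: contrapT => H; apply: Ef.
elim/supp_in_ind: f / Cf => [|c m f Cm IH]; first exact: linear0.
rewrite linearP IH addr0; apply/eqP; rewrite scaler_eq0; apply/orP; right.
apply/eqP; apply: contrapT => nz; apply: H; exists (m o0), (m o1).
by rewrite mon_eta -mdeg2.
Qed.

Section Vertex.
Variables (star : P -> P -> P) (E : {linear P -> P}).
Hypotheses (star_okP : star_ok star) (EP : lnd_ok star E).
Hypothesis E_neq0 : exists2 f, inC f & E f <> 0.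

(** The term al v^q d/du of the derivation, whose factor on u^i v^j is i al; [low_vertex] is
    likewise the term be u^p d/dv. *)
Definition left_vertex (E : {linear P -> P}) (q : int) := exists2 al : k, al != 0 &
  forall i j, (4 %| i + j)%N -> cc E (-1) q i j = i%:R * al.
Definition low_vertex (E : {linear P -> P}) (p : int) := exists2 be : k, be != 0 &
  forall i j, (4 %| i + j)%N -> cc E p (-1) i j = j%:R * be.

(** The second weight breaks the ties left by the first. By independence of the weights, the
    iterated top part is bihomogeneous, so [cc_vertex] applies; its coefficients at (r, s) are still
    those of [E]. *)
Lemma vertex a b a' b' : (0 < a + b)%N -> (0 < a' + b')%N -> a%:Z * b'%:Z - a'%:Z * b%:Z != 0 ->
  exists r s, wdeg E a b (a%:Z * r + b%:Z * s) /\
    ((exists q : nat, [/\ r = -1, s = q%:Z & left_vertex E q]) \/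
     (exists p : nat, [/\ r = p%:Z, s = -1 & low_vertex E p])).
Proof.
move=> ab ab' det.
have [d [Ed nEd]] := wdeg_min star_okP EP ab E_neq0.
pose E1 : {linear P -> P} := grE E a b d.
have E1P : lnd_ok *%R E1 := grE_ok star_okP EP ab Ed.
have E1nz : exists2 f, inC f & E1 f <> 0 := grE_neq0 Ed nEd.
have [d' [Ed' nEd']] := wdeg_min (mul_star_ok k) E1P ab' E1nz.
pose E2 : {linear P -> P} := grE E1 a' b' d'.
have E2P : lnd_ok *%R E2 := grE_ok (mul_star_ok k) E1P ab' Ed'.
have E2nz : exists2 f, inC f & E2 f <> 0 := grE_neq0 Ed' nEd'.
have hom i j : whomog a b ((wt a b (mon i j))%:Z + d) (E2 'X_[mon i j]).
  by rewrite /= grEX; apply: homog_hpart; rewrite /= grEX; apply: hpart_homog.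
have hom' i j : whomog a' b' ((wt a' b' (mon i j))%:Z + d') (E2 'X_[mon i j]).
  by rewrite /= grEX; apply: hpart_homog.
have [i0 [j0 [C0 /mon_neq0 [x0 [y0 nz0]]]]] := lnd_neq0_mon E2nz.
pose r := x0%:Z - i0%:Z; pose s := y0%:Z - j0%:Z.
have dE : d = a%:Z * r + b%:Z * s.
  by have := homog_cf (hom _ _) nz0; rewrite wt_mon PoszD !PoszM /r /s; lia.
have dE' : d' = a'%:Z * r + b'%:Z * s.
  by have := homog_cf (hom' _ _) nz0; rewrite wt_mon PoszD !PoszM /r /s; lia.
have ccE i j : cc E2 r s i j = cc E r s i j.
  rewrite /cc /= grEX cf_hpart; last by rewrite wt_mon PoszD !PoszM dE'; ring.
  by rewrite /= grEX cf_hpart // wt_mon PoszD !PoszM dE; ring.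
exists r, s; split; first by rewrite -dE.
have := @cc_vertex k hk E2 r s E2P; case.
- move=> i j C m nz; have := nz; rewrite -[m]mon_eta -cfN => nz'.
  have h := homog_cf (hom _ _) nz'; have h' := homog_cf (hom' _ _) nz'.
  have [] := @linear2_eq0 a b a' b' ((m o0)%:Z - i%:Z - r) ((m o1)%:Z - j%:Z - s) det.
  + by move: h; rewrite wt_mon PoszD !PoszM dE; lia.
  + by move: h'; rewrite wt_mon PoszD !PoszM dE'; lia.
  + by rewrite mon_eta => ? ?; apply/andP; split; apply/eqP; lia.
- by exists i0, j0; rewrite C0 /cc /r /s /= ![_%:Z + (_ - _)]addrC !subrK.
- move=> [q [re se [al al0 H]]]; left; exists q; split=> //; exists al => // i j C.
  by rewrite -(H i j C) ccE re se.
- move=> [p [re se [be be0 H]]]; right; exists p; split=> //; exists be => // i j C.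
  by rewrite -(H i j C) ccE re se.
Qed.

(* The Newton polygon of [E] has the extreme vertices [(p, -1)] and [(-1, q)]. *)
Record newton (E : {linear P -> P}) (p q : nat) : Prop := Newton {
  newton_u : wdeg E 1 0 p;
  newton_v : wdeg E 0 1 q;
  newton_low : low_vertex E p;
  newton_left : left_vertex E q
}.

(** The weights (1,0) and (0,1), each with the other as tie-break, find an extreme vertex in either
    direction; such a vertex is on the axis opposite to its direction unless [E] lowers that
    degree. *)
Lemma newton_cases :
  [\/ wdeg E 1 0 (-1), wdeg E 0 1 (-1) | exists p q, newton E p q].
Proof.
have [r [s []]] := @vertex 1 0 0 1 isT isT isT.
have [r' [s' []]] := @vertex 0 1 1 0 isT isT isT.
rewrite (_ : 0%:Z * r' + 1%:Z * s' = s'); last by lia.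
rewrite (_ : 1%:Z * r + 0%:Z * s = r); last by lia.
move=> Es + Er.
case=> [[q [_ sq Hq]]|[p [_ sp _]]]; last by move=> _; apply: Or32; rewrite -sp.
case=> [[q' [rq' _ _]]|[p [rp _ Hp]]]; first by apply: Or31; rewrite -rq'.
by apply: Or33; exists p, q; split=> //; rewrite -?rp -?sq.
Qed.

(** The term u^p d/dv has weight a p - b, as its value on v^4 shows. *)
Lemma low_vertex_le a b d (p : nat) : wdeg E a b d -> low_vertex E p -> a%:Z * p%:Z - b%:Z <= d.
Proof.
move=> Ed [be be0 H]; have := H 0%N 4%N isT.
move=> e; have nz : cc E p (-1) 0 4 != 0 by rewrite e mulf_neq0 ?natk_eq0.
have := wle_cf (Ed _ _ (inCmon (isT : 4 %| 0 + 4)%N) (wleX a b _)) nz.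
by rewrite wt_mon; lia.
Qed.

Lemma left_vertex_le a b d (q : nat) : wdeg E a b d -> left_vertex E q -> b%:Z * q%:Z - a%:Z <= d.
Proof.
move=> Ed [al al0 H]; have := H 4%N 0%N isT.
move=> e; have nz : cc E (-1) q 4 0 != 0 by rewrite e mulf_neq0 ?natk_eq0.
have := wle_cf (Ed _ _ (inCmon (isT : 4 %| 4 + 0)%N) (wleX a b _)) nz.
by rewrite wt_mon; lia.
Qed.

(** For this weight (p, -1) and (-1, q) both have value pq - 1. The vertex that realises the degree
    is some (p', -1) or (-1, q'), and p' <= p, q' <= q by extremality. *)
Lemma newton_edge p q : newton E p q -> wdeg E q.+1 p.+1 (p%:Z * q%:Z - 1).
Proof.
move=> N; have [||r [s [Ed H]]] := @vertex q.+1 p.+1 1 0 _ isT; [by []|by lia|].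
apply: wdegW Ed; case: H => [[q' [-> -> V]]|[p' [-> -> V]]].
  by have := left_vertex_le (newton_v N) V; nia.
by have := low_vertex_le (newton_u N) V; nia.
Qed.

End Vertex.
End NewtonPolygon.

(** * The degree function of a locally nilpotent derivation *)

Section LocalDegree.
Variable k : fieldType.
Hypothesis hk : [pchar k] =i pred0.
Local Notation P := {mpoly k[2]}.
Local Notation o1 := (ord_max : 'I_2).
Local Notation o0 := (ord0 : 'I_2).
Implicit Types (f g : P) (m : 'X_{1..2}) (i j a b n : nat) (x y r s d : int).
Variable E : {linear P -> P}.
Hypothesis EP : lnd_ok *%R E.

Definition ndeg f n : Prop := iter n.+1 E f = 0 /\ iter n E f <> 0.

Lemma ndeg_exists f : inC f -> f <> 0 -> exists n, ndeg f n.
Proof.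
move=> Cf nz; have [N HN] := lndN EP Cf.
have ex : exists n, iter n E f == 0 by exists N; apply/eqP.
case: (ex_minnP ex) => -[|n] /eqP n0 min_n //; exists n; split=> // /eqP /min_n.
by rewrite ltnn.
Qed.

Lemma ndeg_neq0 f n : ndeg f n -> f <> 0.
Proof. by move=> [_ nz] f0; apply: nz; rewrite f0 iter_lin0. Qed.

Lemma ndeg_uniq f n n' : ndeg f n -> ndeg f n' -> n = n'.
Proof.
move=> [e nz] [e' nz']; case: (ltngtP n n') => // lt.
  by case: nz'; apply: iter_lin_ge e.
by case: nz; apply: iter_lin_ge e'.
Qed.

Lemma ndeg_lt f n n' : ndeg f n -> iter n' E f = 0 -> (n < n')%N.
Proof. by move=> [_ nz] e; rewrite ltnNge; apply/negP => le; exact: nz (iter_lin_ge le e). Qed.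

Lemma ndegS f n : ndeg f n.+1 -> ndeg (E f) n.
Proof. by rewrite /ndeg -!iterSr. Qed.

Lemma ndegE f n : ndeg f n -> E f <> 0 -> exists2 n', n = n'.+1 & ndeg (E f) n'.
Proof.
case: n => [[e _] nz|n /ndegS]; first by case: nz.
by exists n.
Qed.

Lemma inC_iter n f : inC f -> inC (iter n E f).
Proof. by move=> Cf; elim: n => //= n; apply: (lndC EP). Qed.

(** In the Leibniz formula of order n + n' only one term survives; the induction is Pascal's rule,
    with the cases n = 0 and n' = 0 apart. *)
Lemma iter_leibniz N n n' f g : (n + n' = N)%N -> inC f -> inC g ->
  iter n.+1 E f = 0 -> iter n'.+1 E g = 0 ->
  iter N E (f * g) = 'C(N, n)%:R *: (iter n E f * iter n' E g) /\ iter N.+1 E (f * g) = 0.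
Proof.
elim: N n n' f g => [|N IH] n n' f g.
  move=> /eqP; rewrite addn_eq0 => /andP[/eqP -> /eqP ->] Cf Cg /= ef eg.
  by rewrite bin0 scale1r (lndL EP) // ef eg mulr0 mul0r addr0.
move=> nN Cf Cg ef eg; have CEf := lndC EP Cf; have CEg := lndC EP Cg.
have [n0|n0] := posnP n.
  have n'N : n' = N.+1 by rewrite -nN n0.
  rewrite n0 bin0 scale1r n'N in ef eg *.
  have {}ef : E f = 0 by [].
  rewrite ![iter N.+1 _ _]iterSr [iter N.+2 _ _]iterSr (lndL EP) // ef mul0r addr0.
  have [||-> ->] := IH 0%N N f (E g) _ Cf CEg ef; rewrite -?iterSr //.
  by rewrite bin0 scale1r.
have [n'0|n'0] := posnP n'.
  have n'N : n = N.+1 by rewrite -nN n'0 addn0.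
  rewrite n'0 n'N binn scale1r in ef eg *.
  have {}eg : E g = 0 by [].
  rewrite ![iter N.+1 _ _]iterSr [iter N.+2 _ _]iterSr (lndL EP) // eg mulr0 add0r.
  have [||-> ->] := IH N 0%N (E f) g _ CEf Cg _ eg; rewrite -?iterSr ?addn0 //.
  by rewrite binn scale1r.
case: n n' n0 n'0 nN ef eg => // n [//|n'] _ _ nN ef eg.
rewrite [iter N.+1 _ _]iterSr [iter N.+2 _ _]iterSr (lndL EP) // !iter_linD.
have [||-> ->] := IH n.+1 n' f (E g) _ Cf CEg ef; rewrite -?iterSr //; first by lia.
have [||-> ->] := IH n n'.+1 (E f) g _ CEf Cg _ eg; rewrite -?iterSr //; first by lia.
by rewrite addr0 binS natrD scalerDl.
Qed.

(** The binomial coefficient is nonzero in characteristic 0, and k[u,v] is a domain. *)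
Lemma ndegM f g n n' : inC f -> inC g -> ndeg f n -> ndeg g n' -> ndeg (f * g) (n + n').
Proof.
move=> Cf Cg [ef nf] [eg ng]; have [e e0] := iter_leibniz erefl Cf Cg ef eg.
split=> // /eqP; rewrite e scaler_eq0 natk_eq0 // -leqn0 leqNgt bin_gt0 leq_addr /=.
by rewrite mulf_eq0 => /orP[/eqP|/eqP].
Qed.

Lemma ndegX f n N : inC f -> ndeg f n -> ndeg (f ^+ N) (N * n).
Proof.
move=> Cf df; have CX M : inC (f ^+ M).
  by elim: M => [|M IH]; rewrite ?expr0 ?exprS; [apply: inC1|apply: inCM].
elim: N => [|N IH].
  rewrite expr0 mul0n; split=> /=; first exact: lnd1 (mul_star_ok k) EP.
  by apply/eqP; apply: oner_neq0.
by rewrite exprS mulSn; apply: ndegM.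
Qed.

Lemma ndegD f g n : ndeg f n -> iter n E g = 0 -> ndeg (f + g) n.
Proof.
move=> [ef nf] eg; split; rewrite iter_linD; first by rewrite ef [iter _ _ g]/= eg linear0 addr0.
by rewrite eg addr0.
Qed.

Lemma ndegZ c f n : c != 0 -> ndeg f n -> ndeg (c *: f) n.
Proof.
move=> c0 [ef nf]; split; rewrite iter_linZ; first by rewrite ef scaler0.
by apply/eqP; rewrite scaler_eq0 (negbTE c0); apply/eqP.
Qed.

Lemma monX i j N : 'X_[mon i j] ^+ N = 'X_[mon (N * i) (N * j)] :> P.
Proof.
elim: N => [|N IH]; first by rewrite expr0 !mul0n mon00 mpolyX0.
by rewrite exprS IH monXD !mulSn.
Qed.

Section Weights.
Variables U V : nat.
Hypotheses (dU : ndeg 'X_[mon 4 0] U) (dV : ndeg 'X_[mon 0 4] V).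

(** The fourth power of u^i v^j is a product of powers of u^4 and v^4, and degrees add up. *)
Lemma ndeg_mon i j : (4 %| i + j)%N ->
  exists2 n, ndeg 'X_[mon i j] n & (4 * n = i * U + j * V)%N.
Proof.
move=> C; have CX : inC ('X_[mon i j] : P) := inCmon C.
have [|n dn] := ndeg_exists CX.
  by move/(congr1 (fun f : P => f@_(mon i j))); rewrite mcoeffX eqxx mcoeff0 => /eqP; rewrite oner_eq0.
exists n => //; apply: (@ndeg_uniq ('X_[mon i j] ^+ 4)); first exact: ndegX.
have -> : 'X_[mon i j] ^+ 4 = 'X_[mon 4 0] ^+ i * 'X_[mon 0 4] ^+ j :> P.
  by rewrite !monX monXD; congr 'X_[mon _ _]; lia.
have CXX i' j' N : (4 %| i' + j')%N -> inC ('X_[mon i' j'] ^+ N : P).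
  by move=> C'; rewrite monX; apply: inCmon; rewrite -mulnDr dvdn_mull.
by apply: ndegM; [exact: CXX|exact: CXX|apply: ndegX => //; exact: inCmon..].
Qed.

(** The degree of a sum is that of its strictly dominant monomial: all the others are killed by
    fewer iterations. *)
Lemma ndeg_lead f i j : inC f -> cf f i j != 0 ->
  (forall i' j', cf f i' j' != 0 -> (i' = i /\ j' = j) \/ (i' * U + j' * V < i * U + j * V)%N) ->
  exists2 n, ndeg f n & (4 * n = i * U + j * V)%N.
Proof.
move=> Cf nz H.
have C : (4 %| i + j)%N by have := Cf _ nz; rewrite mdeg_mon.
have [n dn en] := ndeg_mon C; exists n => //.
rewrite -[f](subrK (f@_(mon i j) *: 'X_[mon i j])) addrC.
apply: ndegD; first exact: ndegZ.
have : supp_in (fun m => (4 %| mdeg m)%N && (m o0 * U + m o1 * V < 4 * n)%N) (f - f@_(mon i j) *: 'X_[mon i j]).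
  move=> m; rewrite mcoeffB mcoeffZ mcoeffX; case: (eqVneq (mon i j) m) => [<-|ne].
    by rewrite mulr1 subrr eqxx.
  rewrite mulr0 subr0 => nm; rewrite Cf //= en.
  have := nm; rewrite -[m in f@_m]mon_eta -cfN => /H[[e0 e1]|//].
  by move: ne; rewrite -e0 -e1 mon_eta eqxx.
move: (f - _) => g; elim/supp_in_ind: g / => [|c m g /andP[Cm lt] IH]; first exact: iter_lin0.
rewrite iter_lin IH addr0.
have [|n' [e' _] en'] := @ndeg_mon (m o0) (m o1); first by rewrite -mdeg2.
rewrite mon_eta in e'; rewrite (iter_lin_ge _ e') ?scaler0 //; lia.
Qed.

End Weights.

Lemma mon_factor f i j : (4 %| i + j)%N -> inC f ->
  (forall x y, cf f x y != 0 -> (i%:Z <= x) && (j%:Z <= y)) ->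
  exists2 g, inC g & f = 'X_[mon i j] * g.
Proof.
move=> C Cf H.
have : supp_in (fun m => [&& 4 %| mdeg m, i <= m o0 & j <= m o1])%N f.
  move=> m nz; rewrite (Cf _ nz) /=.
  by have := nz; rewrite -[m]mon_eta -cfN mon_eta => /H; rewrite !lez_nat.
elim/supp_in_ind: f / {Cf H} => [|c m f /and3P[Cm im jm] [g Cg ->]].
  by exists 0; rewrite ?mulr0 //; apply: supp_in0.
exists (c *: 'X_[mon (m o0 - i) (m o1 - j)] + g).
  by apply: supp_in_mon => //; rewrite mdeg_mon; move: Cm C; rewrite mdeg2; lia.
rewrite mulrDr -scalerAr monXD; congr (_ *: 'X_[_] + _).
by rewrite -[LHS]mon_eta; congr mon; lia.
Qed.

End LocalDegree.

(** * Derivations homogeneous along an edge of the polygon *)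

Section Edge.
Variable k : fieldType.
Hypothesis hk : [pchar k] =i pred0.
Local Notation P := {mpoly k[2]}.
Local Notation o1 := (ord_max : 'I_2).
Local Notation o0 := (ord0 : 'I_2).
Implicit Types (f g : P) (m : 'X_{1..2}) (i j a b n : nat) (x y r s d : int).
Variables (E : {linear P -> P}) (p q : nat).
Hypothesis EP : lnd_ok *%R E.
Hypothesis E_homog : forall i j,
  whomog q.+1 p.+1 ((wt q.+1 p.+1 (mon i j))%:Z + (p%:Z * q%:Z - 1)) (E 'X_[mon i j]).
Hypotheses (E_low : low_vertex E p) (E_left : left_vertex E q).

Lemma cf_cc i j x y : cf (E 'X_[mon i j]) x y = cc E (x - i%:Z) (y - j%:Z) i j.
Proof. by rewrite /cc; congr cf; lia. Qed.

(** The equation is that of the line through (p, -1) and (-1, q), shifted by (1, 1); the bounds say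
    that no translation by -2 occurs. *)
Lemma cf_edge i j x y : (4 %| i + j)%N -> cf (E 'X_[mon i j]) x y != 0 ->
  [/\ q.+1%:Z * (x - i%:Z + 1) + p.+1%:Z * (y - j%:Z + 1) = p.+1%:Z * q.+1%:Z,
      i%:Z - 1 <= x, j%:Z - 1 <= y, 0 <= x & 0 <= y] /\
  exists x' y' : nat, [/\ x = x'%:Z, y = y'%:Z & (4 %| x' + y')%N].
Proof.
move=> C nz; have [x' [y' [ex ey]]] := cf_supp (lndC EP (inCmon C)) nz.
rewrite mdeg_mon => C'; split; last by exists x', y'; split.
have := homog_cf (@E_homog i j) nz; rewrite wt_mon => h.
have nz' := nz; rewrite cf_cc in nz'; have /andP[b1 b2] := cc_bounds hk EP C nz'.
split; lia.
Qed.

Lemma E_left4 : cf (E 'X_[mon 4 0]) 3 q != 0.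
Proof.
have [al al0 H] := E_left; have := H 4%N 0%N isT; rewrite /cc.
by rewrite (_ : cf _ _ _ = cf (E 'X_[mon 4 0]) 3 q) => [->|]; rewrite ?mulf_neq0 ?natk_eq0.
Qed.

Lemma E_low4 : cf (E 'X_[mon 0 4]) p 3 != 0.
Proof.
have [be be0 H] := E_low; have := H 0%N 4%N isT; rewrite /cc.
by rewrite (_ : cf _ _ _ = cf (E 'X_[mon 0 4]) p 3) => [->|]; rewrite ?mulf_neq0 ?natk_eq0.
Qed.

Lemma cf_neq0 f x y : cf f x y != 0 -> f <> 0.
Proof. by move=> + f0; rewrite f0 cf0 eqxx. Qed.

(** The monomial u^p v^3 occurs in E(v^4), so its degree is divisible by 4. *)
Lemma p_mod4 : (p %% 4 = 1)%N.
Proof.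
have [_ [x' [y' [ex ey C]]]] := cf_edge (isT : 4 %| 0 + 4)%N E_low4.
have xp : x' = p by lia.
by move: C; rewrite xp; lia.
Qed.

Lemma q_mod4 : (q %% 4 = 1)%N.
Proof.
have [_ [x' [y' [ex ey C]]]] := cf_edge (isT : 4 %| 4 + 0)%N E_left4.
have yq : y' = q by lia.
by move: C; rewrite yq; lia.
Qed.

Lemma ndeg_UV : exists U V, [/\ ndeg E 'X_[mon 4 0] U, ndeg E 'X_[mon 0 4] V, (0 < U)%N & (0 < V)%N].
Proof.
have X40 : E 'X_[mon 4 0] <> 0 by apply: cf_neq0 E_left4.
have X04 : E 'X_[mon 0 4] <> 0 by apply: cf_neq0 E_low4.
have [|U dU] := ndeg_exists EP (inCmon (isT : 4 %| 4 + 0)%N).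
  by move=> e; apply: X40; rewrite e linear0.
have [|V dV] := ndeg_exists EP (inCmon (isT : 4 %| 0 + 4)%N).
  by move=> e; apply: X04; rewrite e linear0.
exists U, V; split=> //.
  by have [n' ->] := ndegE dU X40.
by have [n' ->] := ndegE dV X04.
Qed.

Section Weights.
Variables U V : nat.
Hypotheses (dU : ndeg E 'X_[mon 4 0] U) (dV : ndeg E 'X_[mon 0 4] V).

Lemma ndegE40 : exists2 n, ndeg E (E 'X_[mon 4 0]) n & U = n.+1.
Proof.
have [n -> dn] := ndegE dU (cf_neq0 E_left4).
by exists n.
Qed.

Lemma ndegE04 : exists2 n, ndeg E (E 'X_[mon 0 4]) n & V = n.+1.
Proof.
have [n -> dn] := ndegE dV (cf_neq0 E_low4).
by exists n.
Qed.

(* Otherwise [u^3 v] divides [E u^4] and [u v^3] divides [E v^4], which is impossible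
   for a locally nilpotent derivation. *)
Lemma edge_lattice_point :
  (exists x, cf (E 'X_[mon 4 0]) x 0 != 0) \/ (exists y, cf (E 'X_[mon 0 4]) 0 y != 0).
Proof.
apply: contrapT => H.
have CE40 := lndC EP (inCmon (isT : 4 %| 4 + 0)%N).
have CE04 := lndC EP (inCmon (isT : 4 %| 0 + 4)%N).
have [|g Cg eg] := mon_factor (isT : 4 %| 3 + 1)%N CE40.
  move=> x y nz; have [[_ x3 _ _ y0] _] := cf_edge (isT : 4 %| 4 + 0)%N nz.
  apply/andP; split; first by lia.
  suff : y != 0 by lia.
  by apply/eqP => y_0; apply: H; left; exists x; rewrite -y_0.
have [|h Ch eh] := mon_factor (isT : 4 %| 1 + 3)%N CE04.
  move=> x y nz; have [[_ _ y3 x0 _] _] := cf_edge (isT : 4 %| 0 + 4)%N nz.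
  apply/andP; split; last by lia.
  suff : x != 0 by lia.
  by apply/eqP => x_0; apply: H; right; exists y; rewrite -x_0.
have [n dn Un] := ndegE40; have [n' dn' Vn'] := ndegE04.
have nzg : g <> 0 by move=> g0; apply: (ndeg_neq0 dn); rewrite eg g0 mulr0.
have nzh : h <> 0 by move=> h0; apply: (ndeg_neq0 dn'); rewrite eh h0 mulr0.
have [G dG] := ndeg_exists EP Cg nzg; have [H' dH] := ndeg_exists EP Ch nzh.
have [m1 dm1 em1] := ndeg_mon hk EP dU dV (isT : 4 %| 3 + 1)%N.
have [m2 dm2 em2] := ndeg_mon hk EP dU dV (isT : 4 %| 1 + 3)%N.
rewrite eg in dn; rewrite eh in dn'.
(* The two factorizations give U - 1 >= (3U + V)/4 and V - 1 >= (U + 3V)/4, that is U >= V + 4 and V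
   >= U + 4. *)
have := ndeg_uniq dn (ndegM hk EP (inCmon (isT : 4 %| 3 + 1)%N) Cg dm1 dG).
have := ndeg_uniq dn' (ndegM hk EP (inCmon (isT : 4 %| 1 + 3)%N) Ch dm2 dH).
lia.
Qed.

(** A pure power u^x in E(u^4) gives (q+1)(x-3) = (p+1)q. As q+1 is prime to q, p+1 = b(q+1) and x =
    3 + bq; since 4 | x and q = 1 mod 4, also b = 1 mod 4. A pure power of v in E(v^4) gives instead
    p+1 | q+1, hence p = q and c = 0. *)
Lemma edge_slope : (q <= p)%N -> exists2 c, p.+1 = ((4 * c + 1) * q.+1)%N & True.
Proof.
move=> qp; have pm := p_mod4; have qm := q_mod4.
have [[x nz]|[y nz]] := edge_lattice_point.
  have [[e x3 _ _ _] [x' [y' [ex ey C]]]] := cf_edge (isT : 4 %| 4 + 0)%N nz.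
  have y0 : y' = 0%N by lia.
  have eN : (q.+1 * (x' - 3) = p.+1 * q)%N.
    have [z xz] : exists z, x' = (3 + z)%N by exists (x' - 3)%N; lia.
    by move: e; rewrite ex xz addKn; lia.
  have dv : (q.+1 %| p.+1)%N.
    have : (q.+1 %| p.+1 * q)%N by rewrite -eN dvdn_mulr.
    by rewrite Gauss_dvdl // coprimeSn.
  case/dvdnP: dv => b pE; exists (b %/ 4)%N => //.
  have bq : (x' - 3 = b * q)%N.
    by apply/eqP; rewrite -(eqn_pmul2l (ltn0Sn q)) eN pE; apply/eqP; ring.
  have x4 : (x' %% 4 = 0)%N by move: C; rewrite y0 addn0 => /eqP.
  have x3' : (3 <= x')%N by lia.
  have qE : q = (q %/ 4 * 4 + 1)%N by rewrite {1}(divn_eq q 4) qm.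
  have : (b %% 4 = 1)%N.
    have : ((b * q) %% 4 = 1)%N by rewrite -bq; lia.
    by rewrite -modnMmr qm muln1.
  by move=> bm; rewrite pE; congr (_ * _)%N; rewrite {1}(divn_eq b 4) bm; lia.
have [[e _ y3 _ _] [x' [y' [ex ey C]]]] := cf_edge (isT : 4 %| 0 + 4)%N nz.
have eN : (p.+1 * (y' - 3) = q.+1 * p)%N.
  have [z yz] : exists z, y' = (3 + z)%N by exists (y' - 3)%N; lia.
  have x0 : x' = 0%N by lia.
  by move: e; rewrite ex ey yz addKn; lia.
have dv : (p.+1 %| q.+1)%N.
  have : (p.+1 %| q.+1 * p)%N by rewrite -eN dvdn_mulr.
  by rewrite Gauss_dvdl // coprimeSn.
exists 0%N => //; rewrite muln0 add0n mul1n.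
by apply/eqP; rewrite eqn_leq (dvdn_leq _ dv) //= ltnS.
Qed.

(** Were V > bU, the dominant monomial of E(u^4) would be the end u^3 v^q of the edge, so 4(U-1) =
    3U + qV and U > V. Were V < bU, the other end u^p v^3 of E(v^4) would give 4(V-1) = pU + 3V, so
    V > pU >= bU. Both are absurd. *)
Lemma edge_weights b : p.+1 = (b * q.+1)%N -> V = (b * U)%N.
Proof.
move=> pE.
have b0 : (0 < b)%N by case: b pE.
have CE40 := lndC EP (inCmon (isT : 4 %| 4 + 0)%N).
have CE04 := lndC EP (inCmon (isT : 4 %| 0 + 4)%N).
have [n dn Un] := ndegE40; have [n' dn' Vn'] := ndegE04.
have line40 x y : cf (E 'X_[mon 4 0]) x y != 0 ->
    exists2 t : nat, (t <= q)%N & y = t /\ x = (3 + b * (q - t))%N.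
  move=> nz; have [[e x3 _ _ y0] [x' [y' [ex ey _]]]] := cf_edge (isT : 4 %| 4 + 0)%N nz.
  have [z xz] : exists z, x' = (3 + z)%N by exists (x' - 3)%N; lia.
  have e2 : (z + b * y' = b * q)%N.
    apply/eqP; rewrite -(eqn_pmul2l (ltn0Sn q)); apply/eqP.
    by move: e; rewrite ex ey xz pE; lia.
  exists y'; first by rewrite -(leq_pmul2l b0); lia.
  by split=> //; rewrite ex xz mulnBr -e2 addnK.
have line04 x y : cf (E 'X_[mon 0 4]) x y != 0 ->
    exists2 t : nat, (t <= q)%N & y = (3 + t)%N /\ x = (b * (q.+1 - t) - 1)%N.
  move=> nz; have [[e _ y3 x0 _] [x' [y' [ex ey _]]]] := cf_edge (isT : 4 %| 0 + 4)%N nz.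
  have [z yz] : exists z, y' = (3 + z)%N by exists (y' - 3)%N; lia.
  have e2 : (x'.+1 + b * z = b * q.+1)%N.
    apply/eqP; rewrite -(eqn_pmul2l (ltn0Sn q)); apply/eqP.
    by move: e; rewrite ex ey yz pE; lia.
  exists z; first by rewrite -ltnS -(ltn_pmul2l b0); lia.
  by rewrite ex ey yz; split=> //; rewrite mulnBr -e2 addnK subn1.
have q1 : (0 < q)%N by have := q_mod4; case: (q).
have up : (b * U < V)%N -> (4 * n = 3 * U + q * V)%N.
  move=> lt; have [|l dl <-] := ndeg_lead hk EP dU dV CE40 E_left4; last by rewrite (ndeg_uniq dn dl).
  move=> i j /line40[t tq [[->] [->]]].
  case: (ltngtP t q) tq => // [tq _|-> _]; last by left; rewrite subnn muln0.
  right; have : ((q - t) * (b * U) < (q - t) * V)%N by rewrite ltn_pmul2l // subn_gt0.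
  have -> : (q * V = (q - t) * V + t * V)%N by rewrite -mulnDl subnK // ltnW.
  lia.
have down : (V < b * U)%N -> (4 * n' = p * U + 3 * V)%N.
  move=> lt; have [|l dl <-] := ndeg_lead hk EP dU dV CE04 E_low4; last by rewrite (ndeg_uniq dn' dl).
  move=> i j /line04[t tq [[->] [->]]].
  have pb : p = (b * q.+1 - 1)%N by lia.
  case: (posnP t) => [->|t0]; first by left; rewrite pb subn0 addn0.
  right; have : (t * V < t * (b * U))%N by rewrite ltn_pmul2l.
  have : (t * (b * U) = b * t * U)%N by ring.
  have bt : (b * t < b * q.+1)%N by rewrite ltn_pmul2l.
  have : ((b * q.+1 - 1) * U = (b * q.+1 - b * t - 1) * U + b * t * U)%N.
    by rewrite -mulnDl; congr muln; lia.
  by rewrite mulnDl pb mulnBr; lia.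
case: (ltngtP V (b * U)%N) => // [lt|lt].
  have bq : (0 < b * q)%N by rewrite muln_gt0 b0.
  have bp : (b <= p)%N by rewrite -ltnS pE mulnS; lia.
  have : (b * U <= p * U)%N by rewrite leq_mul2r bp orbT.
  by have := down lt; lia.
have : (1 * U <= b * U)%N by rewrite leq_mul2r b0 orbT.
have : (1 * V <= q * V)%N by rewrite leq_mul2r q1 orbT.
by have := up lt; lia.
Qed.

End Weights.

(** Let i be the least exponent of u in f, attained at u^i v^j. The coefficient of u^(i-1) v^(j+q)
    in E f is i al times that of u^i v^j: any other monomial would have to move left by at least 2.
    Hence i = 0. *)
Lemma ker_pure_power f (n : int) : inC f -> whomog q.+1 p.+1 n f -> f <> 0 -> E f = 0 ->
  exists j, cf f 0 j != 0.
Proof.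
move=> Cf hf nz Ef0; have [al al0 Hal] := E_left.
have ex : exists i, `[< exists j, cf f i j != 0 >].
  by have [i [j nz']] := mon_neq0 nz; exists i; apply/asboolP; exists j.
case: (ex_minnP ex) => i /asboolP[j nzij] min_i.
case: (posnP i) => [i0|i0]; first by exists j; move: nzij; rewrite i0.
have C : (4 %| i + j)%N by have := Cf _ nzij; rewrite mdeg_mon.
have : cf (E f) (i%:Z - 1) (j%:Z + q%:Z) = 0 by rewrite Ef0 cf0.
pose c0 := f@_(mon i j); pose g := f - c0 *: 'X_[mon i j].
have fE : f = g + c0 *: 'X_[mon i j] by rewrite /g subrK.
rewrite fE linearD linearZ /= cfD cfZ.
have -> : cf (E 'X_[mon i j]) (i%:Z - 1) (j%:Z + q%:Z) = i%:R * al by rewrite -(Hal i j C).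
have Qg : supp_in (fun m => (4 %| mdeg m)%N && (i < m o0)%N) g.
  move=> m; rewrite mcoeffB mcoeffZ mcoeffX; case: (eqVneq (mon i j) m) => [<-|ne].
    by rewrite mulr1 subrr eqxx.
  rewrite mulr0 subr0 => nm; rewrite Cf //=.
  have nm' : cf f (m o0) (m o1) != 0 by rewrite cfN mon_eta.
  have im : (i <= m o0)%N by apply: min_i; apply/asboolP; exists (m o1).
  case: (ltngtP i (m o0)) im => // e _.
  have := homog_cf hf nm'; have := homog_cf hf nzij; rewrite -e => e1 e2.
  (* Homogeneity leaves only one monomial with the minimal exponent of u. *)
  have e3 : j = m o1 by nia.
  by move: ne; rewrite e e3 mon_eta eqxx.
have -> : cf (E g) (i%:Z - 1) (j%:Z + q%:Z) = 0.
  elim/supp_in_ind: g / Qg {fE} => [|c m g /andP[Cm im] IH]; first by rewrite linear0 cf0.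
  rewrite linearP cfD cfZ IH addr0 -[m]mon_eta cf_cc cc_rm2 ?mulr0 -?mdeg2 ?mon_eta //.
  lia.
rewrite add0r => /eqP; rewrite !mulf_eq0 natk_eq0 // (negbTE al0) orbF.
by rewrite /c0 -cfN (negbTE nzij) /= eqn0Ngt i0.
Qed.

(** Homogeneity allows a single pure power of v; the combination in which it cancels lies in the
    kernel and so is zero. The ratio is a quotient of coefficients, hence in k. *)
Lemma ker_proportional f g (n : int) : inC f -> inC g ->
  whomog q.+1 p.+1 n f -> whomog q.+1 p.+1 n g -> E f = 0 -> E g = 0 -> g <> 0 ->
  exists la, f = la *: g.
Proof.
move=> Cf Cg hf hg Ef Eg g0; have [j nzj] := ker_pure_power Cg hg g0 Eg.
exists (cf f 0 j / cf g 0 j).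
set la := _ / _; apply/eqP; rewrite -subr_eq0; apply/eqP; apply: contrapT => nz.
have hh : whomog q.+1 p.+1 n (f - la *: g) by apply/supp_inB => //; apply: supp_inZ.
have Ch : inC (f - la *: g) by apply/supp_inB => //; apply: supp_inZ.
have [|j' nzj'] := ker_pure_power Ch hh nz.
  by rewrite linearB linearZ /= Ef Eg scaler0 subrr.
have e := homog_cf hh nzj'; have e' := homog_cf hg nzj.
have jj : j' = j by nia.
move: nzj'; rewrite jj cfD -scaleN1r !cfZ /la divfK // mulN1r subrr eqxx //.
Qed.

(** With b = 4c + 1 and 3 + b = 4c + 4, the monomials u^3 v and u^(4c+4) have the same weight and,
    by V = bU, the same degree n. Their n-th iterates are nonzero kernel elements of equal weight,
    so [ker_proportional] supplies [la]. *)
Lemma edge_main : (q <= p)%N -> exists c, p.+1 = ((4 * c + 1) * q.+1)%N /\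
  exists n la, [/\ ndeg E 'X_[mon 3 1] n, ndeg E 'X_[mon (4 * c + 4) 0] n &
    iter n E ('X_[mon 3 1] - la *: 'X_[mon (4 * c + 4) 0]) = 0].
Proof.
move=> qp; have [U [V [dU dV U0 V0]]] := ndeg_UV.
have [c pE _] := edge_slope dU dV qp; exists c; split=> //.
have VE := edge_weights dU dV pE.
have C2 : (4 %| (4 * c + 4) + 0)%N by lia.
have C1 : (4 %| 3 + 1)%N by [].
have [n dn en] := ndeg_mon hk EP dU dV C1.
have [n' dn' en'] := ndeg_mon hk EP dU dV C2.
have nn : n' = n by lia.
rewrite nn in dn'.
have hom N i j : whomog q.+1 p.+1 ((wt q.+1 p.+1 (mon i j))%:Z + (p%:Z * q%:Z - 1) *+ N)
    (iter N E 'X_[mon i j]).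
  elim: N => [|N IH]; first by rewrite mulr0n addr0; apply: homogX.
  rewrite mulrSr addrA /=; apply: (supp_in_lin _ IH) => m /eqP <-.
  by rewrite -[m]mon_eta; apply: E_homog.
have h1 := hom n 3%N 1%N; have h2 := hom n (4 * c + 4)%N 0%N.
have ew : wt q.+1 p.+1 (mon 3 1) = wt q.+1 p.+1 (mon (4 * c + 4) 0).
  by rewrite !wt_mon pE; ring.
rewrite -ew in h2.
have I1 : inC (iter n E 'X_[mon 3 1]) by apply/(inC_iter EP)/inCmon.
have I2 : inC (iter n E 'X_[mon (4 * c + 4) 0]) by apply/(inC_iter EP)/inCmon.
have [] := ker_proportional I1 I2 h1 h2.
- by have [e _] := dn.
- by have [e _] := dn'.
- by have [_ e] := dn'.
move=> la e; exists n, la; split=> //.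
by rewrite -scaleNr iter_linD iter_linZ e scaleNr subrr.
Qed.

End Edge.

(** * Normal forms on the quadric *)

Section NormalForm.
Variables (k : fieldType) (A : comAlgType k) (x0 x1 y : A).
Hypothesis x0y : x0 * y = x1 ^+ 2 + 1.
Local Notation P := {mpoly k[2]}.
Local Notation o1 := (ord_max : 'I_2).
Local Notation o0 := (ord0 : 'I_2).
Implicit Types (f g : P) (m : 'X_{1..2}) (i j a b c : nat).

(* [nform i j] stands for [u^i v^j] under [x0 ~ u^2], [x1 ~ uv], [y ~ v^2]; it is
   meant for [i + j] even. *)
Definition nform i j : A := x0 ^+ ((i - j)./2) * y ^+ ((j - i)./2) * x1 ^+ minn i j.
Definition Psi : P -> A := lin (fun m => nform (m o0) (m o1)).
HB.instance Definition _ := GRing.Linear.copy Psi (lin (fun m => nform (m o0) (m o1))).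

Lemma PsiX i j : Psi 'X_[mon i j] = nform i j.
Proof. by rewrite /Psi linX mon_0 mon_1. Qed.

(** The proper quotients of u^i v^j by powers of uv: exactly what the constant 1 in x0 y = x1^2 + 1
    can produce. *)
Definition lower i j : pred 'X_{1..2} :=
  fun m => (m o0 < i)%N && (m o0 + j == m o1 + i)%N.

Definition inE : P -> Prop := supp_in (fun m => ~~ odd (mdeg m)).

(** Replacing x0 y by x1^2 + 1 lowers both a and b: the x1^2 keeps the leading monomial, while the 1
    divides it by (uv)^2. *)
Lemma Psi_monomial a b c : exists2 f, Psi f = x0 ^+ a * y ^+ b * x1 ^+ c &
  supp_in (lower (2 * a + c) (2 * b + c)) (f - 'X_[mon (2 * a + c) (2 * b + c)]).
Proof.
elim: a b c => [|a IH] b c.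
  exists 'X_[mon (2 * 0 + c) (2 * b + c)]; last by rewrite subrr; apply: supp_in0.
  rewrite PsiX /nform; congr (x0 ^+ _ * y ^+ _ * x1 ^+ _); lia.
case: b => [|b].
  exists 'X_[mon (2 * a.+1 + c) (2 * 0 + c)]; last by rewrite subrr; apply: supp_in0.
  rewrite PsiX /nform; congr (x0 ^+ _ * y ^+ _ * x1 ^+ _); lia.
have [f ef lf] := IH b (c + 2)%N; have [g eg lg] := IH b c.
exists (f + g).
  rewrite linearD /= ef eg.
  have -> : x0 ^+ a.+1 * y ^+ b.+1 * x1 ^+ c = (x0 * y) * (x0 ^+ a * y ^+ b * x1 ^+ c).
    by rewrite !exprS mulrACA !mulrA.
  by rewrite x0y mulrDl mul1r exprD; congr (_ + _); rewrite [RHS]mulrC -!mulrA.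
have -> : (2 * a.+1 + c = 2 * a + (c + 2))%N by lia.
have -> : (2 * b.+1 + c = 2 * b + (c + 2))%N by lia.
rewrite addrAC; apply: supp_inD => //.
rewrite -[g](subrK 'X_[mon (2 * a + c) (2 * b + c)]); apply: supp_inD.
  by apply: supp_inW lg => m; rewrite /lower; lia.
by apply: supp_inX; rewrite /lower mon_0 mon_1; lia.
Qed.

Lemma nform_mul i j i' j' : ~~ odd (i + j) -> ~~ odd (i' + j') ->
  exists2 f, Psi f = nform i j * nform i' j' &
    supp_in (lower (i + i') (j + j')) (f - 'X_[mon (i + i') (j + j')]).
Proof.
move=> Oij Oij'.
have [f ef] := Psi_monomial ((i - j)./2 + (i' - j')./2) ((j - i)./2 + (j' - i')./2)
  (minn i j + minn i' j').
have -> : (2 * ((i - j)./2 + (i' - j')./2) + (minn i j + minn i' j') = i + i')%N by lia.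
have -> : (2 * ((j - i)./2 + (j' - i')./2) + (minn i j + minn i' j') = j + j')%N by lia.
by move=> lf; exists f => //; rewrite ef /nform !exprD; ring.
Qed.

Lemma inE_lower i j f : ~~ odd (i + j) -> supp_in (lower i j) (f - 'X_[mon i j]) -> inE f.
Proof.
move=> Oij lf; rewrite -[f](subrK 'X_[mon i j]); apply: supp_inD.
  by apply: supp_inW lf => m; rewrite /lower mdeg2; lia.
by apply: supp_inX; rewrite mdeg2 mon_0 mon_1.
Qed.

End NormalForm.

Section QuadricModel.
Variable k : fieldType.
Hypothesis hk : [pchar k] =i pred0.
Local Notation P := {mpoly k[2]}.
Local Notation P3 := {mpoly k[3]}.
Local Notation D := (ringD k).
Local Notation o1 := (ord_max : 'I_2).
Local Notation o0 := (ord0 : 'I_2).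
Implicit Types (f g : P) (m : 'X_{1..2}) (i j a b c : nat).

Definition x0 : D := projD 'X_(inord 0).
Definition x1 : D := projD 'X_(inord 1).
Definition x2 : D := projD 'X_(inord 2).
Definition y2 : D := 2%:R *: x2.

Lemma two_neq0 : 2%:R != 0 :> k.
Proof. by rewrite (pcharf0P k).1. Qed.

Lemma x2E : x2 = 2%:R^-1 *: y2.
Proof. by rewrite /y2 scalerA mulVf ?scale1r ?two_neq0. Qed.

Lemma x0y2 : x0 * y2 = x1 ^+ 2 + 1.
Proof.
have := ringD_relation k; rewrite /= -/x0 -/x1 -/x2 => <-.
by rewrite addrCA subrr addr0 /y2 -scalerAr scaler_nat -mulrA mulr_natl.
Qed.

Local Notation eD := (nform x0 x1 y2).
Local Notation PsiD := (Psi x0 x1 y2).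

Lemma Psi_surj (x : D) : exists2 f, inE f & PsiD f = x.
Proof.
rewrite -[x](quot_projK x) -/(projD (repr x)); move: (repr x) => p {x}.
rewrite [p]mpolyE linear_sum; elim: (msupp p) => [|m s [f Ef IH]].
  by exists 0; rewrite ?big_nil ?linear0 //; apply: supp_in0.
rewrite big_cons -IH.
have [g eg lg] := Psi_monomial x0y2 (m (inord 0)) (m (inord 2)) (m (inord 1)).
(* Each factor x2 equals y/2. *)
exists ((p@_m * 2%:R^-1 ^+ m (inord 2)) *: g + f).
  apply: supp_inD => //; apply: supp_inZ; apply: inE_lower lg; lia.
rewrite linearP /= eg linearZ /=; congr (_ + _); rewrite -scalerA; congr (_ *: _).
rewrite mpolyXE_id rmorph_prod /=.
rewrite !big_ord_recr big_ord0 /= mul1r !rmorphXn /=.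
have e0 : widen_ord (leqnSn 2) (widen_ord (leqnSn 1) ord_max) = inord 0 :> 'I_3.
  by apply/val_inj; rewrite /= inordK.
have e1 : widen_ord (leqnSn 2) ord_max = inord 1 :> 'I_3 by apply/val_inj; rewrite /= inordK.
have e2 : ord_max = inord 2 :> 'I_3 by apply/val_inj; rewrite /= inordK.
rewrite e0 e1 e2 -/x0 -/x1 -/x2 x2E (exprZn 2%:R^-1 y2).
rewrite -[RHS]scalerAr.
by rewrite [X in _ *: X = _]mulrAC.
Qed.

(* [x0 = u^2], [x1 = uX], [2 x2 = X^2 + u^-2] parametrises the quadric, and maps
   [nform i j] to a polynomial in [X] with leading term [u^i X^j]. *)
Section Transcendental.
Variables (K : fieldType) (h : {rmorphism k -> K}) (u : K).
Hypothesis u_transcendental : forall p : {poly k}, (map_poly h p).[u] = 0 -> p = 0.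

Local Notation iota := (polyC \o h).

Definition rho_var (i : 'I_3) : {poly K} :=
  nth 0 [:: (u ^+ 2)%:P; u%:P * 'X; (h 2%:R^-1)%:P * ('X^2 + (u ^- 2)%:P)] i.

Definition rho : P3 -> {poly K} := mmap iota rho_var.
HB.instance Definition _ := GRing.RMorphism.copy rho (mmap iota rho_var).

Lemma u_neq0 : u != 0.
Proof.
apply/eqP => u0; have := @u_transcendental 'X; rewrite map_polyX hornerX => /(_ u0)/eqP.
by rewrite polyX_eq0.
Qed.

Lemma rhoX (i : nat) : (i < 3)%N -> rho 'X_(inord i) =
  nth 0 [:: (u ^+ 2)%:P; u%:P * 'X; (h 2%:R^-1)%:P * ('X^2 + (u ^- 2)%:P)] i.
Proof.
by move=> lt3; rewrite /rho mmapX mmap1U /rho_var inordK.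
Qed.

Lemma rhoZ (c : k) (p : P3) : rho (c *: p) = (h c)%:P * rho p.
Proof. by rewrite /rho mmapZ. Qed.

Lemma iota2 : (h 2%:R)%:P * (h 2%:R^-1)%:P = 1.
Proof. by rewrite -polyCM -rmorphM mulfV ?two_neq0 ?rmorph1. Qed.

Lemma rho_quadric : rho (quadric k) = 0.
Proof.
rewrite /quadric expr2 !rmorphB !rmorphM rmorph_nat rmorph1 /= !rhoX //=.
have -> : 2%:R = (h 2%:R)%:P by rewrite !rmorph_nat.
rewrite mulrACA.
rewrite iota2.
rewrite mul1r.
rewrite mulrDr.
rewrite -polyCM.
rewrite mulfV; last exact: (expf_neq0 2 u_neq0).
by rewrite mulrACA -polyCM -!expr2 polyC1 addrAC addrK subrr.
Qed.

(** A lift of the normal form to the polynomial ring, where [rho] is defined. *)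
Definition eP3 i j : P3 := 'X_(inord 0) ^+ ((i - j)./2) *
  (2%:R *: 'X_(inord 2)) ^+ ((j - i)./2) * 'X_(inord 1) ^+ minn i j.

Lemma projD_eP3 i j : projD (eP3 i j) = eD i j.
Proof. by rewrite /eP3 !rmorphM !rmorphXn /= linearZ. Qed.

Lemma rho_eP3 i j : ~~ odd (i + j) ->
  size (rho (eP3 i j)) = j.+1 /\ lead_coef (rho (eP3 i j)) = u ^+ i.
Proof.
move=> Oij; pose a := ((i - j)./2)%N; pose b := ((j - i)./2)%N; pose c := minn i j.
have ux n : u ^+ n != 0 by rewrite expf_neq0 ?u_neq0.
have -> : rho (eP3 i j) = (u ^+ i)%:P * (('X^2 + (u ^- 2)%:P) ^+ b * 'X^c).
  rewrite /eP3 !rmorphM !rmorphXn /= rhoZ !rhoX //= mulrA iota2 mul1r exprMn.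
  rewrite -/a -/b -/c mulrACA -!polyC_exp -polyCM -exprM -exprD.
  by congr (_%:P * _); congr (_ ^+ _); rewrite /a /c; lia.
have n2 : ('X^2 + (u ^- 2)%:P) ^+ b != 0 :> {poly K}.
  by rewrite expf_neq0 // -size_poly_eq0 size_XnaddC.
split; last by rewrite !lead_coefM lead_coefC lead_coef_exp lead_coefXnaddC // lead_coefXn expr1n !mulr1.
have sz : size (('X^2 + (u ^- 2)%:P : {poly K}) ^+ b) = (2 * b).+1.
  by rewrite (polySpred n2) size_exp size_XnaddC.
rewrite size_Cmul //.
rewrite (size_mul n2) ?sz ?size_polyXn; last exact/monic_neq0/monicXn.
rewrite /b /c /=; lia.
Qed.

(** A relation among the lifts of normal forms lies in the ideal of the quadric, which [rho] kills.
    The coefficient of X^J, for J the largest exponent of v, involves only leading terms and is a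
    polynomial in u over k; u being transcendental, all its coefficients vanish. *)
Lemma Psi_inj_transcendental f : inE f -> PsiD f = 0 -> f = 0.
Proof.
move=> Ef; rewrite /Psi /lin.
have -> : \sum_(m <- msupp f) f@_m *: eD (m o0) (m o1) =
   projD (\sum_(m <- msupp f) f@_m *: eP3 (m o0) (m o1)).
  by rewrite linear_sum; apply: eq_bigr => m _; rewrite linearZ /= projD_eP3.
move/eqP; rewrite -(raddf0 (@projD k)) quot_proj_eq subr0 => /asboolP[g eg].
apply: contrapT => /eqP nz; have := rho_quadric; move/(congr1 (fun z => rho g * z)).
rewrite mulr0 -rmorphM -eg rmorph_sum /=.
under eq_bigr do rewrite rhoZ.
have ex : exists j, has (fun m => m o1 == j) (msupp f).
  exists ((mlead f) o1); apply/hasP; exists (mlead f) => //; exact: mlead_supp.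
have ub j : has (fun m => m o1 == j) (msupp f) -> (j <= msize f)%N.
  case/hasP => m /msize_mdeg_lt + /eqP <-; rewrite mdeg2; lia.
case: (ex_maxnP ex ub) => J /hasP[m0 m0f /eqP m0J] maxJ.
have {}maxJ m : m \in msupp f -> (m o1 <= J)%N by move=> mf; apply: maxJ; apply/hasP; exists m.
move/(congr1 (fun z : {poly K} => z`_J)); rewrite coef0 coef_sum.
pose t m : {poly k} := if m o1 == J then f@_m *: 'X^(m o0) else 0.
have coefJ m : m \in msupp f -> ((h f@_m)%:P * rho (eP3 (m o0) (m o1)))`_J =
   (map_poly h (t m)).[u].
  move=> mf; have := mf; rewrite mcoeff_msupp => /Ef; rewrite mdeg2 => /rho_eP3[sz lc].
  rewrite coefCM /t; case: eqP => [e|ne].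
    have -> : (rho (eP3 (m o0) (m o1)))`_J = u ^+ m o0 by rewrite -lc lead_coefE sz e.
    by rewrite map_polyZ map_polyXn hornerZ hornerXn.
  rewrite nth_default ?mulr0 ?rmorph0 ?horner0 // sz ltn_neqAle maxJ // andbT; exact/eqP.
rewrite big_seq; under eq_bigr => m mf do rewrite coefJ //.
rewrite -big_seq -horner_sum -rmorph_sum /= => /u_transcendental.
move/(congr1 (fun z : {poly k} => z`_(m0 o0))); rewrite coef0 coef_sum (bigD1_seq m0) ?msupp_uniq //=.
rewrite {1}/t m0J eqxx coefZ coefXn eqxx mulr1 big1 ?addr0 => [e|m ne].
  by move: m0f; rewrite mcoeff_msupp e eqxx.
rewrite /t; case: eqP => [e|]; last by rewrite coef0.
rewrite coefZ coefXn; case: eqP => [e'|]; last by rewrite mulr0.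
by move: ne; rewrite (@monP m m0) ?eqxx // e m0J.
Qed.

End Transcendental.

Lemma Psi_inj f : inE f -> PsiD f = 0 -> f = 0.
Proof.
(* The field k(X), with X itself as the transcendental element. *)
pose h : {rmorphism k -> {fraction {poly k}}} := @FracField.tofrac {poly k} \o polyC.
apply: (@Psi_inj_transcendental _ h (@FracField.tofrac {poly k} 'X)) => p.
have -> : map_poly h p = map_poly (@FracField.tofrac {poly k}) (map_poly polyC p).
  by rewrite map_poly_comp.
rewrite horner_map /= => /eqP; rewrite tofrac_eq0 => /eqP.
by rewrite -/(p \Po 'X) comp_polyXr.
Qed.

End QuadricModel.

(* What is used of the quadric [A], with its sign involution [mmu], and of the inclusion
   [mval] of its ring of invariants [R]. *)
Record model (k : fieldType) (A R : comAlgType k) := Model {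
  mx0 : A; mx1 : A; my : A;
  mmu : {lrmorphism A -> A};
  mval : {lrmorphism R -> A};
  model_rel : mx0 * my = mx1 ^+ 2 + 1;
  model_surj : forall x : A, exists2 f, inE f & Psi mx0 mx1 my f = x;
  model_inj : forall f, inE f -> Psi mx0 mx1 my f = 0 -> f = 0;
  model_lift : forall z0 z1 w : A, z0 * w = z1 ^+ 2 + 1 ->
    exists phi : {lrmorphism A -> A}, [/\ phi mx0 = z0, phi mx1 = z1 & phi my = w];
  model_der : exists d : derivation A,
    [/\ d mx0 = 0, d mx1 = mx0 & d my = 2%:R *: mx1];
  model_mux0 : mmu mx0 = - mx0;
  model_mux1 : mmu mx1 = - mx1;
  model_muy : mmu my = - my;
  model_val_inj : injective mval;
  model_val_fix : forall r, mmu (mval r) = mval r;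
  model_val_im : forall x, mmu x = x -> exists r, mval r = x
}.

Section Coordinates.
Variable k : fieldType.
Hypothesis hk : [pchar k] =i pred0.
Variables (A R : comAlgType k) (M : model A R).
Local Notation P := {mpoly k[2]}.
Local Notation o1 := (ord_max : 'I_2).
Local Notation o0 := (ord0 : 'I_2).
Local Notation x0 := (mx0 M).
Local Notation x1 := (mx1 M).
Local Notation y := (my M).
Local Notation mu := (mmu M).
Local Notation val := (mval M).
Local Notation PsiM := (Psi x0 x1 y).
Local Notation eM := (nform x0 x1 y).
Implicit Types (f g : P) (m : 'X_{1..2}) (i j a b c : nat).

Definition Phi (x : A) : P := s2val (cid2 (model_surj M x)).

Lemma Phi_inE x : inE (Phi x).
Proof. exact: s2valP (cid2 (model_surj M x)). Qed.
Arguments Phi_inE x : clear implicits.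

Lemma PhiK : cancel Phi PsiM.
Proof. by move=> x; apply: s2valP' (cid2 (model_surj M x)). Qed.

Lemma Phi_uniq x f : inE f -> PsiM f = x -> Phi x = f.
Proof.
move=> Ef ef; apply/eqP; rewrite -subr_eq0; apply/eqP; apply: (model_inj (m := M)).
  by apply: supp_inB => //; apply: Phi_inE.
by rewrite linearB /= PhiK ef subrr.
Qed.

Lemma PsiK f : inE f -> Phi (PsiM f) = f.
Proof. by move=> Ef; apply: Phi_uniq. Qed.

Lemma Phi_linear : linear Phi.
Proof.
move=> c x y; apply: Phi_uniq; last by rewrite linearP /= !PhiK.
by apply: supp_inD; [apply: supp_inZ|]; apply: Phi_inE.
Qed.
HB.instance Definition _ := GRing.isLinear.Build k A P _ Phi Phi_linear.

Lemma inE_C f : inC f -> inE f.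
Proof. by apply: supp_inW => m; lia. Qed.

Lemma Phi_mul (Q : pred 'X_{1..2}) (Q' : pred 'X_{1..2}) (Q'' : pred 'X_{1..2}) f g :
  (forall m m', Q m -> Q' m' -> forall l, lower (m o0 + m' o0) (m o1 + m' o1) l -> Q'' l) ->
  inE f -> inE g -> supp_in Q f -> supp_in Q' g ->
  supp_in Q'' (Phi (PsiM f * PsiM g) - f * g).
Proof.
move=> HQ Ef Eg Qf Qg.
have : supp_in (fun m => Q m && ~~ odd (mdeg m)) f by move=> m nz; rewrite Qf ?Ef.
elim/supp_in_ind: f / {Ef Qf} => [|c m f /andP[Qm Em] IHf].
  by rewrite linear0 !mul0r linear0 subr0; apply: supp_in0.
rewrite linearP /= !mulrDl linearD /= opprD addrACA; apply: supp_inD => //.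
rewrite -!scalerAl linearZ /= -scalerBr; apply: supp_inZ => {IHf}.
have : supp_in (fun m => Q' m && ~~ odd (mdeg m)) g by move=> m' nz; rewrite Qg ?Eg.
elim/supp_in_ind: g / {Eg Qg} => [|c' m' g /andP[Qm' Em'] IHg].
  by rewrite linear0 !mulr0 linear0 subr0; apply: supp_in0.
rewrite linearP /= !mulrDr linearD /= opprD addrACA; apply: supp_inD => //.
rewrite -!scalerAr linearZ /= -scalerBr; apply: supp_inZ => {IHg}.
rewrite -[m]mon_eta -[m']mon_eta !PsiX monXD.
rewrite mdeg2 in Em; rewrite mdeg2 in Em'.
have [h eh lh] := nform_mul (model_rel M) Em Em'; rewrite -eh PsiK.
  by apply: supp_inW lh => l; apply: HQ.
by apply: inE_lower lh; lia.
Qed.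

(** The corrections are quotients by (uv)^t with t > 0, of weight smaller by (a + b)t. *)
Lemma Phi_wle a b (n n' : int) f g : (0 < a + b)%N -> inE f -> inE g ->
  wle a b n f -> wle a b n' g -> wle a b (n + n' - 1) (Phi (PsiM f * PsiM g) - f * g).
Proof.
move=> ab Ef Eg nf ng; apply: Phi_mul Ef Eg nf ng => m m'.
rewrite /wt => mn mn' l /andP[l0 /eqP l1].
have [t [e0 e1 t0]] : exists t, [/\ (l o0 + t = m o0 + m' o0)%N, (l o1 + t = m o1 + m' o1)%N & (0 < t)%N].
  by exists (m o0 + m' o0 - l o0)%N; split; lia.
have h0 : (a * l o0 + a * t = a * m o0 + a * m' o0)%N by rewrite -!mulnDr e0.
have h1 : (b * l o1 + b * t = b * m o1 + b * m' o1)%N by rewrite -!mulnDr e1.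
have h2 : (0 < a * t + b * t)%N by rewrite -mulnDl muln_gt0 ab.
lia.
Qed.

Definition wleD a b (n : int) (x : A) := wle a b n (Phi x).

Lemma wlnform_mul a b (n n' : int) x y : (0 < a + b)%N -> wleD a b n x -> wleD a b n' y ->
  wleD a b (n + n') (x * y).
Proof.
move=> ab nx ny; rewrite /wleD -[Phi (x * y)](subrK (Phi x * Phi y)).
apply: supp_inD; last exact: wleM.
have := Phi_wle ab (Phi_inE x) (Phi_inE y) nx ny; rewrite !PhiK; apply: wleW; lia.
Qed.

Definition sgn : P -> P := lin (fun m => (-1) ^+ (mdeg m)./2 *: 'X_[m]).
HB.instance Definition _ := GRing.Linear.copy sgn (lin (fun m => (-1) ^+ (mdeg m)./2 *: 'X_[m] : P)).

Lemma sgnE f m : (sgn f)@_m = (-1) ^+ (mdeg m)./2 * f@_m.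
Proof.
have : supp_in predT f by [].
elim/supp_in_ind: f / => [|c m' f _ IH]; first by rewrite linear0 mcoeff0 mulr0.
rewrite linearP /= !mcoeffD !mcoeffZ IH mulrDr {1}/sgn linX mcoeffZ mcoeffX.
by case: eqP => [->|_]; rewrite !(mulr0, mulr1) // mulrC.
Qed.

Lemma exprN3 (B : comAlgType k) (x y' z : B) a b c :
  (- x) ^+ a * (- y') ^+ b * (- z) ^+ c = (-1) ^+ (a + b + c) *: (x ^+ a * y' ^+ b * z ^+ c).
Proof.
rewrite -(scaleN1r x) -(scaleN1r y') -(scaleN1r z) !exprZn.
rewrite -scalerAr -!scalerAl -scalerAr -scalerAl !scalerA -!exprD.
by congr (_ ^+ _ *: _); lia.
Qed.

Lemma mu_nform i j : ~~ odd (i + j) -> mu (eM i j) = (-1) ^+ (i + j)./2 *: eM i j.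
Proof.
move=> Oij; rewrite /nform !rmorphM !rmorphXn /= model_mux0 model_mux1 model_muy exprN3.
by congr (_ ^+ _ *: _); lia.
Qed.

Lemma mu_Psi f : inE f -> mu (PsiM f) = PsiM (sgn f).
Proof.
move=> Ef; elim/supp_in_ind: f / Ef => [|c m f Em IH]; first by rewrite !linear0.
rewrite !linearP /= IH; congr (_ *: _ + _).
have -> : sgn 'X_[m] = (-1) ^+ (mdeg m)./2 *: 'X_[m] by rewrite /sgn linX.
rewrite linearZ /= -[m]mon_eta !PsiX mu_nform ?mon_eta ?mdeg2 //.
by rewrite -mdeg2.
Qed.

Lemma sgn_inE f : inE f -> inE (sgn f).
Proof. by move=> Ef m; rewrite sgnE mulf_eq0 negb_or => /andP[_ /Ef]. Qed.

Lemma muK : involutive mu.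
Proof.
move=> x; rewrite -[x]PhiK !mu_Psi; [|apply: sgn_inE|]; try exact: Phi_inE.
congr PsiM; apply/mpolyP => m; rewrite !sgnE mulrA -expr2 -exprM mulnC exprM.
by rewrite sqrrN expr1n expr1n mul1r.
Qed.

Lemma mu_fixedP (x : A) : mu x = x <-> inC (Phi x).
Proof.
rewrite -{1 2}[x]PhiK mu_Psi; last exact: Phi_inE.
have e m : (-1) ^+ (mdeg m)./2 * (Phi x)@_m = (Phi x)@_m <-> ((Phi x)@_m != 0 -> (4 %| mdeg m)%N).
  case: (eqVneq (Phi x)@_m 0) => [->|nz]; first by rewrite mulr0; split.
  have Em := Phi_inE x m nz.
  have -> : (4 %| mdeg m)%N = ~~ odd (mdeg m)./2 by lia.
  rewrite -signr_odd; case: (odd _) => /=; last by rewrite expr0 mul1r; split.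
  rewrite expr1 mulN1r; split=> [h|/(_ isT)//].
  move/eqP: h; rewrite -subr_eq0 -opprD oppr_eq0 -mulr2n -mulr_natl mulf_eq0 (negbTE nz).
  by rewrite (negbTE (two_neq0 hk)).
split=> [/(congr1 Phi)|Cx].
  rewrite PsiK ?PsiK; [|exact: Phi_inE|apply: sgn_inE; exact: Phi_inE].
  by move=> h m; apply/e; rewrite -sgnE h.
by congr PsiM; apply/mpolyP => m; rewrite sgnE; apply/e/Cx.
Qed.

Lemma toR_subproof (x : A) : exists r, val r = 2%:R^-1 *: (x + mu x).
Proof. by apply: model_val_im; rewrite linearZ linearD /= muK addrC. Qed.
(** The averaging operator onto the invariants: being total, it can be a linear map. *)
Definition toR (x : A) : R := projT1 (cid (toR_subproof x)).

Lemma toRE x : val (toR x) = 2%:R^-1 *: (x + mu x).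
Proof. exact: (projT2 (cid (toR_subproof x))). Qed.

Lemma toR_linear : linear toR.
Proof.
move=> c x z; apply: (model_val_inj (m := M)); rewrite linearP /= !toRE linearP /=.
by rewrite addrACA -[c *: x + _]scalerDr [LHS]scalerDr !scalerA [2%:R^-1 * c]mulrC.
Qed.
HB.instance Definition _ := GRing.isLinear.Build k A R _ toR toR_linear.

Lemma toRK (x : A) : mu x = x -> val (toR x) = x.
Proof.
by move=> e; rewrite toRE e -mulr2n -scaler_nat scalerA mulVf ?scale1r ?two_neq0.
Qed.

Lemma valRK (r : R) : toR (val r) = r.
Proof. by apply: (model_val_inj (m := M)); rewrite toRK // model_val_fix. Qed.

End Coordinates.
Arguments Phi_inE {k A R} M x.

(** * Automorphisms and reduction of the Newton polygon *)

Section Conjugation.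
Variables (k : fieldType) (B : comAlgType k).
Implicit Types (D E : derivation B) (al be : alg_auto B).

Definition auto_comp al be : alg_auto B :=
  @AlgAuto k B (al \o be) (auto_inv be \o auto_inv al)
    (can_comp (auto_funK al) (auto_funK be)) (can_comp (auto_invK be) (auto_invK al)).

Definition auto_id : alg_auto B :=
  @AlgAuto k B idfun idfun (fun=> erefl) (fun=> erefl).

Definition auto_sym al : alg_auto B :=
  @AlgAuto k B (auto_inv al) al (auto_invK al) (auto_funK al).

Lemma conj_leibniz al D (x y : B) :
  (al \o D \o auto_inv al) (x * y) =
  x * (al \o D \o auto_inv al) y + (al \o D \o auto_inv al) x * y.
Proof. by rewrite /= rmorphM der_leibniz rmorphD !rmorphM /= !auto_invK. Qed.

Definition conj_der al D : derivation B :=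
  @Derivation k B (al \o D \o auto_inv al) (conj_leibniz al D).

Lemma iter_conj al D n b : iter n (conj_der al D) b = al (iter n D (auto_inv al b)).
Proof. by elim: n => [|n IH] /=; rewrite ?auto_invK // IH auto_funK. Qed.

Lemma conj_nilpotent al D : locally_nilpotent D -> locally_nilpotent (conj_der al D).
Proof.
move=> nD b; have [N HN] := nD (auto_inv al b); exists N => n le_n.
by rewrite iter_conj HN ?linear0.
Qed.

Lemma conj_irreducible al D : der_irreducible D -> der_irreducible (conj_der al D).
Proof.
move=> irr [a [[b nb] H]]; apply: irr; exists (auto_inv al a); split.
  exists (auto_inv al b); apply: contra nb => /asboolP[c e]; apply/asboolP.
  by exists (al c); rewrite -[b](auto_invK al) e rmorphM /= auto_invK.
move=> c; have /asboolP[e He] := H (al c); apply/asboolP; exists (auto_inv al e).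
by rewrite -rmorphM -He /= !auto_funK.
Qed.

End Conjugation.

Section Transport.
Variable k : fieldType.
Hypothesis hk : [pchar k] =i pred0.
Variables (A R : comAlgType k) (M : model A R).
Local Notation P := {mpoly k[2]}.
Local Notation x0 := (mx0 M).
Local Notation x1 := (mx1 M).
Local Notation y := (my M).
Local Notation mu := (mmu M).
Local Notation val := (mval M).
Local Notation PsiM := (Psi x0 x1 y).
Local Notation eM := (nform x0 x1 y).
Implicit Types (f g : P) (m : 'X_{1..2}) (i j a b c : nat).

Definition star f g : P := Phi M (PsiM f * PsiM g).

Lemma nform00 : eM 0 0 = 1.
Proof. by rewrite /nform !expr0 !mul1r. Qed.

Lemma Psi1 : PsiM 1 = 1.
Proof. by rewrite -mpolyX0 -mon00 PsiX nform00. Qed.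

Lemma star_okP : star_ok star.
Proof.
split=> [f Cf|f Cf|f g Cf Cg|a b n n' f g ab Cf Cg nf ng].
- by rewrite /star Psi1 mul1r PsiK //; apply: inE_C.
- by rewrite /star Psi1 mulr1 PsiK //; apply: inE_C.
- apply/(mu_fixedP hk); rewrite rmorphM /=.
  by congr (_ * _); apply/(mu_fixedP hk); rewrite PsiK //; apply: inE_C.
- by apply: Phi_wle => //; apply: inE_C.
Qed.

Definition coord (r : R) : P := Phi M (val r).
HB.instance Definition _ := GRing.Linear.copy coord (Phi M \o val).
Definition elt (f : P) : R := toR M (PsiM f).
HB.instance Definition _ := GRing.Linear.copy elt (toR M \o PsiM).

Lemma inC_coord r : inC (coord r).
Proof. by apply/(mu_fixedP hk)/model_val_fix. Qed.

Lemma coordK : cancel coord elt.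
Proof. by move=> r; rewrite /elt PhiK valRK. Qed.

Lemma val_elt f : inC f -> val (elt f) = PsiM f.
Proof.
by move=> Cf; rewrite toRK //; apply/(mu_fixedP hk); rewrite PsiK //; apply: inE_C.
Qed.

Lemma eltK f : inC f -> coord (elt f) = f.
Proof. by move=> Cf; rewrite /coord val_elt // PsiK //; apply: inE_C. Qed.

Lemma coordM r r' : coord (r * r') = star (coord r) (coord r').
Proof. by rewrite /coord rmorphM /star !PhiK. Qed.

Definition der_op (E : derivation R) : P -> P := coord \o E \o elt.
HB.instance Definition _ E := GRing.Linear.copy (der_op E) (coord \o E \o elt).

Lemma coord_der (E : derivation R) r : coord (E r) = der_op E (coord r).
Proof. by rewrite /der_op /= coordK. Qed.

Lemma coord_iter (E : derivation R) n r : coord (iter n E r) = iter n (der_op E) (coord r).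
Proof. by elim: n => //= n <-; rewrite coord_der. Qed.

Lemma der_op_ok (E : derivation R) : locally_nilpotent E -> lnd_ok star (der_op E).
Proof.
move=> nE; split=> [f Cf|f g Cf Cg|f Cf]; first exact: inC_coord.
  rewrite -[in LHS](eltK Cf) -[in LHS](eltK Cg) -coordM /= -coord_der.
  by rewrite der_leibniz linearD /= !coordM !coord_der !eltK.
have [N HN] := nE (elt f); exists N.
by rewrite -(eltK Cf) -coord_iter HN // linear0.
Qed.

Lemma der_op_neq0 (E : derivation R) r : E r <> 0 -> exists2 f, inC f & der_op E f <> 0.
Proof.
move=> nz; exists (coord r); first exact: inC_coord.
by rewrite -coord_der => /(congr1 elt); rewrite coordK linear0.
Qed.

Lemma lrmorph_eq (phi psi : {lrmorphism A -> A}) :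
  phi x0 = psi x0 -> phi x1 = psi x1 -> phi y = psi y -> phi =1 psi.
Proof.
move=> e0 e1 ey x; rewrite -(PhiK M x) /Psi /lin !linear_sum; apply: eq_bigr => m _.
by rewrite !linearZ /nform !rmorphM !rmorphXn /= e0 e1 ey.
Qed.

Section Automorphism.
Variable phi : {lrmorphism A -> A}.
Hypotheses (o0 : mu (phi x0) = - phi x0) (o1 : mu (phi x1) = - phi x1) (oy : mu (phi y) = - phi y).

(** The generators go to odd elements, so [phi] commutes with the involution and restricts to R. *)
Lemma phi_mu x : mu (phi x) = phi (mu x).
Proof.
move: x; apply: (@lrmorph_eq (mu \o phi) (phi \o mu)) => /=.
- by rewrite o0 model_mux0 rmorphN.
- by rewrite o1 model_mux1 rmorphN.
- by rewrite oy model_muy rmorphN.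
Qed.

Lemma restr_subproof r : exists r', val r' = phi (val r).
Proof. by apply: model_val_im; rewrite phi_mu model_val_fix. Qed.
Definition restr (r : R) : R := projT1 (cid (restr_subproof r)).

Lemma restrE r : val (restr r) = phi (val r).
Proof. exact: projT2 (cid (restr_subproof r)). Qed.

Lemma restr_linear : linear restr.
Proof.
move=> c r s; apply: (model_val_inj (m := M)).
by rewrite linearP /= !restrE !linearP /=.
Qed.

Lemma restr_monoid : monoid_morphism restr.
Proof.
split=> [|r s]; apply: (model_val_inj (m := M)).
  by rewrite restrE !rmorph1.
by rewrite restrE [RHS]rmorphM /= !restrE [X in phi X]rmorphM /= rmorphM.
Qed.
HB.instance Definition _ := GRing.isLinear.Build k R R _ restr restr_linear.
HB.instance Definition _ := GRing.isMonoidMorphism.Build R R restr restr_monoid.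
Definition restr_morph : {lrmorphism R -> R} := restr.
End Automorphism.

Lemma auto_exists (phi psi : {lrmorphism A -> A}) :
  mu (phi x0) = - phi x0 -> mu (phi x1) = - phi x1 -> mu (phi y) = - phi y ->
  mu (psi x0) = - psi x0 -> mu (psi x1) = - psi x1 -> mu (psi y) = - psi y ->
  phi (psi x0) = x0 -> phi (psi x1) = x1 -> phi (psi y) = y ->
  psi (phi x0) = x0 -> psi (phi x1) = x1 -> psi (phi y) = y ->
  exists al : alg_auto R, (forall r, val (al r) = phi (val r)) /\
    (forall r, val (auto_inv al r) = psi (val r)).
Proof.
move=> a0 a1 ay b0 b1 by_ c0 c1 cy d0 d1 dy.
pose f := restr_morph a0 a1 ay; pose g := restr_morph b0 b1 by_.
have fg : cancel f g.
  move=> r; apply: (model_val_inj (m := M)); rewrite /= !restrE.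
  exact: (@lrmorph_eq (psi \o phi) idfun).
have gf : cancel g f.
  move=> r; apply: (model_val_inj (m := M)); rewrite /= !restrE.
  exact: (@lrmorph_eq (phi \o psi) idfun).
by exists (AlgAuto fg gf); split=> r /=; rewrite restrE.
Qed.

End Transport.

Section Flip.
Variable k : fieldType.
Hypothesis hk : [pchar k] =i pred0.
Local Notation P := {mpoly k[2]}.
Local Notation o1 := (ord_max : 'I_2).
Local Notation o0 := (ord0 : 'I_2).
Implicit Types (f g : P) (m : 'X_{1..2}) (i j a b c : nat).

Definition flip : P -> P := lin (fun m => 'X_[mon (m o1) (m o0)]).
HB.instance Definition _ := GRing.Linear.copy flip (lin (fun m => 'X_[mon (m o1) (m o0)] : P)).

Lemma flipX i j : flip 'X_[mon i j] = 'X_[mon j i].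
Proof. by rewrite /flip linX mon_0 mon_1. Qed.

Lemma flipK : involutive flip.
Proof.
move=> f; have : supp_in predT f by [].
elim/supp_in_ind: f / => [|c m f _ IH]; first by rewrite !linear0.
by rewrite !linearP /= IH -[m]mon_eta !flipX.
Qed.

Lemma cf_flip f (x z : int) : cf (flip f) x z = cf f z x.
Proof.
have : supp_in predT f by [].
elim/supp_in_ind: f / => [|c m f _ IH]; first by rewrite linear0 !cf0.
by rewrite linearP /= !cfD !cfZ IH -[m]mon_eta flipX !cfX andbC.
Qed.

Lemma flip_supp_in (Q Q' : pred 'X_{1..2}) f :
  (forall i j, Q (mon i j) -> Q' (mon j i)) -> supp_in Q f -> supp_in Q' (flip f).
Proof.
move=> QQ Qf; apply: supp_in_lin Qf => m; rewrite -[m]mon_eta /= flipX => /QQ; exact: supp_inX.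
Qed.

Lemma inC_flip f : inC f -> inC (flip f).
Proof. by apply: flip_supp_in => i j; rewrite !mdeg_mon addnC. Qed.

Lemma inE_flip f : inE f -> inE (flip f).
Proof. by apply: flip_supp_in => i j; rewrite !mdeg_mon addnC. Qed.

Lemma wle_flip a b (n : int) f : wle a b n f -> wle b a n (flip f).
Proof. by apply: flip_supp_in => i j; rewrite !wt_mon addnC. Qed.

Variables E E' : {linear P -> P}.
Hypothesis EE' : forall f, inC f -> E' (flip f) = flip (E f).

Lemma wdeg_flip a b (d : int) : wdeg E a b d -> wdeg E' b a d.
Proof.
move=> Ed n f Cf nf; rewrite -[f]flipK EE'; last exact: inC_flip.
by apply/wle_flip/Ed; [apply: inC_flip|apply: wle_flip].
Qed.

Lemma cc_flip (r s : int) i j : (4 %| i + j)%N -> cc E' r s i j = cc E s r j i.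
Proof.
by move=> C; rewrite /cc -flipX EE' ?cf_flip //; apply: inCmon; rewrite addnC.
Qed.

Lemma newton_flip p q : newton E p q -> newton E' q p.
Proof.
case=> Eu Ev [be be0 Hb] [al al0 Ha]; split; try exact: wdeg_flip.
  by exists al => // i j C; rewrite cc_flip // Ha // addnC.
by exists be => // i j C; rewrite cc_flip // Hb // addnC.
Qed.

End Flip.

Section Automorphisms.
Variable k : fieldType.
Hypothesis hk : [pchar k] =i pred0.
Variables (A R : comAlgType k) (M : model A R).
Local Notation P := {mpoly k[2]}.
Local Notation o1 := (ord_max : 'I_2).
Local Notation o0 := (ord0 : 'I_2).
Local Notation x0 := (mx0 M).
Local Notation x1 := (mx1 M).
Local Notation y := (my M).
Local Notation mu := (mmu M).
Local Notation val := (mval M).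
Local Notation PsiM := (Psi x0 x1 y).
Local Notation eM := (nform x0 x1 y).
Implicit Types (f g : P) (m : 'X_{1..2}) (i j a b c : nat).

(** The relation is symmetric in x0 and y; this provides the reduction to q <= p. *)
Lemma swap_auto : exists al : alg_auto R,
  (forall r, coord M (al r) = flip (coord M r)) /\
  (forall r, coord M (auto_inv al r) = flip (coord M r)).
Proof.
have [|phi [e0 e1 ey]] := @model_lift k A R M y x1 x0; first by rewrite mulrC (model_rel M).
have phiE x : Phi M (phi x) = flip (Phi M x).
  apply: Phi_uniq; first by apply/inE_flip/(Phi_inE M).
  rewrite -[x in RHS](PhiK M); move: (Phi M x) => f.
  have : supp_in predT f by [].
  elim/supp_in_ind: f / => [|c m f _ IH]; first by rewrite !linear0.
  rewrite !linearP /= IH; congr (_ *: _ + _); rewrite -[m]mon_eta flipX !PsiX /nform.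
  by rewrite !rmorphM !rmorphXn /= e0 e1 ey minnC [X in X * _ = _]mulrC.
have [||||||||||||al [H H']] := @auto_exists k A R M phi phi; rewrite ?e0 ?e1 ?ey
  ?(model_mux0, model_mux1, model_muy) //.
by exists al; split=> r; rewrite /coord ?H ?H'.
Qed.

Lemma wleD_scale a b (n : int) (c' : k) x : wleD M a b n x -> wleD M a b n (c' *: x).
Proof. by rewrite /wleD linearZ; apply: supp_inZ. Qed.

Lemma wleDW a b (n n' : int) x : n <= n' -> wleD M a b n x -> wleD M a b n' x.
Proof. exact: wleW. Qed.

Lemma wleD_add a b (n : int) x z : wleD M a b n x -> wleD M a b n z -> wleD M a b n (x + z).
Proof. by rewrite /wleD linearD; apply: supp_inD. Qed.

Lemma wleD_nform a b i j : ~~ odd (i + j) -> wleD M a b (a * i + b * j)%N (eM i j).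
Proof.
move=> Oij; rewrite /wleD -PsiX PsiK; last by apply: supp_inX; rewrite mdeg_mon.
by rewrite -wt_mon; apply: wleX.
Qed.

Lemma wleD_1 a b : wleD M a b 0 1.
Proof. by have := @wleD_nform a b 0 0 isT; rewrite !muln0 nform00. Qed.

Lemma nform20 : eM 2 0 = x0. Proof. by rewrite /nform /= expr1 !expr0 !mulr1. Qed.
Lemma nform11 : eM 1 1 = x1. Proof. by rewrite /nform /= expr1 !expr0 !mul1r. Qed.
Lemma nform02 : eM 0 2 = y. Proof. by rewrite /nform /= expr1 !expr0 !mulr1 mul1r. Qed.

Lemma wleD_exp a b (n : int) N x : (0 < a + b)%N -> wleD M a b n x ->
  wleD M a b (N%:Z * n) (x ^+ N).
Proof.
move=> ab nx; elim: N => [|N IH]; first by rewrite expr0 mul0r; apply: wleD_1.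
rewrite exprS; apply: wleDW (wlnform_mul ab nx IH); lia.
Qed.

(** The generators suffice because the weight of a normal form is exactly the sum of the weights of
    its factors. *)
Lemma wleD_morph a b (phi : {lrmorphism A -> A}) : (0 < a + b)%N ->
  wleD M a b (2 * a)%N (phi x0) -> wleD M a b (a + b)%N (phi x1) ->
  wleD M a b (2 * b)%N (phi y) ->
  forall (n : int) x, wleD M a b n x -> wleD M a b n (phi x).
Proof.
move=> ab h0 h1 hy n x nx; rewrite -(PhiK M x).
have : supp_in (fun m => ((wt a b m)%:Z <= n) && ~~ odd (mdeg m)) (Phi M x).
  by move=> m nz; apply/andP; split; [exact: nx | exact: (Phi_inE M _ m nz)].
move: (Phi M x) => f; elim/supp_in_ind: f / => [|c m f /andP[mn Em] IH].
  by rewrite !linear0 /wleD linear0; apply: supp_in0.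
rewrite !linearP /=; apply: wleD_add => //; apply: wleD_scale.
rewrite -[m]mon_eta PsiX /nform !rmorphM !rmorphXn /=.
move: Em mn; rewrite mdeg2 /wt; move: (m o0) (m o1) => i j Em mn.
set I := ((i - j)./2)%N; set J := ((j - i)./2)%N; set L := minn i j.
have w := wlnform_mul ab (wlnform_mul ab (@wleD_exp _ _ _ I _ ab h0) (@wleD_exp _ _ _ J _ ab hy))
  (@wleD_exp _ _ _ L _ ab h1).
apply: wleDW w.
have iE : i = (2 * I + L)%N by rewrite /I /L; lia.
have jE : j = (2 * J + L)%N by rewrite /J /L; lia.
have mnE : (a * i + b * j = 2 * a * I + 2 * b * J + (a + b) * L)%N by rewrite {1}iE {1}jE; ring.
rewrite mnE in mn; lia.
Qed.

(** The image of y is dictated by the relation: it is ((x1 + la x0^(2c+1))^2 + 1)/x0. *)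
Lemma shear_lift c (la : k) : exists phi : {lrmorphism A -> A},
  [/\ phi x0 = x0, phi x1 = x1 + la *: x0 ^+ (2 * c).+1 &
     phi y = y + (2%:R * la) *: (x0 ^+ (2 * c) * x1) + (la ^+ 2) *: x0 ^+ (4 * c).+1].
Proof.
apply: model_lift; set T := x0 ^+ (2 * c); pose L : A := la%:A.
have e1 u : la *: u = L * u by rewrite mulr_algl.
have e2 u : (2%:R * la) *: u = 2%:R * (L * u) by rewrite -e1 -scalerA mulr_natl scaler_nat.
have e3 u : (la ^+ 2) *: u = L * (L * u) by rewrite -!e1 scalerA.
have -> : x0 ^+ (4 * c).+1 = x0 * T * T.
  by rewrite exprS -mulrA /T -exprD; congr (_ * _ ^+ _); lia.
rewrite (exprS x0 (2 * c)) -/T e1 e2 e3; transitivity (x0 * y + 2%:R * L * T * x0 * x1 + L ^+ 2 * x0 ^+ 2 * T ^+ 2).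
  ring.
rewrite model_rel; ring.
Qed.

(** For the weight (a, (4c+1)a), x1 and x0^(2c+1) both have weight (4c+2)a, so the shear respects
    the filtration. *)
Lemma wleD_shear a c (la : k) (phi : {lrmorphism A -> A}) : (0 < a)%N ->
  phi x0 = x0 -> phi x1 = x1 + la *: x0 ^+ (2 * c).+1 ->
  phi y = y + (2%:R * la) *: (x0 ^+ (2 * c) * x1) + (la ^+ 2) *: x0 ^+ (4 * c).+1 ->
  forall (n : int) x, wleD M a ((4 * c + 1) * a) n x -> wleD M a ((4 * c + 1) * a) n (phi x).
Proof.
move=> a0 e0 e1 ey; set b := ((4 * c + 1) * a)%N.
have ab : (0 < a + b)%N by rewrite addn_gt0 a0.
have w0 N : x0 ^+ N = eM (2 * N) 0.
  by rewrite /nform subn0 minn0 sub0n !expr0 !mulr1 mul2n doubleK.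
apply: (wleD_morph ab).
- by rewrite e0 -nform20; apply: wleDW (wleD_nform _ _ _) => //; lia.
- rewrite e1; apply: wleD_add.
    by rewrite -nform11; apply: wleDW (wleD_nform _ _ _) => //; lia.
  apply: wleD_scale; rewrite w0; apply: wleDW (wleD_nform _ _ _); rewrite /b; lia.
- rewrite ey; apply: wleD_add; first apply: wleD_add.
  + by rewrite -nform02; apply: wleDW (wleD_nform _ _ _) => //; lia.
  + apply: wleD_scale; rewrite w0 -nform11.
    by apply: wleDW (wlnform_mul ab (wleD_nform _ _ _) (wleD_nform _ _ _)); rewrite /b; lia.
  + apply: wleD_scale; rewrite w0; apply: wleDW (wleD_nform _ _ _); rewrite /b; lia.
Qed.

End Automorphisms.

Section NewtonTop.
Variable k : fieldType.
Hypothesis hk : [pchar k] =i pred0.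
Local Notation P := {mpoly k[2]}.
Variables (star : P -> P -> P) (E : {linear P -> P}).
Hypotheses (star_okP : star_ok star) (EP : lnd_ok star E).
Hypothesis E_neq0 : exists2 f, inC f & E f <> 0.
Variables p q : nat.
Hypothesis EN : newton E p q.

Definition newton_top : {linear P -> P} := grE E q.+1 p.+1 (p%:Z * q%:Z - 1).

Lemma newton_top_main : (q <= p)%N -> exists c, p.+1 = ((4 * c + 1) * q.+1)%N /\
  exists n la, [/\ ndeg newton_top 'X_[mon 3 1] n, ndeg newton_top 'X_[mon (4 * c + 4) 0] n &
    iter n newton_top ('X_[mon 3 1] - la *: 'X_[mon (4 * c + 4) 0]) = 0].
Proof.
have Ed := newton_edge hk star_okP EP E_neq0 EN.
have cf_top i j (x y : int) : q.+1%:Z * x + p.+1%:Z * y = p%:Z * q%:Z - 1 ->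
    cc newton_top x y i j = cc E x y i j.
  move=> e; rewrite /cc /newton_top /= grEX cf_hpart // wt_mon PoszD !PoszM -e; ring.
have topP : lnd_ok *%R newton_top :=
  @grE_ok k star E star_okP EP q.+1 p.+1 _ isT Ed.
apply: (edge_main hk topP).
- by move=> i j; rewrite /newton_top /= grEX; apply: hpart_homog.
- have [be be0 H] := newton_low EN; exists be => // i j C.
  by rewrite cf_top ?H //; lia.
- have [al al0 H] := newton_left EN; exists al => // i j C.
  by rewrite cf_top ?H //; lia.
Qed.

Lemma newton_top_iter f n N : inC f -> whomog q.+1 p.+1 n f ->
  wle q.+1 p.+1 (n + (p%:Z * q%:Z - 1) *+ N) (iter N E f) /\
  hpart q.+1 p.+1 (n + (p%:Z * q%:Z - 1) *+ N) (iter N E f) = iter N newton_top f.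
Proof.
move=> Cf hf; have Ed := newton_edge hk star_okP EP E_neq0 EN.
by have := grE_iter EP (isT : 0 < q.+1 + p.+1)%N Ed N Cf (homog_wle hf); rewrite (hpart_id hf).
Qed.

End NewtonTop.

Section Shear.
Variable k : fieldType.
Hypothesis hk : [pchar k] =i pred0.
Variables (A R : comAlgType k) (M : model A R).
Local Notation P := {mpoly k[2]}.
Local Notation x0 := (mx0 M).
Local Notation x1 := (mx1 M).
Local Notation y := (my M).
Local Notation mu := (mmu M).
Local Notation val := (mval M).
Local Notation PsiM := (Psi x0 x1 y).
Local Notation eM := (nform x0 x1 y).
Local Notation coord := (coord M).
Local Notation elt := (elt M).
Local Notation der_op := (der_op M).
Implicit Types (f g : P) (m : 'X_{1..2}) (i j a b c : nat).

Lemma exprN_odd (B : comAlgType k) (x : B) n : (- x) ^+ (2 * n).+1 = - x ^+ (2 * n).+1.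
Proof. by rewrite !exprS !exprM sqrrN mulNr. Qed.
Lemma exprN_even (B : comAlgType k) (x : B) n : (- x) ^+ (2 * n) = x ^+ (2 * n).
Proof. by rewrite !exprM sqrrN. Qed.

Lemma shear_odd c (la : k) (phi : {lrmorphism A -> A}) :
  phi x0 = x0 -> phi x1 = x1 + la *: x0 ^+ (2 * c).+1 ->
  phi y = y + (2%:R * la) *: (x0 ^+ (2 * c) * x1) + (la ^+ 2) *: x0 ^+ (4 * c).+1 ->
  [/\ mu (phi x0) = - phi x0, mu (phi x1) = - phi x1 & mu (phi y) = - phi y].
Proof.
have c2 : (4 * c = 2 * (2 * c))%N by lia.
move=> -> -> ->; rewrite !linearD !linearZ rmorphM !rmorphXn /= c2.
rewrite model_mux0 model_mux1 model_muy !exprN_odd exprN_even mulrN !scalerN.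
by split=> //; rewrite !opprD.
Qed.

Lemma shear_cancel c (la la' : k) (phi psi : {lrmorphism A -> A}) : la + la' = 0 ->
  phi x0 = x0 -> phi x1 = x1 + la *: x0 ^+ (2 * c).+1 ->
  phi y = y + (2%:R * la) *: (x0 ^+ (2 * c) * x1) + (la ^+ 2) *: x0 ^+ (4 * c).+1 ->
  psi x0 = x0 -> psi x1 = x1 + la' *: x0 ^+ (2 * c).+1 ->
  psi y = y + (2%:R * la') *: (x0 ^+ (2 * c) * x1) + (la' ^+ 2) *: x0 ^+ (4 * c).+1 ->
  [/\ phi (psi x0) = x0, phi (psi x1) = x1 & phi (psi y) = y].
Proof.
move=> la0 p0 p1 py s0 s1 sy; rewrite s0 s1 sy p0; split=> //.
  by rewrite linearD linearZ rmorphXn /= p0 p1 -addrA -scalerDl la0 scale0r addr0.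
rewrite !linearD !linearZ rmorphM !rmorphXn /= p0 p1 py mulrDr -scalerAr -exprD !scalerDr !scalerA.
have -> : (2 * c + (2 * c).+1 = (4 * c).+1)%N by lia.
set X := x0 ^+ (4 * c).+1; set Y := x0 ^+ _ * x1.
have la'E : la' = - la by apply/eqP; rewrite -addr_eq0 addrC la0.
rewrite la'E -!addrA; set a1 := _ *: Y; set a2 := _ *: X.
set a3 := _ *: Y; set a4 := _ *: X; set a5 := _ *: X.
have e1 : a1 + a3 = 0.
  rewrite -scalerDl (_ : _ + _ = 0) ?scale0r //; ring.
have e2 : a2 + (a4 + a5) = 0.
  rewrite -!scalerDl (_ : _ + _ = 0) ?scale0r //; ring.
by rewrite [a5 + (a1 + _)]addrCA [a5 + _]addrC -[a2 + a4 + a5]addrA e2 addr0 [a3 + a1]addrC e1 addr0.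
Qed.

Lemma elt_wle a b (n : int) r : wle a b n (coord r) <-> wleD M a b n (val r).
Proof. by []. Qed.

Lemma elt31 : val (elt 'X_[mon 3 1]) = x0 * x1.
Proof. by rewrite (val_elt hk M (@inCmon k 3 1 isT)) PsiX /nform /= !expr1 mulr1. Qed.

Lemma elt_u4 c : val (elt 'X_[mon (4 * c) 0]) = x0 ^+ (2 * c).
Proof.
have C : inC ('X_[mon (4 * c) 0] : P) by apply: inCmon; rewrite addn0 dvdn_mulr.
rewrite (val_elt hk M C) PsiX /nform subn0 minn0 sub0n !expr0 !mulr1.
by congr (_ ^+ _); lia.
Qed.

(** The inverse is the shear by -la: it sends x0 x1 to x0 x1 - la x0^(2c+2), the element singled out
    by [edge_main]. *)
Lemma shear_auto c (la : k) : exists al : alg_auto R,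
  [/\ forall a n r, (0 < a)%N -> wle a ((4 * c + 1) * a) n (coord r) ->
        wle a ((4 * c + 1) * a) n (coord (al r)),
      forall a n r, (0 < a)%N -> wle a ((4 * c + 1) * a) n (coord r) ->
        wle a ((4 * c + 1) * a) n (coord (auto_inv al r)),
      auto_inv al (elt 'X_[mon 3 1]) = elt ('X_[mon 3 1] - la *: 'X_[mon (4 * c + 4) 0]) &
      auto_inv al (elt 'X_[mon (4 * c + 4) 0]) = elt 'X_[mon (4 * c + 4) 0]].
Proof.
have [phi [p0 p1 py]] := shear_lift M c la.
have [psi [s0 s1 sy]] := shear_lift M c (- la).
have [a0 a1 ay] := shear_odd p0 p1 py.
have [b0 b1 by_] := shear_odd s0 s1 sy.
have [c0 c1 cy] := shear_cancel (subrr la) p0 p1 py s0 s1 sy.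
have [d0 d1 dy] := shear_cancel (addNr la) s0 s1 sy p0 p1 py.
have [al [H H']] := auto_exists a0 a1 ay b0 b1 by_ c0 c1 cy d0 d1 dy.
have c4 : (4 * c + 4 = 4 * c.+1)%N by lia.
exists al; split.
- move=> a n r a_gt0 nr; apply/elt_wle; rewrite H; exact: (wleD_shear a_gt0 p0 p1 py).
- move=> a n r a_gt0 nr; apply/elt_wle; rewrite H'; exact: (wleD_shear a_gt0 s0 s1 sy).
- apply: (model_val_inj (m := M)); rewrite H' linearB linearZ /= linearB linearZ /= elt31 c4 elt_u4.
  rewrite rmorphM /= s0 s1 mulrDr scaleNr mulrN -scalerAr -exprS.
  by congr (_ - _ *: _ ^+ _); lia.
- by apply: (model_val_inj (m := M)); rewrite H' c4 elt_u4 rmorphXn /= s0.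
Qed.

Section WeightsConj.
Variables (al : alg_auto R) (E : derivation R) (a b : nat).
Hypothesis wal : forall n r, wle a b n (coord r) -> wle a b n (coord (al r)).
Hypothesis wal' : forall n r, wle a b n (coord r) -> wle a b n (coord (auto_inv al r)).

Lemma wdeg_conj d : wdeg (der_op E) a b d -> wdeg (der_op (conj_der al E)) a b d.
Proof.
move=> Ed n f Cf nf.
apply: (wal (r := E (auto_inv al (elt f)))).
rewrite (coord_der hk); apply: (Ed n); first exact: inC_coord.
by apply: wal'; rewrite (eltK hk).
Qed.

End WeightsConj.

Lemma conj_neq0 (al : alg_auto R) (E : derivation R) r : E r <> 0 -> conj_der al E (al r) <> 0.
Proof. by move=> nz; rewrite /= auto_funK => /(congr1 (auto_inv al)); rewrite auto_funK linear0. Qed.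

Lemma der_op_iter (E : derivation R) n f : inC f -> iter n (der_op E) f = coord (iter n E (elt f)).
Proof. by move=> Cf; rewrite (coord_iter hk) (eltK hk). Qed.

(* If the polygon of the conjugate [E'] were that of [E], its top part would annihilate
   [u^3 v] in at most [n] steps, hence also [u^(4c+4)], which has the same degree for
   [E'] as [u^3 v]; but the shear fixes [u^(4c+4)], whose degree for [E] is [n]. *)
Lemma reduce_step p q (E : derivation R) : locally_nilpotent E -> (q <= p)%N ->
  newton (der_op E) p q ->
  exists al : alg_auto R, let E' := der_op (conj_der al E) in
    [\/ wdeg E' 1 0 (-1), wdeg E' 0 1 (-1) |
        exists p' q', newton E' p' q' /\ (p' + q' < p + q)%N].
Proof.
move=> nE qp EN; have starP := star_okP hk M; have EP := der_op_ok hk M nE.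
have E0 : exists2 f, inC f & der_op E f <> 0.
  have [al al0 H] := newton_left EN.
  exists 'X_[mon 4 0]; first by apply: inCmon.
  move=> e; have := H 4%N 0%N isT; rewrite /cc [X in cf X]e cf0 => /esym/eqP.
  by rewrite mulf_eq0 (negbTE al0) (natk_eq0 hk).
have [c [pE [n [la [dn dn' kn]]]]] := newton_top_main hk starP EP E0 EN qp.
have [al [W W' e1 e2]] := shear_auto c la; exists al => /=.
set E' := conj_der al E.
have nE' : locally_nilpotent E' by apply: conj_nilpotent.
have EP' := der_op_ok hk M nE'.
have E0' : exists2 f, inC f & der_op E' f <> 0.
  have [f Cf nz] := E0.
  apply: (@der_op_neq0 _ hk A R M E' (al (elt f))); apply: conj_neq0 => e; apply: nz.
  by rewrite -(eltK hk M Cf) -(coord_der hk) e linear0.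
case: (newton_cases hk starP EP' E0') => [?|?|[p' [q' EN']]]; [by apply: Or31|by apply: Or32|].
apply: Or33; exists p', q'; split=> //.
have Ed := newton_edge hk starP EP E0 EN.
have wE : p.+1 = ((4 * c + 1) * q.+1)%N by [].
have Wq (N : int) r := W q.+1 N r isT; have Wq' (N : int) r := W' q.+1 N r isT; rewrite -wE in Wq Wq'.
(* Both the shear and its inverse respect this weight, so the new polygon stays below the line of
   the old edge; hence p' <= p and q' <= q. *)
have Ed' : wdeg (der_op E') q.+1 p.+1 (p%:Z * q%:Z - 1) by apply: wdeg_conj.
have lep : (p' <= p)%N by have := low_vertex_le hk Ed' (newton_low EN'); nia.
have leq : (q' <= q)%N by have := left_vertex_le hk Ed' (newton_left EN'); nia.
rewrite ltnNge; apply/negP => le.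
have pp : p' = p by lia.
have qq : q' = q by lia.
rewrite {}pp {}qq in EN' lep leq le.
have [c' [pE' [n' [la' [dm dm' _]]]]] := newton_top_main hk starP EP' E0' EN' qp.
(* The slope of the edge determines c. *)
have cc' : c' = c.
  by move: pE'; rewrite pE => /eqP; rewrite eqn_pmul2r // => /eqP; lia.
rewrite {}cc' in dm'.
have C1 := @inCmon k 3 1 isT.
have C2 : inC ('X_[mon (4 * c + 4) 0] : P) by apply: inCmon; lia.
have h1 := @homogX k q.+1 p.+1 (mon 3 1).
have h2 := @homogX k q.+1 p.+1 (mon (4 * c + 4) 0).
have ew : wt q.+1 p.+1 (mon 3 1) = wt q.+1 p.+1 (mon (4 * c + 4) 0).
  by rewrite !wt_mon pE; ring.
rewrite -ew in h2.
set g := 'X_[mon 3 1] - la *: 'X_[mon (4 * c + 4) 0] in kn e1.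
have Cg : inC g by apply/supp_inB => //; apply: supp_inZ.
have hg : whomog q.+1 p.+1 (wt q.+1 p.+1 (mon 3 1))%:Z g by apply/supp_inB => //; apply: supp_inZ.
have [wg tg] := newton_top_iter hk starP EP E0 EN n Cg hg.
(* The n-th iterate of [g] under [E] falls below its expected weight, and [al] carries [g] to u^3
   v. *)
rewrite kn in tg; have {tg} := hpart_wle wg tg.
rewrite der_op_iter // -e1 => /Wq; rewrite -iter_conj -der_op_iter // => low1.
have [w1 t1] := newton_top_iter hk starP EP' E0' EN' n C1 h1.
have z1 : iter n (newton_top (der_op E') p q) 'X_[mon 3 1] = 0.
  by rewrite -t1; apply: hpart_low low1 _; lia.
have lt_n := ndeg_lt dm z1.
have [w2 t2] := newton_top_iter hk starP EP' E0' EN' n C2 h2.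
have z2 : iter n (newton_top (der_op E') p q) 'X_[mon (4 * c + 4) 0] = 0.
  by have [e _] := dm'; apply: iter_lin_ge e.
rewrite z2 in t2; have {t2} := hpart_wle w2 t2.
rewrite der_op_iter // iter_conj e2 => /Wq'; rewrite auto_funK -der_op_iter // => low2.
have [w3 t3] := newton_top_iter hk starP EP E0 EN n C2 h2.
have [_] := dn'; apply; rewrite -t3; apply: hpart_low low2 _; lia.
Qed.

End Shear.

(** * Induction on the polygon, and generators of R *)

Section Normalization.
Variable k : fieldType.
Hypothesis hk : [pchar k] =i pred0.
Variables (A R : comAlgType k) (M : model A R).
Local Notation P := {mpoly k[2]}.
Local Notation o1 := (ord_max : 'I_2).
Local Notation o0 := (ord0 : 'I_2).
Local Notation x0 := (mx0 M).
Local Notation x1 := (mx1 M).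
Local Notation y := (my M).
Local Notation mu := (mmu M).
Local Notation val := (mval M).
Local Notation PsiM := (Psi x0 x1 y).
Local Notation eM := (nform x0 x1 y).
Local Notation coord := (coord M).
Local Notation elt := (elt M).
Local Notation der_op := (der_op M).
Implicit Types (f g : P) (m : 'X_{1..2}) (i j a b c : nat) (r h : R) (E : derivation R).

Lemma der_op_flip (al : alg_auto R) E :
  (forall r, coord (al r) = flip (coord r)) ->
  (forall r, coord (auto_inv al r) = flip (coord r)) ->
  forall f, inC f -> der_op (conj_der al E) (flip f) = flip (der_op E f).
Proof.
move=> H H' f Cf; change (coord (al (E (auto_inv al (elt (flip f))))) = flip (der_op E f)).
rewrite H (coord_der hk) H' (eltK hk) ?flipK //; exact: inC_flip.
Qed.

Lemma normalize_newton p q E : locally_nilpotent E -> newton (der_op E) p q ->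
  exists al : alg_auto R, wdeg (der_op (conj_der al E)) 0 1 (-1).
Proof.
have [N] := ubnP (p + q)%N; elim: N p q E => // N IH p q E le_N nE EN.
have [sw [sw1 sw2]] := swap_auto M.
wlog qp : p q E nE EN le_N / (q <= p)%N.
  move=> H; case: (leqP q p) => [|/ltnW pq]; first exact: H EN le_N.
  have EN' := newton_flip (der_op_flip (E) sw1 sw2) EN.
  have [||al Hal] := H q p _ _ EN' _ pq; [exact: conj_nilpotent|by rewrite addnC|].
  by exists (auto_comp al sw).
have [al [Hu|Hv|[p' [q' [EN' lt]]]]] := reduce_step hk nE qp EN.
- exists (auto_comp sw al).
  exact: (wdeg_flip (der_op_flip (conj_der al E) sw1 sw2)) Hu.
- by exists al.
- have [||al' Hal'] := IH p' q' (conj_der al E) _ _ EN'; first by apply: leq_trans lt _.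
    exact: conj_nilpotent.
  by exists (auto_comp al' al).
Qed.

Lemma normalize E : locally_nilpotent E -> (exists r, E r <> 0) ->
  exists al : alg_auto R, wdeg (der_op (conj_der al E)) 0 1 (-1).
Proof.
move=> nE [r nz]; have [sw [sw1 sw2]] := swap_auto M.
case: (newton_cases hk (star_okP hk M) (der_op_ok hk M nE) (der_op_neq0 hk M nz)).
- by exists sw; apply: (wdeg_flip (der_op_flip (E) sw1 sw2)).
- by move=> Hv; exists (auto_id R).
- by move=> [p [q EN]]; apply: normalize_newton EN.
Qed.

Lemma A_ind (T : A -> Prop) :
  (forall (c : k) x z, T x -> T z -> T (c *: x + z)) ->
  (forall x z, T x -> T z -> T (x * z)) -> T 1 -> T x0 -> T x1 -> T y -> forall x, T x.
Proof.
move=> Tl Tm T1 T0 Tx1 Ty x.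
have TX n z : T z -> T (z ^+ n).
  by move=> Tz; elim: n => [|n IH]; rewrite ?expr0 ?exprS //; apply: Tm.
have T00 : T 0 by have := Tl (-1) 1 1 T1 T1; rewrite scaleN1r addNr.
rewrite -(PhiK M x); have : supp_in predT (Phi M x) by [].
move: (Phi M x) => f; elim/supp_in_ind: f / => [|c m f _ IH]; first by rewrite linear0.
rewrite linearP; apply: Tl => //; rewrite -[m]mon_eta /= PsiX.
exact: (Tm _ _ (Tm _ _ (TX _ _ T0) (TX _ _ Ty)) (TX _ _ Tx1)).
Qed.

(** As in [wdeg_gen], a normal form is a product with a degree 4 factor up to terms of lower degree,
    so the five normal forms of degree 4 generate R. *)
Lemma R_ind (T : R -> Prop) :
  (forall (c : k) r h, T r -> T h -> T (c *: r + h)) ->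
  (forall r h, T r -> T h -> T (r * h)) -> T 1 ->
  (forall m, mdeg m = 4%N -> T (elt 'X_[m])) -> forall r, T r.
Proof.
move=> Tl Tm T1 T4 r.
have T00 : T 0 by have := Tl (-1) 1 1 T1 T1; rewrite scaleN1r addNr.
have TX m : (4 %| mdeg m)%N -> T (elt 'X_[m]).
  have [N] := ubnP (mdeg m); elim: N m => // N IH m leN Cm.
  case: (posnP (mdeg m)) => [/eqP|m_gt0].
    rewrite mdeg_eq0 => /eqP ->; rewrite mpolyX0.
    have -> : elt 1 = 1; last by [].
    apply: (model_val_inj (m := M)); rewrite rmorph1 (val_elt hk M (@inC1 k)).
    exact: Psi1.
  have m_ge4 : (4 <= mdeg m)%N by apply: dvdn_leq.
  pose i := minn 4 (m o0); pose m0 := mon i (4 - i).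
  pose m' := mon (m o0 - i) (m o1 - (4 - i)).
  have mE : m = (m0 + m')%MM.
    rewrite -[m]mon_eta monD; move: m_ge4; rewrite mdeg2 => m4.
    by congr mon; rewrite /i; lia.
  have m04 : mdeg m0 = 4 by rewrite mdeg2 mon_0 mon_1 /i; lia.
  have Cm' : (4 %| mdeg m')%N by move: Cm; rewrite mE mdegD m04 dvdn_addr.
  have C0 : inC ('X_[m0] : P) by apply: inCX; rewrite m04.
  have C' : inC ('X_[m'] : P) by apply: inCX.
  set g := star M 'X_[m0] 'X_[m'] - 'X_[m0] * 'X_[m'].
  have Cg : inC g.
    by apply: supp_inB; [apply: (starC (star_okP hk M)) | apply: inCM].
  have -> : elt 'X_[m] = elt 'X_[m0] * elt 'X_[m'] - elt g.
    rewrite -[X in X - _](coordK hk M) (coordM M) !(eltK hk) // -linearB /= /g opprB addrC subrK.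
    by rewrite mE mpolyXD.
  have lt_m' : (mdeg m' < N)%N by move: leN; rewrite mE mdegD m04; lia.
  have Tg : T (elt g).
    have : supp_in (fun l => (4 %| mdeg l) && (mdeg l < mdeg m))%N g.
      move=> l nz; rewrite Cg //=.
      have := starF (star_okP hk M) (isT : 0 < 1 + 1)%N C0 C' (wleX 1 1 m0) (wleX 1 1 m').
      by move=> /(_ l nz); rewrite !wt11 mE mdegD; lia.
    elim/supp_in_ind: (g) / => [|c l f /andP[Cl lt] IHf]; first by rewrite linear0.
    rewrite linearP; apply: Tl => //; apply: IH => //; lia.
  rewrite addrC -scaleN1r; apply: Tl => //; apply: Tm; [exact: T4|exact: IH].
rewrite -(coordK hk M r); have := @inC_coord k hk A R M r.
move: (coord r) => f; elim/supp_in_ind: f / => [|c m f Cm IH]; first by rewrite linear0.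
by rewrite linearP; apply: Tl => //; apply: TX.
Qed.

End Normalization.

(** * The derivations lowering the degree in v *)

Section StandardDerivation.
Variable k : fieldType.
Hypothesis hk : [pchar k] =i pred0.
Variables (A R : comAlgType k) (M : model A R).
Local Notation P := {mpoly k[2]}.
Local Notation o1 := (ord_max : 'I_2).
Local Notation o0 := (ord0 : 'I_2).
Local Notation x0 := (mx0 M).
Local Notation x1 := (mx1 M).
Local Notation y := (my M).
Local Notation mu := (mmu M).
Local Notation val := (mval M).
Local Notation PsiM := (Psi x0 x1 y).
Local Notation eM := (nform x0 x1 y).
Local Notation coord := (coord M).
Local Notation elt := (elt M).
Local Notation der_op := (der_op M).
Implicit Types (f g : P) (m : 'X_{1..2}) (i j a b c : nat) (r h : R) (E D : derivation R).

Lemma der1 (B : comAlgType k) (D : derivation B) : D 1 = 0.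
Proof. by have [/eqP] := der_ker_subalg_closed D. Qed.

Lemma coord_inj : injective coord.
Proof. exact: can_inj (coordK hk M). Qed.

Lemma coord1 : coord 1 = 1.
Proof.
rewrite /coord rmorph1 -[1 in LHS](Psi1 M) PsiK //; exact/inE_C/inC1.
Qed.

Lemma top_exists a b r : r <> 0 -> exists n : nat, wle a b n (coord r) /\ hpart a b n (coord r) <> 0.
Proof.
move=> nz; have [n0 Hn0] := wle_exists a b (coord r).
have ex : exists n : nat, `[< wle a b n%:Z (coord r) >] by exists n0; apply/asboolP.
case: (ex_minnP ex) => n /asboolP nr min_n; exists n; split=> // h0.
have low := hpart_wle nr h0; case: n nr min_n h0 low => [|n] nr min_n h0 low.
  apply: nz; apply: coord_inj; rewrite linear0; apply: wle_neg low; lia.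
have : (n.+1 <= n)%N; last by rewrite ltnn.
by apply: min_n; apply/asboolP; apply: wleW low; lia.
Qed.

Lemma top_mul a b (n n' : int) r r' : (0 < a + b)%N -> wle a b n (coord r) -> wle a b n' (coord r') ->
  hpart a b (n + n') (coord (r * r')) = hpart a b n (coord r) * hpart a b n' (coord r').
Proof.
by move=> ab nr nr'; rewrite coordM (hpart_star (star_okP hk M)) //; apply: inC_coord.
Qed.

(** These are x0^2, x0 x1 and x1^2. The other two generators are x1 y and y^2, and [s_mul13],
    [s_mul04] express their multiples by [s] through [t] and [z]. *)
Local Notation s := (elt 'X_[mon 4 0]).
Local Notation t := (elt 'X_[mon 3 1]).
Local Notation z := (elt 'X_[mon 2 2]).

Lemma coord_elt i j : (4 %| i + j)%N -> coord (elt 'X_[mon i j]) = 'X_[mon i j].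
Proof. by move=> C; rewrite (eltK hk) //; apply: inCmon. Qed.

Lemma wle_elt a b (n : int) i j : (4 %| i + j)%N -> (a * i + b * j)%N%:Z <= n ->
  wle a b n (coord (elt 'X_[mon i j])).
Proof. by move=> C le_n; rewrite coord_elt //; apply: wleW (wleX a b _); rewrite wt_mon. Qed.

Lemma val_elt_mon i j : (4 %| i + j)%N -> val (elt 'X_[mon i j]) = eM i j.
Proof. by move=> C; rewrite (val_elt hk) ?PsiX //; apply: inCmon. Qed.

(* [x0^2] raises the degree in [u] by 4. *)
Lemma s_mul_eq0 h : wle 1 0 3 (coord (s * h)) -> h = 0.
Proof.
move=> w3; apply: contrapT => nz; have [n [nw nt]] := @top_exists 1 0 h nz.
have sw : wle 1 0 4 (coord s) by apply: wle_elt.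
have := top_mul (isT : 0 < 1 + 0)%N sw nw; rewrite (hpart_low w3); last by lia.
rewrite coord_elt // hpart_id; last by apply: supp_inX; rewrite wt_mon.
move=> /esym/eqP; rewrite mulf_eq0.
case/orP => /eqP // /(congr1 (fun f : P => f@_(mon 4 0))).
by rewrite mcoeffX eqxx mcoeff0 => /eqP; rewrite oner_eq0.
Qed.

Lemma s_regular h : s * h = 0 -> h = 0.
Proof. by move=> e; apply: s_mul_eq0; rewrite e linear0; apply: supp_in0. Qed.

Lemma scale1_eq0 (c : k) r : c *: r = 0 -> r <> 0 -> c = 0.
Proof.
move=> e nz; apply/eqP; apply: contrapT => /negP c0; apply: nz.
by rewrite -[r]scale1r -(mulVf c0) -scalerA e scaler0.
Qed.

Lemma elt_neq0 i j : (4 %| i + j)%N -> elt 'X_[mon i j] <> 0.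
Proof.
move=> C /(congr1 coord); rewrite coord_elt // linear0 => /(congr1 (fun f : P => f@_(mon i j))).
by rewrite mcoeffX eqxx mcoeff0 => /eqP; rewrite oner_eq0.
Qed.

Lemma t_sqr : t * t = s * z.
Proof.
apply: (model_val_inj (m := M)); rewrite !rmorphM /= !val_elt_mon // /nform /=; ring.
Qed.

Lemma s_mul13 : s * elt 'X_[mon 1 3] = t * (z + 1).
Proof.
apply: (model_val_inj (m := M)); rewrite !rmorphM rmorphD rmorph1 /= !val_elt_mon // /nform /=.
rewrite !expr1 !expr0 !mulr1 !mul1r -(model_rel M); ring.
Qed.

Lemma s_mul04 : s * elt 'X_[mon 0 4] = (z + 1) * (z + 1).
Proof.
apply: (model_val_inj (m := M)); rewrite !rmorphM rmorphD rmorph1 /= !val_elt_mon // /nform /=.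
rewrite !expr0 !mulr1 !mul1r -(model_rel M); ring.
Qed.

Lemma mon_deg4 (T : R -> Prop) : T s -> T t -> T z -> T (elt 'X_[mon 1 3]) -> T (elt 'X_[mon 0 4]) ->
  forall m, mdeg m = 4%N -> T (elt 'X_[m]).
Proof.
move=> Ts Tt Tz T13 T04 m; rewrite -[m]mon_eta mdeg_mon; move: (m o0) (m o1) => i j ij.
have -> : j = (4 - i)%N by lia.
have : (i <= 4)%N by lia.
by case: i ij => [|[|[|[|[|]]]]].
Qed.

Lemma s_pow c : s * elt 'X_[mon (4 * c) 0] = elt 'X_[mon (4 * c.+1) 0].
Proof.
have -> : s = elt 'X_[mon (4 * 1) 0] by [].
by apply: (model_val_inj (m := M)); rewrite rmorphM /= !elt_u4 // -exprD; congr (_ ^+ _); lia.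
Qed.

Lemma v0_split r : wle 0 1 0 (coord r) -> exists (c : k) r', wle 0 1 0 (coord r') /\
  r = c *: 1 + s * r' /\ (coord r)@_(mon 0 0) = c.
Proof.
move=> v0; have Cr := @inC_coord k hk A R M r.
have : supp_in (fun m => (4 %| mdeg m) && (m o1 == 0))%N (coord r).
  move=> m nz; rewrite Cr //=; have := v0 _ nz; rewrite /wt; lia.
suff H f : supp_in (fun m => (4 %| mdeg m) && (m o1 == 0))%N f -> exists (c : k) r',
    wle 0 1 0 (coord r') /\ elt f = c *: 1 + s * r' /\ f@_(mon 0 0) = c.
  by move=> /H; rewrite (coordK hk).
move=> {v0 Cr r}.
elim/supp_in_ind: f / => [|c m f /andP[Cm /eqP m0] [c0 [r [v0 [e ec]]]]].
  exists 0, 0; split; first by rewrite linear0; apply: supp_in0.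
  by rewrite linear0 scale0r mulr0 addr0 mcoeff0.
rewrite linearP /= e mcoeffD mcoeffZ ec -[m]mon_eta m0.
have mE : (m o0 = 4 * (m o0 %/ 4))%N by rewrite mulnC divnK //; move: Cm; rewrite mdeg2 m0 addn0.
rewrite {}mE; case: (m o0 %/ 4)%N => [|c'].
  exists (c + c0), r; split=> //.
  have -> : elt 'X_[mon (4 * 0) 0] = 1.
    by apply: coord_inj; rewrite coord1 coord_elt // muln0 mon00 mpolyX0.
  by rewrite scalerDl addrA muln0 mcoeffX eqxx mulr1.
exists c0, (c *: elt 'X_[mon (4 * c') 0] + r); split.
  rewrite linearP /= coord_elt ?addn0 ?dvdn_mulr //; apply: supp_in_mon => //.
  by rewrite wt_mon mul0n muln0.
rewrite mulrDr -scalerAr s_pow addrCA; split=> //.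
by rewrite mcoeffX mon_eq muln_eq0 /= mulr0 add0r.
Qed.

Section LowerV.
Variables (E : derivation R).
Hypothesis Ev : wdeg (der_op E) 0 1 (-1).

Lemma lower_v (n : int) r : wle 0 1 n (coord r) -> wle 0 1 (n - 1) (coord (E r)).
Proof. by move=> nr; rewrite (coord_der hk); apply: Ev => //; apply: inC_coord. Qed.

Lemma v0_ker r : wle 0 1 0 (coord r) -> E r = 0.
Proof. by move=> /lower_v/wle_neg h; apply: coord_inj; rewrite linear0 h. Qed.

Lemma lower_v_nilpotent : locally_nilpotent E.
Proof.
move=> r; have [N HN] := wle_exists 0 1 (coord r); exists N.+1 => n le_n.
have H i : wle 0 1 (N%:Z - i%:Z) (coord (iter i E r)).
  elim: i => [|i IH]; first by rewrite subr0.
  by apply: wleW (lower_v IH); lia.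
by apply: coord_inj; rewrite linear0; apply: wle_neg (H n); lia.
Qed.

Lemma lower_v_s : E s = 0.
Proof. by apply: v0_ker; exact: wle_elt. Qed.

Lemma lower_v_t : wle 0 1 0 (coord (E t)).
Proof. by apply: (@lower_v 1); exact: wle_elt. Qed.

End LowerV.

End StandardDerivation.

Section StandardExists.
Variable k : fieldType.
Hypothesis hk : [pchar k] =i pred0.
Variables (A R : comAlgType k) (M : model A R).
Local Notation P := {mpoly k[2]}.
Local Notation o1 := (ord_max : 'I_2).
Local Notation o0 := (ord0 : 'I_2).
Local Notation x0 := (mx0 M).
Local Notation x1 := (mx1 M).
Local Notation y := (my M).
Local Notation mu := (mmu M).
Local Notation val := (mval M).
Local Notation PsiM := (Psi x0 x1 y).
Local Notation eM := (nform x0 x1 y).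
Local Notation coord := (coord M).
Local Notation elt := (elt M).
Local Notation der_op := (der_op M).
Local Notation s := (elt 'X_[mon 4 0]).
Local Notation t := (elt 'X_[mon 3 1]).
Local Notation z := (elt 'X_[mon 2 2]).
Implicit Types (f g : P) (m : 'X_{1..2}) (i j a b c : nat) (r h : R) (E D : derivation R).

(** The pairs [S] of bounds, on an element and on its image, are multiplicative by the Leibniz rule,
    so the generators suffice. *)
Lemma wleD_der a b (e : int) (d : derivation A) : (0 < a + b)%N ->
  wleD M a b ((2 * a)%N%:Z + e) (d x0) -> wleD M a b ((a + b)%N%:Z + e) (d x1) ->
  wleD M a b ((2 * b)%N%:Z + e) (d y) ->
  forall (n : int) x, wleD M a b n x -> wleD M a b (n + e) (d x).
Proof.
move=> ab h0 h1 hy n x nx.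
pose S (n : int) x := wleD M a b n x /\ wleD M a b (n + e) (d x).
have S1 : S 0 1 by split; [exact: wleD_1|rewrite der1 /wleD linear0; apply: supp_in0].
have SM n1 n2 u v : S n1 u -> S n2 v -> S (n1 + n2) (u * v).
  move=> [nu du] [nv dv]; split; first exact: wlnform_mul.
  rewrite der_leibniz; apply: wleD_add.
    by apply: wleDW (wlnform_mul ab nu dv); lia.
  by apply: wleDW (wlnform_mul ab du nv); lia.
have SX n1 u N : S n1 u -> S (N%:Z * n1) (u ^+ N).
  move=> Su; elim: N => [|N IH]; first by rewrite mul0r expr0.
  have -> : N.+1%:Z * n1 = n1 + N%:Z * n1 by lia.
  by rewrite exprS; apply: SM.
have w i j := @wleD_nform k A R M a b i j.
have S0 : S (2 * a)%N%:Z x0.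
  by split=> //; rewrite -(nform20 M); apply: wleDW (w _ _ _) => //; lia.
have S2 : S (2 * b)%N%:Z y.
  by split=> //; rewrite -(nform02 M); apply: wleDW (w _ _ _) => //; lia.
have S11 : S (a + b)%N%:Z x1.
  by split=> //; rewrite -(nform11 M); apply: wleDW (w _ _ _) => //; lia.
rewrite -(PhiK M x).
have : supp_in (fun m => ((wt a b m)%:Z <= n) && ~~ odd (mdeg m)) (Phi M x).
  by move=> m nz; apply/andP; split; [exact: nx | exact: (Phi_inE M _ m nz)].
move: (Phi M x) => f; elim/supp_in_ind: f / => [|c m f /andP[mn Em] IH].
  by rewrite !linear0 /wleD linear0; apply: supp_in0.
rewrite !linearP /=; apply: wleD_add => //; apply: wleD_scale.
rewrite -[m]mon_eta PsiX /nform.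
move: Em mn; rewrite mdeg2 /wt; move: (m o0) (m o1) => i j Em mn.
set I := ((i - j)./2)%N; set J := ((j - i)./2)%N; set L := minn i j.
have [_ h] := SM _ _ _ _ (SM _ _ _ _ (SX _ _ I S0) (SX _ _ J S2)) (SX _ _ L S11).
apply: wleDW h.
have iE : i = (2 * I + L)%N by rewrite /I /L; lia.
have jE : j = (2 * J + L)%N by rewrite /J /L; lia.
have mnE : (a * i + b * j = 2 * a * I + 2 * b * J + (a + b) * L)%N by rewrite {1}iE {1}jE; ring.
rewrite mnE in mn; lia.
Qed.

(** The derivation x0 |-> 0, x1 |-> x0, y |-> 2 x1 commutes with the involution. The torus element
    x0 |-> c x0, x1 |-> x1, y |-> c^-1 y conjugates it to its multiple by c. *)
Lemma std_exists : exists D : derivation R,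
  [/\ D s = 0, D t = s, D z = 2%:R *: t, wdeg (der_op D) 0 1 (-1) & wdeg (der_op D) 1 0 1] /\
  forall c : k, c != 0 -> exists al : alg_auto R, forall r, conj_der al D r = c *: D r.
Proof.
have [d [d0 d1 dy]] := model_der M.
have dmu x : mu (d x) = d (mu x).
  elim/(A_ind (M := M)): x => [c x v ex ev|x v ex ev||||].
  - by rewrite !linearP /= ex ev.
  - by rewrite der_leibniz rmorphD !rmorphM /= der_leibniz ex ev.
  - by rewrite der1 rmorph1 der1 linear0.
  - by rewrite model_mux0 linearN d0 oppr0 linear0.
  - by rewrite model_mux1 linearN d1 model_mux0.
  - by rewrite model_muy linearN dy linearZ /= model_mux1 scalerN.
have ex r : exists r', val r' = d (val r).
  by apply: model_val_im; rewrite dmu model_val_fix.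
pose Df r := projT1 (cid (ex r)).
have DE r : val (Df r) = d (val r) := projT2 (cid (ex r)).
have Dlin : linear Df.
  by move=> c r h; apply: (model_val_inj (m := M)); rewrite [RHS]linearP /= !DE linearP /= linearP.
pose Dl : {linear R -> R} := HB.pack Df (GRing.isLinear.Build k R R _ Df Dlin).
have Dleib r h : Dl (r * h) = r * Dl h + Dl r * h.
  apply: (model_val_inj (m := M)); rewrite [LHS]DE rmorphD !rmorphM /= !DE der_leibniz.
  by [].
pose D := Derivation Dleib.
have {DE}DE r : val (D r) = d (val r) := DE r.
have wD a b (e : int) : (0 < a + b)%N ->
  wleD M a b ((2 * a)%N%:Z + e) (d x0) -> wleD M a b ((a + b)%N%:Z + e) (d x1) ->
  wleD M a b ((2 * b)%N%:Z + e) (d y) -> wdeg (der_op D) a b e.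
  move=> ab h0 h1 hy n f Cf nf.
  change (wle a b (n + e) (Phi M (val (D (elt f))))).
  rewrite DE; apply: (wleD_der ab h0 h1 hy).
  by rewrite /wleD (val_elt hk) // PsiK //; apply: inE_C.
have w0 a b (n : int) : wleD M a b n 0 by rewrite /wleD linear0; apply: supp_in0.
exists D; split; first split.
- apply: (model_val_inj (m := M)); rewrite DE linear0 (val_elt_mon hk) // /nform /=.
  by rewrite !expr0 !mulr1 expr2 der_leibniz d0 mulr0 mul0r addr0.
- apply: (model_val_inj (m := M)); rewrite DE !(val_elt_mon hk) // /nform /=.
  by rewrite !expr0 !expr1 !mulr1 der_leibniz d0 d1 mul0r addr0 expr2.
- apply: (model_val_inj (m := M)); rewrite DE linearZ /= !(val_elt_mon hk) // /nform /=.
  by rewrite !expr0 !expr1 !mulr1 mul1r expr2 der_leibniz d1 mulrC scaler_nat mulr2n.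
- apply: wD => //; rewrite ?d0 ?d1 ?dy; first exact: w0.
    by rewrite -(nform20 M); apply: wleDW (@wleD_nform k A R M _ _ _ _ _).
  by apply: wleD_scale; rewrite -(nform11 M); apply: wleDW (@wleD_nform k A R M _ _ _ _ _).
- apply: wD => //; rewrite ?d0 ?d1 ?dy; first exact: w0.
    by rewrite -(nform20 M); apply: wleDW (@wleD_nform k A R M _ _ _ _ _).
  by apply: wleD_scale; rewrite -(nform11 M); apply: wleDW (@wleD_nform k A R M _ _ _ _ _).
move=> c c0.
have rel (e : k) : e != 0 -> (e *: x0) * (e^-1 *: y) = x1 ^+ 2 + 1.
  by move=> e0; rewrite -scalerAl -scalerAr scalerA mulfV // scale1r model_rel.
have [phi [p0 p1 py]] := model_lift M (rel c c0).
have ci0 : c^-1 != 0 by rewrite invr_eq0.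
have [psi [s0 s1 sy]] := model_lift M (rel _ ci0); rewrite invrK in sy.
have [||||||||||||al [H H']] := @auto_exists k A R M phi psi;
  rewrite ?p0 ?p1 ?py ?s0 ?s1 ?sy ?linearZ /= ?p0 ?p1 ?py ?s0 ?s1 ?sy ?scalerA
    ?mulfV ?mulVf ?scale1r ?(model_mux0, model_mux1, model_muy) ?scalerN //.
exists al => r; apply: (model_val_inj (m := M)); rewrite /= H DE H' linearZ /= DE.
have pp v : phi (psi v) = v.
  apply: (@lrmorph_eq k A R M (phi \o psi) idfun) => /=; rewrite ?s0 ?s1 ?sy ?linearZ /= ?p0 ?p1 ?py //.
    by rewrite scalerA mulVf // scale1r.
  by rewrite scalerA mulfV // scale1r.
elim/(A_ind (M := M)): (val r) => [c' u v eu ev|u v eu ev||||].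
- rewrite [psi _]linearP /= ![d (_ + _)]linearP /= [phi _]linearP /= eu ev scalerDr.
  by rewrite !scalerA [c * c']mulrC.
- rewrite rmorphM /= !der_leibniz rmorphD /= !rmorphM /= !pp eu ev scalerDr.
  by rewrite -scalerAr -scalerAl.
- by rewrite rmorph1 der1 !linear0.
- by rewrite s0 linearZ /= d0 !linear0.
- by rewrite s1 d1 p0.
- by rewrite sy linearZ /= dy linearZ /= linearZ /= p1.
Qed.

End StandardExists.

Section Classification.
Variable k : fieldType.
Hypothesis hk : [pchar k] =i pred0.
Variables (A R : comAlgType k) (M : model A R).
Local Notation P := {mpoly k[2]}.
Local Notation o1 := (ord_max : 'I_2).
Local Notation o0 := (ord0 : 'I_2).
Local Notation coord := (coord M).
Local Notation elt := (elt M).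
Local Notation der_op := (der_op M).
Local Notation s := (elt 'X_[mon 4 0]).
Local Notation t := (elt 'X_[mon 3 1]).
Local Notation z := (elt 'X_[mon 2 2]).
Implicit Types (f g : P) (m : 'X_{1..2}) (i j a b c : nat) (r h : R) (E D : derivation R).

Lemma s_mul_le3 (r h : R) : r = s * h -> wle 1 0 3 (coord r) -> h = 0.
Proof. by move=> -> /(s_mul_eq0 hk). Qed.

Lemma wle_1 a b (n : int) (c : k) : 0 <= n -> wle a b n (coord (c *: 1)).
Proof.
move=> n0; rewrite linearZ /= (coord1 M) -mpolyX0 -mon00; apply: supp_inZ.
by apply: wleW (wleX a b _); rewrite wt_mon !muln0.
Qed.

Lemma const_s (c : k) h : c *: 1 = s * h -> c = 0.
Proof.
move=> e; apply: (@scale1_eq0 k R c 1); last by apply/eqP; apply: oner_neq0.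
have h0 : h = 0 by apply: (s_mul_le3 e); apply: wle_1.
by rewrite e h0 mulr0.
Qed.

(** Degrees in v add up, because top parts multiply in the domain k[u,v]. *)
Lemma v0_factor r h : wle 0 1 0 (coord (r * h)) -> r * h <> 0 ->
  wle 0 1 0 (coord r) /\ wle 0 1 0 (coord h).
Proof.
move=> v0 nz; have r0 : r <> 0 by move=> e; apply: nz; rewrite e mul0r.
have h0 : h <> 0 by move=> e; apply: nz; rewrite e mulr0.
have [n [nr tr]] := top_exists hk M 0 1 r0.
have [n' [nh th]] := top_exists hk M 0 1 h0.
suff : (n + n' = 0)%N by move/eqP; rewrite addn_eq0 => /andP[/eqP e /eqP e']; rewrite e in nr; rewrite e' in nh.
apply: contrapT => nn; have := top_mul hk (isT : 0 < 0 + 1)%N nr nh.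
rewrite (hpart_low v0); last by lia.
by move/esym/eqP; rewrite mulf_eq0 => /orP[/eqP|/eqP].
Qed.

(* [E x0^2 = 0] and [E (x0 x1) = g] lies in [k[x0^2]]; the relation [(x0 x1)^2 = x0^2 x1^2]
   forces [g] to vanish at [x0 = 0]. *)
Lemma lower_v_standard D E : D s = 0 -> D t = s -> D z = 2%:R *: t ->
  wdeg (der_op E) 0 1 (-1) ->
  exists g : R, wle 0 1 0 (coord g) /\ forall r, E r = g * D r.
Proof.
move=> Ds Dt Dz Ev; have Es := lower_v_s hk Ev.
have [c [g [v0g [Et _]]]] := v0_split hk (lower_v_t hk Ev).
have Ez : s * E z = 2%:R *: (t * E t).
  have := congr1 E (t_sqr hk M); rewrite !der_leibniz Es mul0r addr0 => <-.
  by rewrite [E t * t]mulrC scaler_nat mulr2n.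
have Ez0 : s * (E z - 2%:R *: (t * g)) = (2%:R * c) *: t.
  by rewrite mulrBr Ez Et mulrDr scalerDr -!scalerAr mulr1 scalerA mulrCA addrK.
(* A multiple of x0^2 proportional to x0 x1 has degree at most 3 in u, so it is zero. *)
have ez : E z - 2%:R *: (t * g) = 0.
  apply: (s_mul_le3 (esym Ez0)); rewrite linearZ; apply: supp_inZ; exact: wle_elt.
have c0 : c = 0.
  have : 2%:R * c = 0.
    apply: (@scale1_eq0 k R _ t); last exact: (elt_neq0 hk).
    by rewrite -Ez0 ez mulr0.
  by move/eqP; rewrite mulf_eq0 (negbTE (two_neq0 hk)) => /eqP.
have {}Et : E t = g * s by rewrite Et c0 scale0r add0r mulrC.
have {}Ez : E z = g * D z by rewrite Dz -scalerAr; apply/eqP; rewrite -subr_eq0 [g * t]mulrC ez.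
exists g; split=> //; apply: (R_ind hk (M := M)).
- by move=> c' r h er eh; rewrite !linearP /= er eh mulrDr scalerAr.
- by move=> r h er eh; rewrite !der_leibniz er eh; ring.
- by rewrite !der1 mulr0.
(* Identities for x1 y and y^2 are checked after multiplication by x0^2, which is no zero divisor
   and is killed by both derivations. *)
- have regular r : s * (E r - g * D r) = 0 -> E r = g * D r.
    by move/(s_regular hk)/eqP; rewrite subr_eq0 => /eqP.
  have z1 : E (z + 1) = g * D (z + 1) by rewrite !linearD /= !der1 !addr0.
  have sE r : s * E r = E (s * r) by rewrite der_leibniz Es mul0r addr0.
  have sD r : s * D r = D (s * r) by rewrite der_leibniz Ds mul0r addr0.
  apply: (@mon_deg4 k A R M (fun r => E r = g * D r)) => //.
  + by rewrite Es Ds mulr0.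
  + by rewrite Et Dt.
  + apply: regular; rewrite mulrBr mulrCA sE sD (s_mul13 hk) !der_leibniz z1 Et Dt; ring.
  + apply: regular; rewrite mulrBr mulrCA sE sD (s_mul04 hk) !der_leibniz z1; ring.
Qed.

Section Standard.
Variable D : derivation R.
Hypotheses (Ds : D s = 0) (Dt : D t = s) (Dz : D z = 2%:R *: t).
Hypotheses (Dv : wdeg (der_op D) 0 1 (-1)) (Du : wdeg (der_op D) 1 0 1).

(** As D(x0 x1) = x0^2, the degree of [D] in u is at least 1; the extreme vertex for the weight
    (1,0) can then only be (1, -1). *)
Lemma std_low : low_vertex (der_op D) 1.
Proof.
have nz : D t <> 0 by rewrite Dt; apply: (elt_neq0 hk).
have t3 : wle 1 0 3 (coord t) by apply: wle_elt.
have up (e : int) : wdeg (der_op D) 1 0 e -> 1 <= e.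
  move=> /(_ 3 (coord t) (@inC_coord k hk A R M t) t3); rewrite /= -(coord_der hk) Dt (coord_elt hk) //.
  by move=> /(_ (mon 4 0)); rewrite mcoeffX eqxx wt_mon oner_eq0 => /(_ isT); lia.
have DP := der_op_ok hk M (lower_v_nilpotent hk Dv).
have [r [e [Ed H]]] := vertex hk (star_okP hk M) DP (der_op_neq0 hk M nz)
  (isT : 0 < 1 + 0)%N (isT : 0 < 0 + 1)%N isT.
have {}Ed : wdeg (der_op D) 1 0 r by move: Ed; congr wdeg; lia.
have r1 := up _ Ed; case: H => [[q [rE _ _]]|[p [rE _ low]]]; first by move: r1; rewrite rE.
have p1 : (p <= 1)%N by have := low_vertex_le hk Du low; lia.
have -> : 1 = p%:Z by lia.
exact: low.
Qed.

(** In the top row v^(n+1) of r, take the largest exponent i of u. [D] raises u by at most 1 and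
    lowers v by at least 1, so only u^i v^(n+1) reaches u^(i+1) v^n, with nonzero factor (n+1)
    be. *)
Lemma std_ker r : D r = 0 -> wle 0 1 0 (coord r).
Proof.
move=> Dr; case: (EM (r = 0)) => [->|r0]; first by rewrite linear0; apply: supp_in0.
have [[|n] [nr tr]] := top_exists hk M 0 1 r0; first exact: nr.
exfalso; have [N HN] := wle_exists 1 0 (coord r).
set f := coord r in nr tr HN.
have Cf : inC f by apply: inC_coord.
have ex : exists i, cf f i n.+1 != 0.
  have [i [j nz]] := mon_neq0 tr; exists i; have e := homog_cf (@hpart_homog k 0 1 n.+1 f) nz.
  have jE : j = n.+1 by lia.
  by move: nz; rewrite jE cf_hpart //; lia.
have ub i : cf f i n.+1 != 0 -> (i <= N)%N by move/(wle_cf HN); lia.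
case: (ex_maxnP ex ub) => i nz max_i.
have [be be0 Hbe] := std_low.
have C : (4 %| i + n.+1)%N by have := Cf _ nz; rewrite mdeg_mon.
pose c0 := f@_(mon i n.+1); pose g := f - c0 *: 'X_[mon i n.+1].
have fE : f = g + c0 *: 'X_[mon i n.+1] by rewrite /g subrK.
have : cf (der_op D f) (i%:Z + 1) (n.+1%:Z - 1) = 0 by rewrite /= -(coord_der hk) Dr linear0 cf0.
rewrite fE linearD linearZ /= cfD cfZ.
have -> : cf (der_op D 'X_[mon i n.+1]) (i%:Z + 1) (n.+1%:Z - 1) = n.+1%:R * be.
  by rewrite -(Hbe i n.+1 C).
have Qg : supp_in (fun m => (4 %| mdeg m)%N && ((m o1 < n.+1) || (m o0 < i))%N) g.
  move=> m; rewrite mcoeffB mcoeffZ mcoeffX; case: (eqVneq (mon i n.+1) m) => [<-|ne].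
    by rewrite mulr1 subrr eqxx.
  rewrite mulr0 subr0 => nm; rewrite Cf //=.
  have nm' : cf f (m o0) (m o1) != 0 by rewrite cfN mon_eta.
  have := wle_cf nr nm' => le_m; case: (ltngtP (m o1) n.+1) => //= [|e]; first by lia.
  rewrite e in nm'; have := max_i _ nm'; rewrite leq_eqVlt => /orP[/eqP e'|//].
  by move: ne; rewrite -e -e' mon_eta eqxx.
have -> : cf (der_op D g) (i%:Z + 1) (n.+1%:Z - 1) = 0.
  elim/supp_in_ind: g / Qg {fE} => [|c m g /andP[Cm lt] IH]; first by rewrite linear0 cf0.
  rewrite linearP cfD cfZ IH addr0; apply/eqP; rewrite mulf_eq0; apply/orP; right.
  apply: contraT => nz'; have CX : inC ('X_[m] : P) by apply: inCX.
  have h1 := wle_cf (Dv CX (wleX 0 1 m)) nz'; have h2 := wle_cf (Du CX (wleX 1 0 m)) nz'.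
  by move: lt h1 h2; rewrite /wt; lia.
rewrite add0r => /eqP; rewrite !mulf_eq0 (natk_eq0 hk) (negbTE be0) orbF.
by rewrite /c0 -cfN (negbTE nz).
Qed.

(** Write D r = c + s h. The element s r - (D r) t lies in the kernel, hence is c' + s h', and s (r
    - h t - h') = c t + c'. The right side has degree at most 3 in u, so it vanishes, and c = 0. *)
Lemma std_plinth r : D (D r) = 0 -> exists h, wle 0 1 0 (coord h) /\ D r = s * h.
Proof.
move=> DDr; have v0 := std_ker DDr; have [c [h [v0h [e _]]]] := v0_split hk v0.
have : D (s * r - D r * t) = 0.
  by rewrite linearB /= !der_leibniz Ds DDr Dt !mul0r addr0 addr0 mulrC subrr.
move/std_ker/(v0_split hk) => [c' [h' [_ [e' _]]]].
have e2 : s * (r - h * t - h') = c *: t + c' *: 1.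
  have eh : D r - s * h = c *: 1 by rewrite e addrK.
  transitivity ((s * r - D r * t) + (D r - s * h) * t - s * h'); first by ring.
  by rewrite e' eh -scalerAl mul1r addrAC addrK addrC.
have z0 : r - h * t - h' = 0.
  apply: (s_mul_le3 (esym e2)); rewrite linearD linearZ /=; apply: supp_inD.
    by apply: supp_inZ; apply: wle_elt.
  exact: wle_1.
have c0 : c = 0.
  move: e2; rewrite z0 mulr0 => /(congr1 coord); rewrite linear0 linearD !linearZ /=.
  rewrite (coord1 M) (coord_elt hk) // => /(congr1 (fun f : P => f@_(mon 3 1))).
  rewrite mcoeff0 mcoeffD !mcoeffZ mcoeffX eqxx -mpolyX0 -mon00 mcoeffX mon_eq.
  by rewrite mulr1 mulr0 addr0 => ->.
by exists h; split=> //; rewrite e c0 scale0r add0r.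
Qed.

Lemma std_no_slice r : D r <> 1.
Proof.
move=> e; have [|h [_ e']] := @std_plinth r; first by rewrite e der1.
have /eqP : (1 : k) = 0 by apply: (@const_s 1 h); rewrite scale1r -e.
by rewrite oner_eq0.
Qed.

(** A common divisor a divides x0^2 = D t, so a and its cofactor e lie in k[x0^2] and one of them
    has zero constant term. If it is e, cancelling x0^2 makes a a unit; if it is a, then x0^2 would
    divide D z = 2 x0 x1. *)
Lemma std_irreducible : der_irreducible D.
Proof.
move=> [a [[b nb] H]]; apply: (negP nb).
have /asboolP[e se] := H t; rewrite Dt in se.
have vs : wle 0 1 0 (coord (e * a)) by rewrite -se; apply: wle_elt.
have nz : e * a <> 0 by rewrite -se; apply: (elt_neq0 hk).
have [/(v0_split hk)[c1 [e1 [_ [eE _]]]] /(v0_split hk)[c2 [a1 [_ [aE _]]]]] := v0_factor vs nz.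
have c12 : c1 * c2 = 0.
  apply: (@const_s _ (1 - c1 *: a1 - c2 *: e1 - s * e1 * a1)).
  rewrite !mulrBr mulr1 -!scalerAr {1}se eE aE.
  rewrite !mulrDl !mulrDr -!scalerAl -!scalerAr !mul1r !mulr1 scalerA.
  ring.
move/eqP: c12; rewrite mulf_eq0 => /orP[/eqP c0|/eqP c0].
  have e1a : e1 * a = 1.
    apply/eqP; rewrite eq_sym -subr_eq0; apply/eqP; apply: (s_regular hk (M := M)).
    by rewrite mulrBr mulr1 mulrA {1}se eE c0 scale0r add0r subrr.
  by apply/asboolP; exists (b * e1); rewrite -mulrA e1a mulr1.
exfalso; have /asboolP[e' ze] := H z; rewrite Dz aE c0 scale0r add0r mulrCA in ze.
have h0 := s_mul_le3 ze; apply: (elt_neq0 hk (M := M) (isT : 4 %| 3 + 1)%N).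
have : 2%:R *: t = 0.
  rewrite ze h0 ?mulr0 // linearZ; apply: supp_inZ; exact: wle_elt.
by move=> e2; rewrite -[t]scale1r -(mulVf (two_neq0 hk)) -scalerA e2 scaler0.
Qed.

(** The factor g in E = g D divides every value of [E], so irreducibility makes it a unit. A unit
    has degree 0 in u, and as g lies in k[x0^2] it is a constant. *)
Lemma lower_v_irreducible E : wdeg (der_op E) 0 1 (-1) -> der_irreducible E ->
  exists2 c : k, c != 0 & forall r, E r = c *: D r.
Proof.
move=> Ev irr; have [g [v0 EE]] := lower_v_standard Ds Dt Dz Ev.
have [b e] : exists b : R, 1 = b * g.
  apply: contrapT => nb; apply: irr; exists g; split.
    by exists 1; apply/asboolP.
  by move=> r; apply/asboolP; exists (D r); rewrite EE mulrC.
have b0 : b <> 0 by move=> b0; move: e; rewrite b0 mul0r => /eqP; rewrite oner_eq0.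
have g0 : g <> 0 by move=> g0; move: e; rewrite g0 mulr0 => /eqP; rewrite oner_eq0.
have [n [nb tb]] := top_exists hk M 1 0 b0.
have [n' [ng tg]] := top_exists hk M 1 0 g0.
have n0 : n' = 0%N.
  apply: contrapT => nn; have := top_mul hk (isT : 0 < 1 + 0)%N nb ng.
  have w1 : wle 1 0 0 (coord (b * g)) by rewrite -e -[1]scale1r; apply: wle_1.
  rewrite (hpart_low w1); last by lia.
  by move/esym/eqP; rewrite mulf_eq0 => /orP[/eqP|/eqP].
have [c [g1 [_ [ge _]]]] := v0_split hk v0.
have g10 : g1 = 0.
  apply: (@s_mul_le3 (g - c *: 1)); first by rewrite ge addrC addKr.
  rewrite linearB; apply: supp_inB; last exact: wle_1.
  by apply: wleW ng; rewrite n0.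
have {}ge : g = c *: 1 by rewrite ge g10 mulr0 addr0.
exists c; last by move=> r; rewrite EE ge -scalerAl mul1r.
by apply/eqP => c0; apply: g0; rewrite ge c0 scale0r.
Qed.

End Standard.
End Classification.

(** * A derivation with a slice on the polynomial ring *)

Section PartialDerivative.
Variable k : fieldType.
Hypothesis hk : [pchar k] =i pred0.
Variable R : comAlgType k.
Local Notation P := {mpoly k[2]}.
Local Notation o0 := (ord0 : 'I_2).
Variable f : {linear R -> P}.
Hypotheses (f_mul : monoid_morphism f) (f_bij : bijective f).

Lemma slice_derivation : exists D : derivation R, locally_nilpotent D /\ exists r, D r = 1.
Proof.
have [g fK gK] := f_bij; have f_inj := can_inj fK; have [f1 fM] := f_mul.
pose df r := g (mderiv o0 (f r)).
have dfE r : f (df r) = mderiv o0 (f r) by rewrite /df gK.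
have dlin : linear df.
  by move=> c r h; apply: f_inj; rewrite dfE !linearP /= !dfE.
pose dl : {linear R -> R} := HB.pack df (GRing.isLinear.Build k R R _ df dlin).
have dleib r h : dl (r * h) = r * dl h + dl r * h.
  by apply: f_inj; rewrite linearD !fM /= !dfE fM mderivM addrC.
exists (Derivation dleib); split; last first.
  exists (g 'X_o0); apply: f_inj; rewrite /= dfE gK f1 mderivX mnm1E eqxx.
  have -> : (U_(o0) - U_(o0) = 0 :> 'X_{1..2})%MM by apply/mnmP => i; rewrite mnmBE subnn mnm0E.
  by rewrite mpolyX0 scale1r.
have nil n (p : P) : (forall m, p@_m != 0 -> (m o0 < n)%N) -> iter n (mderiv o0) p = 0.
  elim: n p => [|n IH] p Hp.
    apply/mpolyP => m; rewrite mcoeff0; apply/eqP; apply: contraT => /Hp; by rewrite ltn0.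
  rewrite iterSr; apply: IH => m; rewrite mcoeff_deriv => nz.
  have := Hp (m + U_(o0))%MM; rewrite mnmDE mnm1E eqxx addn1 ltnS; apply.
  by apply: contra nz => /eqP ->; rewrite mul0rn.
move=> r; exists (msize (f r)) => n le_n; apply: f_inj; rewrite linear0.
have -> : f (iter n (Derivation dleib) r) = iter n (mderiv o0) (f r).
  by elim: n {le_n} => //= n IH; rewrite dfE IH.
apply: nil => m; rewrite -mcoeff_msupp => /msize_mdeg_lt; rewrite mdeg2; lia.
Qed.

End PartialDerivative.

(** * Transitivity and the plinth invariant *)

Section MainTheorem.
Variable k : fieldType.
Hypothesis hk : [pchar k] =i pred0.
Variables (A R : comAlgType k) (M : model A R).
Local Notation P := {mpoly k[2]}.
Local Notation coord := (coord M).
Local Notation elt := (elt M).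
Local Notation der_op := (der_op M).
Local Notation s := (elt 'X_[mon 4 0]).
Local Notation t := (elt 'X_[mon 3 1]).
Local Notation z := (elt 'X_[mon 2 2]).
Implicit Types (r h : R) (E D : derivation R).

Lemma irreducible_neq0 E : der_irreducible E -> exists r, E r <> 0.
Proof.
move=> irr; apply: contrapT => H; apply: irr; exists 0; split.
  by exists 1; apply/asboolP => -[b]; rewrite mulr0 => /eqP; rewrite oner_eq0.
move=> b; apply/asboolP; exists 0; rewrite mulr0; apply: contrapT => nz.
by apply: H; exists b.
Qed.

Lemma slice_irreducible E r : E r = 1 -> der_irreducible E.
Proof.
move=> e [a [[b nb] H]]; apply: (negP nb); have /asboolP[c ec] := H r.
by apply/asboolP; exists (b * c); rewrite -mulrA -ec e mulr1.
Qed.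

Section Standard.
Variable D : derivation R.
Hypotheses (Ds : D s = 0) (Dt : D t = s) (Dz : D z = 2%:R *: t).
Hypotheses (Dv : wdeg (der_op D) 0 1 (-1)) (Du : wdeg (der_op D) 1 0 1).
Hypothesis D_scale : forall c : k, c != 0 -> exists al : alg_auto R,
  forall r, conj_der al D r = c *: D r.

Lemma conj_std E : ILND E -> exists (al : alg_auto R) (c : k),
  c != 0 /\ forall r, al (E r) = c *: D (al r).
Proof.
move=> EI; have [nE iE] := EI.
have [al Hal] := normalize hk M nE (irreducible_neq0 iE).
have [c c0 H] := lower_v_irreducible hk Ds Dt Dz Hal (conj_irreducible (al := al) iE).
by exists al, c; split=> // r; rewrite -H /= auto_funK.
Qed.

Lemma std_ILND : ILND D.
Proof.
split; first exact: (@lower_v_nilpotent k hk A R M D Dv).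
exact: (std_irreducible hk Dt Dz).
Qed.

(** Two irreducible derivations are conjugate to c1 D and c2 D; the torus element for c2/c1 links
    them. *)
Lemma std_transitivity : strong_transitivity R.
Proof.
split; first by exists D; apply: std_ILND.
move=> D1 D2 /conj_std[al1 [c1 [c10 H1]]] /conj_std[al2 [c2 [c20 H2]]].
have [tau Htau] := D_scale (mulf_neq0 c20 (invr_neq0 c10)).
exists (auto_comp (auto_sym al2) (auto_comp tau al1)) => b /=.
have /= e := Htau (al2 b).
rewrite H1 auto_invK linearZ /= e scalerA mulrCA mulfV // mulr1 -H2 auto_funK //.
Qed.

(** A derivation with a slice is irreducible, hence conjugate to a multiple of [D], which would then
    take the value 1. *)
Lemma std_not_poly : ~ alg_iso R P.
Proof.
move=> [f fM fB]; have [E [nE [r Er]]] := slice_derivation fM fB.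
have [al [c [c0 H]]] := conj_std (conj nE (slice_irreducible Er)).
apply: (std_no_slice hk Ds Dt Dv Du (r := c *: al r)).
by rewrite linearZ /= -H Er rmorph1.
Qed.

Section PlinthQuotient.
Variables (E : derivation R) (al : alg_auto R) (c : k).
Hypotheses (c0 : c != 0) (Hal : forall r, al (E r) = c *: D (al r)).

(** The constant term of an element of ker D = k[x0^2], after transport by [al]: it is evaluation at
    x0 = 0, and will induce the isomorphism from ker E / pl(E) to k. *)
Definition kcoef (x : der_ker E) : k^o := (coord (al (subalg_val x)))@_(mon 0 0).

Lemma ker_split (x : der_ker E) : exists h, wle 0 1 0 (coord h) /\
  al (subalg_val x) = kcoef x *: 1 + s * h.
Proof.
have Dx : D (al (subalg_val x)) = 0.
  have := Hal (subalg_val x); have /eqP -> := valP x; rewrite linear0.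
  move/esym/eqP; rewrite scaler_eq0 (negbTE c0) => /eqP //.
have [c' [h [v0 [e ec]]]] := v0_split hk (std_ker hk Dt Dv Du Dx).
by exists h; rewrite /kcoef ec.
Qed.

Lemma kcoef_uniq (x : der_ker E) (a : k) h : al (subalg_val x) = a *: 1 + s * h -> kcoef x = a.
Proof.
have [h' [_ ->]] := ker_split x; move=> e; apply/eqP; rewrite -subr_eq0; apply/eqP.
apply: (const_s hk (M := M) (h := h - h')).
rewrite scalerBl mulrBr; apply/eqP; rewrite subr_eq addrAC -subr_eq opprK; apply/eqP.
by rewrite e addrC.
Qed.

(** One direction is [std_plinth]. For the other, a kernel element s h with h in k[x0^2] equals D(h
    t); the witness for [E] also divides by c. *)
Lemma kcoef_plinth (x : der_ker E) : (x \in plinth E) <-> kcoef x = 0.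
Proof.
split=> [/asboolP[b eb]|x0].
  have eD : al (subalg_val x) = D (c *: al b) by rewrite -eb Hal linearZ.
  have [|h [_ e]] := std_plinth hk Ds Dt Dv Du (r := c *: al b).
    rewrite -eD; have := Hal (subalg_val x); have /eqP -> := valP x; rewrite linear0.
    by move/esym/eqP; rewrite scaler_eq0 (negbTE c0) => /eqP.
  by apply: (@kcoef_uniq x 0 h); rewrite scale0r add0r eD.
have [h [v0 e]] := ker_split x; rewrite x0 scale0r add0r in e.
apply/asboolP; exists (auto_inv al (c^-1 *: (h * t))).
apply: (can_inj (auto_funK al)); rewrite Hal auto_invK linearZ /= scalerA mulfV // scale1r.
by rewrite der_leibniz Dt (v0_ker hk Dv v0) mul0r addr0 e mulrC.
Qed.

Lemma kcoef_linear : linear kcoef.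
Proof.
move=> a x y; have [h [_ e]] := ker_split x; have [h' [_ e']] := ker_split y.
apply: (@kcoef_uniq _ _ (a *: h + h')); rewrite linearP /= e e'.
by rewrite !scalerDr scalerDl scalerA mulrDr -scalerAr addrACA.
Qed.

HB.instance Definition _ := GRing.isLinear.Build k (der_ker E) k^o _ kcoef kcoef_linear.

Lemma kcoefM x y : kcoef (x * y) = kcoef x * kcoef y.
Proof.
have [h [_ e]] := ker_split x; have [h' [_ e']] := ker_split y.
apply: (@kcoef_uniq _ _ (kcoef x *: h' + kcoef y *: h + s * h * h')).
rewrite rmorphM /= e e' mulrDl !mulrDr -!scalerAl -!scalerAr !mul1r !mulr1 scalerA; ring.
Qed.

Lemma kcoef1 : kcoef 1 = 1.
Proof. by apply: (@kcoef_uniq _ _ 0); rewrite /= rmorph1 mulr0 addr0 scale1r. Qed.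

Definition quot_coef (q : alg_quot (plinth E)) : k^o := kcoef (repr q).

Lemma quot_coef_proj x : quot_coef (quot_proj (plinth E) x) = kcoef x.
Proof.
apply/eqP; rewrite -subr_eq0; apply/eqP; have /kcoef_plinth <- := quot_projP (plinth E) x.
by rewrite linearB.
Qed.

Lemma quot_coef_linear : linear quot_coef.
Proof.
move=> a x y; rewrite -(quot_projK x) -(quot_projK y) -linearP !quot_coef_proj.
exact: kcoef_linear.
Qed.
HB.instance Definition _ := GRing.isLinear.Build k (alg_quot (plinth E)) k^o _ quot_coef quot_coef_linear.

Lemma plinth_quotient : alg_iso (alg_quot (plinth E)) k^o.
Proof.
exists quot_coef.
  split; first exact: etrans (quot_coef_proj 1) kcoef1.
  by move=> x y; apply: etrans (quot_coef_proj (repr x * repr y)) (kcoefM _ _).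
exists (fun a : k => quot_proj (plinth E) (a *: 1)) => [x|a].
  rewrite -[RHS](quot_projK x); apply/eqP; rewrite quot_proj_eq; apply/kcoef_plinth.
  by rewrite linearB linearZ /= kcoef1 [_ *: _]mulr1 subrr.
by rewrite /= quot_coef_proj linearZ /= kcoef1 [_ *: _]mulr1.
Qed.

End PlinthQuotient.
End Standard.
End MainTheorem.

(** * The quadric and its ring of invariants *)

Section QuadricUniversal.
Variable k : fieldType.
Hypothesis hk : [pchar k] =i pred0.
Local Notation P3 := {mpoly k[3]}.
Local Notation Q := (ringD k).

Section Lift.
Variables (B : comAlgType k) (b0 b1 b2 : B).
Hypothesis b_rel : 2%:R * b0 * b2 - b1 ^+ 2 = 1.

Definition ev : P3 -> B := mmap (in_alg B) (fun i => nth 0 [:: b0; b1; b2] i).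
HB.instance Definition _ := GRing.RMorphism.copy ev
  (mmap (in_alg B) (fun i => nth 0 [:: b0; b1; b2] i)).

Lemma evX (i : nat) : (i < 3)%N -> ev 'X_(inord i) = nth 0 [:: b0; b1; b2] i.
Proof. by move=> lt3; rewrite /ev mmapX mmap1U inordK. Qed.

Lemma evZ (c : k) p : ev (c *: p) = c *: ev p.
Proof. by rewrite /ev mmapZ mulr_algl. Qed.

Lemma ev_quadric : ev (quadric k) = 0.
Proof.
rewrite /quadric expr2 !rmorphB !rmorphM rmorph_nat rmorph1 /= !evX //=.
by rewrite -expr2 b_rel subrr.
Qed.

Definition lift (x : Q) : B := ev (repr x).

Lemma lift_proj p : lift (projD p) = ev p.
Proof.
have /asboolP[c e] := quot_projP (principal (quadric k)) p.
apply/eqP; rewrite -subr_eq0 /lift; apply/eqP.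
by rewrite -rmorphB e rmorphM /= ev_quadric mulr0.
Qed.

Lemma projDP (x : Q) : exists p, x = projD p.
Proof. by exists (repr x); rewrite /projD quot_projK. Qed.

Lemma lift_linear : linear lift.
Proof.
move=> c x y; have [p ->] := projDP x; have [q ->] := projDP y.
by rewrite -linearP !lift_proj rmorphD /= evZ.
Qed.
HB.instance Definition _ := GRing.isLinear.Build k Q B _ lift lift_linear.

Lemma lift_monoid : monoid_morphism lift.
Proof.
split=> [|x y].
  by rewrite -[1](rmorph1 (@projD k)) lift_proj rmorph1.
have [p ->] := projDP x; have [q ->] := projDP y.
by rewrite -rmorphM !lift_proj rmorphM.
Qed.
HB.instance Definition _ := GRing.isMonoidMorphism.Build Q B lift lift_monoid.

Lemma lift_exists : exists phi : {lrmorphism Q -> B},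
  [/\ phi (projD 'X_(inord 0)) = b0, phi (projD 'X_(inord 1)) = b1 & phi (projD 'X_(inord 2)) = b2].
Proof. by exists lift; rewrite /= !lift_proj !evX. Qed.

End Lift.

(** The vector field x0 d/dx1 + x1 d/dx2 is tangent to the quadric: it maps the equation to 2 x0 x1
    - 2 x1 x0 = 0. *)
Definition tangent (p : P3) : P3 :=
  'X_(inord 0) * mderiv (inord 1) p + 'X_(inord 1) * mderiv (inord 2) p.

Lemma tangent_linear : linear tangent.
Proof. by move=> c p q; rewrite /tangent !linearP /= !mulrDr -!scalerAr addrACA scalerDr. Qed.
HB.instance Definition _ := GRing.isLinear.Build k P3 P3 _ tangent tangent_linear.

Lemma tangentM p q : tangent (p * q) = p * tangent q + tangent p * q.
Proof. by rewrite /tangent !mderivM; ring. Qed.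

Lemma mderivXU (i j : 'I_3) : mderiv i 'X_j = (i == j)%:R :> P3.
Proof.
rewrite mderivX mnm1E eq_sym; case: eqP => [->|_]; last by rewrite scale0r.
have -> : (U_(j) - U_(j) = 0 :> 'X_{1..3})%MM by apply/mnmP => l; rewrite mnmBE subnn mnm0E.
by rewrite mpolyX0 scale1r.
Qed.

Lemma inord3_eq (i j : nat) : (i < 3)%N -> (j < 3)%N -> (inord i == inord j :> 'I_3) = (i == j).
Proof. by move=> i3 j3; rewrite -val_eqE /= !inordK. Qed.

Lemma tangentX (i : nat) : (i < 3)%N ->
  tangent 'X_(inord i) = nth 0 [:: 0; 'X_(inord 0); 'X_(inord 1)] i.
Proof.
move=> i3; rewrite /tangent !mderivXU !inord3_eq //.
by case: i i3 => [|[|[|]]] //= _; rewrite ?mulr0 ?mulr1 ?addr0 ?add0r.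
Qed.

Lemma tangent1 : tangent 1 = 0.
Proof. by rewrite /tangent -mpolyC1 !mderivC !mulr0 addr0. Qed.

Lemma tangent_quadric : tangent (quadric k) = 0.
Proof.
have -> : quadric k = 2%:R *: ('X_(inord 0) * 'X_(inord 2)) - 'X_(inord 1) * 'X_(inord 1) - 1.
  by rewrite /quadric expr2 scaler_nat -mulrA mulr_natl.
rewrite !linearB linearZ /= !tangentM !tangentX //= tangent1 subr0 mul0r addr0.
by rewrite [X in X - _]scaler_nat mulr2n [X in _ - (X + _)]mulrC subrr.
Qed.

Definition dQ (x : Q) : Q := projD (tangent (repr x)).

Lemma dQ_proj p : dQ (projD p) = projD (tangent p).
Proof.
have /asboolP[c e] := quot_projP (principal (quadric k)) p.
apply/eqP; rewrite quot_proj_eq -linearB e /= tangentM tangent_quadric mulr0 add0r.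
by apply/asboolP; exists (tangent c).
Qed.

Lemma dQ_linear : linear dQ.
Proof.
move=> c x y; have [p ->] := projDP x; have [q ->] := projDP y.
by rewrite -linearP !dQ_proj -linearP -linearP.
Qed.
HB.instance Definition _ := GRing.isLinear.Build k Q Q _ dQ dQ_linear.

Lemma dQ_leibniz x y : dQ (x * y) = x * dQ y + dQ x * y.
Proof.
have [p ->] := projDP x; have [q ->] := projDP y.
by rewrite -rmorphM !dQ_proj tangentM -!rmorphM -rmorphD.
Qed.

Definition valR (r : ringR k) : Q := subalg_val r.

Lemma valR_linear : linear valR.
Proof. by []. Qed.
HB.instance Definition _ := GRing.isLinear.Build k (ringR k) Q _ valR valR_linear.

Lemma valR_monoid : monoid_morphism valR.
Proof. by []. Qed.
HB.instance Definition _ := GRing.isMonoidMorphism.Build (ringR k) Q valR valR_monoid.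

Lemma valR_inj : injective valR.
Proof. exact: val_inj. Qed.

Lemma mu_valR r : mu (valR r) = valR r.
Proof. exact: (eqP (valP r)). Qed.

Lemma valR_im (x : Q) : mu x = x -> exists r, valR r = x.
Proof. by move=> /eqP e; exists (Subalg (e : x \in @mu_fixed k)). Qed.

Lemma quadric_lift (z0 z1 w : Q) : z0 * w = z1 ^+ 2 + 1 ->
  exists phi : {lrmorphism Q -> Q},
    [/\ phi (x0 k) = z0, phi (x1 k) = z1 & phi (y2 k) = w].
Proof.
move=> e; have e' : 2%:R * z0 * (2%:R^-1 *: w) - z1 ^+ 2 = 1.
  rewrite mulr_natl -scaler_nat -scalerAl -scalerAr scalerA mulfV ?two_neq0 //.
  by rewrite scale1r e addrAC subrr add0r.
have [phi [p0 p1 p2]] := lift_exists e'; exists phi; split=> //.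
by rewrite /y2 linearZ /= p2 scalerA mulfV ?two_neq0 // scale1r.
Qed.

Lemma quadric_der : exists d : derivation Q,
  [/\ d (x0 k) = 0, d (x1 k) = x0 k & d (y2 k) = 2%:R *: x1 k].
Proof.
exists (Derivation dQ_leibniz); split.
- by rewrite /= dQ_proj tangentX //= raddf0.
- by rewrite /= dQ_proj tangentX.
- by rewrite linearZ /= dQ_proj tangentX.
Qed.

Lemma mu_y2 : mu (y2 k) = - y2 k.
Proof. by rewrite /y2 linearZ /= mu_var scalerN. Qed.

Definition quadric_model : model Q (ringR k) :=
  @Model k Q (ringR k) (x0 k) (x1 k) (y2 k) (@mu k) valR (x0y2 k) (Psi_surj hk)
    (@Psi_inj k hk) quadric_lift quadric_der (mu_var k (inord 0)) (mu_var k (inord 1)) mu_y2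
    valR_inj mu_valR valR_im.

End QuadricUniversal.

Theorem theorem1p2 (k : fieldType) (hk : [pchar k] =i pred0) :
  strong_transitivity (ringR k) /\ plinth_invariant_is (ringR k) k^o.
Proof.
have M := quadric_model hk.
have [D [[Ds Dt Dz Dv Du] D_scale]] := std_exists hk M.
have tr := std_transitivity hk Ds Dt Dz Dv D_scale.
split=> //; split=> //; first exact: (std_not_poly hk Ds Dt Dz Dv Du).
move=> E /(conj_std hk Ds Dt Dz)[al [c [c0 H]]].
exact: (plinth_quotient hk Ds Dt Dv Du c0 H).
Qed.
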